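(* Let $(Q,W,C)$ be a reduced QP with an algebraic cut (i.e. $(Q,W,C)\in\mathcal W_1$), let $k$ be a strict source of $(Q,W,C)$, and put $\Lambda:=\mathcal P(Q,W,C)$. Then there is an algebra isomorphism $$\operatorname{End}_\Lambda(\nu_k^L(\Lambda))\cong\mathcal P(\mu_k^L(Q,W,C)),$$ where $\nu_k^L$ is the left tilting mutation at $k$.
   Context: $K$ is an algebraically closed field. All modules are left modules; the composition $fg$ of morphisms means first $f$, then $g$. For a quiver $Q$, an arrow or path $a$ goes from $s(a)$ to $e(a)$, and paths are composed from left to right. All quivers $Q$ underlying QPs are finite, connected and not just one vertex. $P_i=\Lambda e_i$; $\tau^-$ is the inverse Auslander–Reiten translation; $\Lambda/P_k$ is the direct sum of the $P_i$ with $i\neq k$. QPs: $\widehat{KQ}=\prod_{i\ge0}KQ_i$, where $KQ_i$ is the span of paths of length $i$; bars denote closure in the radical-adic topology. A QP is $(Q,W)$ with potential $W\in\prod_{i\ge2}KQ_{i,\rm cyc}$, where $KQ_{i,\rm cyc}$ is spanned by cycles of length $i$. The cyclic derivative $\partial_a$ is the continuous linear map with $\partial_a(a_1\cdots a_d)=\sum_{a_i=a}a_{i+1}\cdots a_da_1\cdots a_{i-1}$ on cycles. $\mathcal P(Q,W)=\widehat{KQ}/\overline{\langle\partial_aW\mid a\in Q_1\rangle}$. Potentials $W,W'$ are cyclically equivalent if $W-W'$ is in the closure of the span of all $a_1\cdots a_d-a_2\cdots a_da_1$ with $a_1\cdots a_d$ a cycle. A QP is reduced if $W\in\prod_{i\ge3}KQ_{i,\rm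 cyc}$, and trivial if $W$ is a linear combination of 2-cycles and $\mathcal P(Q,W)\cong\widehat{KQ_0}$. The direct sum of QPs with the same vertex set has the disjoint union of arrows and the sum of potentials. Cuts: $C\subset Q_1$ is a cut if each cycle appearing in $W$ contains exactly one arrow of $C$. $\mathcal P(Q,W,C)=\mathcal P(Q,W)/\overline{\langle C\rangle}=\widehat{KQ_C}/\overline{\langle\partial_cW\mid c\in C\rangle}$, where $Q_C$ has vertices $Q_0$ and arrows $Q_1\setminus C$. A vertex $k$ is a strict source if all arrows ending at $k$ belong to $C$ and all arrows starting at $k$ do not belong to $C$. $C$ is algebraic if (1) $\mathcal P(Q,W,C)$ is finite dimensional of global dimension at most 2, and (2) $\{\partial_cW\}_{c\in C}$ is a minimal set of generators of the ideal $\overline{\langle\partial_cW\mid c\in C\rangle}$ of $\widehat{KQ_C}$ (no $\partial_cW$ lies in the closed ideal generated by the others). $\mathcal W_1$ is the set of reduced QPs with algebraic cuts. Left tilting mutation: $\nu_k^L(\Lambda)$ is the direct sum of $\Lambda/P_k$ and the cokernel of a minimal left $\operatorname{add}(\Lambda/P_k)$-approximation of $P_k$; for $k$ a source and non-sink of the quiver of $\Lambda$ this is the APR tilting module $\tau^-P_k\oplus\Lambda/P_k$. Left mutation of graded QPs: a QP with cut $C$ is regarded as a $\mathbb Z$-graded QP, homogeneous of degree $1$, with $d=1$ on $C$ and $d=0$ on the other arrows. For $k$ not on a loop (with $W$ replaced, if necessary, by a cyclically equivalent potential no cycle of which starts at $k$), $\widetilde\mu_k^L(Q,W,d)=(Q',W',d')$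 where: $Q'$ is obtained from $Q$ by replacing each $a:k\to v$ by $a^*:v\to k$, each $b:u\to k$ by $b^*:k\to u$, and adding $[ba]:u\to v$ for each pair $u\xrightarrow{b}k\xrightarrow{a}v$; $W'=[W]+\sum_{e(b)=k=s(a)}[ba]a^*b^*$, with $[W]$ obtained from $W$ by replacing each composition $ba$ through $k$ by $[ba]$; $d'(a)=d(a)$ for arrows common to $Q$ and $Q'$, $d'(a^* )=-d(a)$ if $s(a)=k$, $d'(b^* )=-d(b)+1$ if $e(b)=k$, $d'([ba])=d(a)+d(b)$. For a strict source all these degrees are $0$ or $1$ and the degree $1$ arrows form a cut. Graded right-equivalence: a degree preserving algebra isomorphism of complete path algebras, identity on $\widehat{KQ_0}$, sending the first potential to one cyclically equivalent to the second. A graded QP with a cut is graded right-equivalent to a direct sum of a reduced one (its reduced part) and a trivial one, unique up to graded right-equivalence. $\mu_k^L(Q,W,C)$ is the reduced part of $\widetilde\mu_k^L(Q,W,C)$, with the cut given by its degree $1$ arrows. *)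

(* Defs.v *)
From HB Require Import structures.
From mathcomp Require Import all_boot all_algebra.
From mathcomp Require Import boolp.

Set Implicit Arguments.
Unset Strict Implicit.
Unset Printing Implicit Defensive.

Import GRing.Theory.
Local Open Scope ring_scope.
Local Open Scope quotient_scope.

(* A unital associative K-algebra, given by its structure map into the centre.
   MathComp's algType excludes the zero ring, and a quotient of a complete path
   algebra is not known beforehand to be nonzero. *)
Record kalgebra (K : comPzRingType) := KAlgebra {
  kalg_ring :> pzRingType;
  kalg_scal : {rmorphism K -> kalg_ring};
  kalg_central : forall (c : K) (x : kalg_ring),
    kalg_scal c * x = x * kalg_scal c
}.

Definition alg_isomorphic (K : comPzRingType) (A B : kalgebra K) : Prop :=
  exists f : {rmorphism A -> B},
    (forall c, f (kalg_scal A c) = kalg_scal B c) /\ bijective f.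

Definition finite_dimensional (K : comPzRingType) (A : kalgebra K) : Prop :=
  exists (n : nat) (b : 'I_n -> A),
    forall x : A, exists c : 'I_n -> K, x = \sum_i kalg_scal A (c i) * b i.

Definition lin_span (K : pzRingType) (A : lmodType K) (S : A -> Prop) (x : A) :=
  exists (n : nat) (c : 'I_n -> K) (s : 'I_n -> A),
    (forall i, S (s i)) /\ x = \sum_i c i *: s i.

Record ideal (A : pzRingType) := Ideal {
  mem_ideal :> A -> Prop;
  ideal0 : mem_ideal 0;
  idealD : forall x y, mem_ideal x -> mem_ideal y -> mem_ideal (x + y);
  idealMl : forall a x, mem_ideal x -> mem_ideal (a * x);
  idealMr : forall a x, mem_ideal x -> mem_ideal (x * a)
}.

Definition ideal_span (A : pzRingType) (S : A -> Prop) (x : A) : Prop :=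
  exists (n : nat) (a s b : 'I_n -> A),
    (forall i, S (s i)) /\ x = \sum_i a i * s i * b i.

Section QuotientRing.
Variables (A : pzRingType) (I : ideal A).

Definition ideal_pred : A -> bool := fun x => `[< I x >].

Lemma idealN x : I x -> I (- x).
Proof. by rewrite -mulN1r; apply: idealMl. Qed.

Lemma ideal_pred_zmod_closed : zmod_closed ideal_pred.
Proof.
split=> [|x y]; first exact/asboolP/ideal0.
move=> /asboolP Ix /asboolP Iy.
by apply/asboolP/idealD => //; apply: idealN.
Qed.

HB.instance Definition _ :=
  GRing.isZmodClosed.Build A ideal_pred ideal_pred_zmod_closed.

Definition ideal_zmod : zmodClosed A := GRing.ZmodClosed.clone A ideal_pred _.

Definition quot_ring : Type := Quotient.quot ideal_zmod.

HB.instance Definition _ := GRing.Zmodule.on quot_ring.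

Definition quot_pi (x : A) : quot_ring := \pi_(Quotient.quot ideal_zmod) x.
Definition quot_repr (u : quot_ring) : A :=
  repr (u : Quotient.quot ideal_zmod).

Lemma quot_reprK u : quot_pi (quot_repr u) = u.
Proof. exact: reprK. Qed.

Lemma quot_piP x y : quot_pi x = quot_pi y <-> I (x - y).
Proof.
rewrite /quot_pi; split=> [/eqP|Ixy].
  by rewrite -Quotient.idealrBE => /asboolP.
by apply/eqP; rewrite -Quotient.idealrBE; apply/asboolP.
Qed.

Lemma quot_piD x y : quot_pi (x + y) = quot_pi x + quot_pi y.
Proof. exact: (raddfD (\pi_(Quotient.quot ideal_zmod))). Qed.

Definition quot_one : quot_ring := quot_pi 1.
Definition quot_mul (u v : quot_ring) : quot_ring :=
  quot_pi (quot_repr u * quot_repr v).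

Lemma quot_piM x y : quot_mul (quot_pi x) (quot_pi y) = quot_pi (x * y).
Proof.
have Ir z : I (quot_repr (quot_pi z) - z) by apply/quot_piP/quot_reprK.
apply/quot_piP; set x' := quot_repr _; set y' := quot_repr _.
have -> : x' * y' - x * y = x' * (y' - y) + (x' - x) * y.
  by rewrite mulrBr mulrBl addrA subrK.
by apply: idealD; [exact: idealMl (Ir y) | exact: idealMr (Ir x)].
Qed.

Lemma quot_mulA : associative quot_mul.
Proof.
move=> u v w; rewrite -(quot_reprK u) -(quot_reprK v) -(quot_reprK w).
by rewrite !quot_piM mulrA.
Qed.

Lemma quot_mul1l : left_id quot_one quot_mul.
Proof. by move=> u; rewrite -(quot_reprK u) quot_piM mul1r. Qed.

Lemma quot_mul1r : right_id quot_one quot_mul.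
Proof. by move=> u; rewrite -(quot_reprK u) quot_piM mulr1. Qed.

Lemma quot_mulDl : left_distributive quot_mul +%R.
Proof.
move=> u v w; rewrite -(quot_reprK u) -(quot_reprK v) -(quot_reprK w).
by rewrite -quot_piD !quot_piM mulrDl quot_piD.
Qed.

Lemma quot_mulDr : right_distributive quot_mul +%R.
Proof.
move=> u v w; rewrite -(quot_reprK u) -(quot_reprK v) -(quot_reprK w).
by rewrite -quot_piD !quot_piM mulrDr quot_piD.
Qed.

HB.instance Definition _ := GRing.Zmodule_isPzRing.Build quot_ring
  quot_mulA quot_mul1l quot_mul1r quot_mulDl quot_mulDr.

Lemma quot_pi_zmod_morphism : zmod_morphism quot_pi.
Proof. exact: (raddfB (\pi_(Quotient.quot ideal_zmod))). Qed.

Lemma quot_pi_monoid_morphism : monoid_morphism quot_pi.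
Proof. by split=> // x y; rewrite -quot_piM. Qed.

HB.instance Definition _ :=
  GRing.isZmodMorphism.Build A quot_ring quot_pi quot_pi_zmod_morphism.
HB.instance Definition _ :=
  GRing.isMonoidMorphism.Build A quot_ring quot_pi quot_pi_monoid_morphism.

End QuotientRing.

Section QuotientAlgebra.
Variables (K : comPzRingType) (A : kalgebra K) (I : ideal A).

Lemma quot_central (c : K) (u : quot_ring I) :
  (@quot_pi _ I \o kalg_scal A) c * u = u * (@quot_pi _ I \o kalg_scal A) c.
Proof. by rewrite -(quot_reprK u) /= -!rmorphM kalg_central. Qed.

Definition quot_alg : kalgebra K := KAlgebra quot_central.

End QuotientAlgebra.

Section Modules.
Variable R : pzRingType.
Implicit Types M N X Y P L T : lmodType R.

Definition mod_isomorphic M N : Prop :=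
  exists f : {linear M -> N}, bijective f.

Definition projective P : Prop :=
  forall X Y (g : {linear X -> Y}) (f : {linear P -> Y}),
    (forall y, exists x, g x = y) ->
    exists h : {linear P -> X}, forall p, g (h p) = f p.

(* 0 -> L -> M -> N -> 0 *)
Definition short_exact L M N (i : {linear L -> M}) (p : {linear M -> N}) :=
  [/\ injective i, (forall y, exists x, p x = y)
    & forall x, p x = 0 <-> exists l, x = i l].

(* M has a projective resolution of length at most n *)
Fixpoint proj_dim_le (n : nat) M : Prop :=
  if n is m.+1 then
    exists L P (i : {linear L -> P}) (p : {linear P -> M}),
      [/\ projective P, short_exact i p & proj_dim_le m L]
  else projective M.

Definition gl_dim_le (n : nat) : Prop := forall M, proj_dim_le n M.

(* X is a direct summand of a finite direct sum of copies of M *)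
Definition in_add M X : Prop :=
  exists (n : nat) (i : {linear X -> {ffun 'I_n -> M}})
    (r : {linear {ffun 'I_n -> M} -> X}), cancel i r.

Definition left_approximation M P X (f : {linear P -> X}) : Prop :=
  in_add M X /\
  forall Y (g : {linear P -> Y}), in_add M Y ->
    exists h : {linear X -> Y}, forall p, h (f p) = g p.

Definition left_minimal P X (f : {linear P -> X}) : Prop :=
  forall h : {linear X -> X}, (forall p, h (f p) = f p) -> bijective h.

Definition is_cokernel X Y N (f : {linear X -> Y}) (g : {linear Y -> N}) :=
  (forall z, exists y, g y = z) /\ (forall y, g y = 0 <-> exists x, y = f x).

End Modules.

(* The left ideal A e, as a left A-module *)
Section LeftIdeal.
Variables (A : pzRingType) (e : A).

Definition left_ideal_pred : A^o -> bool :=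
  fun x => `[< exists y : A, x = y * e >].

Lemma left_ideal_pred_closed : subsemimod_closed left_ideal_pred.
Proof.
split; first split.
- by apply/asboolP; exists 0; rewrite mul0r.
- move=> x y /asboolP[x' ->] /asboolP[y' ->].
  by apply/asboolP; exists (x' + y'); rewrite mulrDl.
- move=> a x /asboolP[x' ->]; apply/asboolP; exists (a * x').
  by rewrite -mulrA.
Qed.

Definition left_ideal : Type := {x : A^o | left_ideal_pred x}.

HB.instance Definition _ := [isSub of left_ideal for @sval _ _].
HB.instance Definition _ := [Choice of left_ideal by <:].
HB.instance Definition _ := GRing.SubChoice_isSubLmodule.Build
  A A^o left_ideal_pred left_ideal left_ideal_pred_closed.

End LeftIdeal.

(* Morphisms are composed from left to right: the product f * g of two
   endomorphisms is "first f, then g". *)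
Section EndomorphismRing.
Variables (A : pzRingType) (M : lmodType A).

Record endo := Endo { endo_fun :> M -> M; endoP : `[< linear endo_fun >] }.

HB.instance Definition _ := [isSub for endo_fun].
HB.instance Definition _ := [Choice of endo by <:].

Implicit Types f g h : endo.

Lemma endo_eq f g : f =1 g -> f = g.
Proof. by move=> fg; apply/val_inj/funext. Qed.

Lemma endo_linear f : linear f.
Proof. exact/asboolP/endoP. Qed.

HB.instance Definition _ f := GRing.isLinear.Build A M M *:%R f (endo_linear f).

Definition endo_of (f : {linear M -> M}) : endo :=
  Endo (introT (asboolP (linear f)) (linearP f)).

Definition endo_zero : endo := endo_of \0.
Definition endo_opp f : endo := endo_of (\- f).
Definition endo_add f g : endo := endo_of (f \+ g).
Definition endo_one : endo := endo_of idfun.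
Definition endo_mul f g : endo := endo_of (g \o f).

Lemma endo_addA : associative endo_add.
Proof. by move=> f g h; apply: endo_eq => x /=; rewrite addrA. Qed.
Lemma endo_addC : commutative endo_add.
Proof. by move=> f g; apply: endo_eq => x /=; rewrite addrC. Qed.
Lemma endo_add0 : left_id endo_zero endo_add.
Proof. by move=> f; apply: endo_eq => x /=; rewrite add0r. Qed.
Lemma endo_addN : left_inverse endo_zero endo_opp endo_add.
Proof. by move=> f; apply: endo_eq => x /=; rewrite addNr. Qed.

HB.instance Definition _ :=
  GRing.isZmodule.Build endo endo_addA endo_addC endo_add0 endo_addN.

Lemma endo_mulA : associative endo_mul.
Proof. by move=> f g h; apply: endo_eq. Qed.
Lemma endo_mul1l : left_id endo_one endo_mul.
Proof. by move=> f; apply: endo_eq. Qed.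
Lemma endo_mul1r : right_id endo_one endo_mul.
Proof. by move=> f; apply: endo_eq. Qed.
Lemma endo_mulDl : left_distributive endo_mul +%R.
Proof. by move=> f g h; apply: endo_eq => x /=; rewrite linearD. Qed.
Lemma endo_mulDr : right_distributive endo_mul +%R.
Proof. by move=> f g h; apply: endo_eq. Qed.

HB.instance Definition _ := GRing.Zmodule_isPzRing.Build endo
  endo_mulA endo_mul1l endo_mul1r endo_mulDl endo_mulDr.

End EndomorphismRing.

Section EndomorphismAlgebra.
Variables (K : comPzRingType) (A : kalgebra K) (M : lmodType A).

Definition endo_scal_fun (c : K) (x : M) : M := kalg_scal A c *: x.

Lemma endo_scal_linear c : linear (endo_scal_fun c).
Proof.
by move=> a x y; rewrite /endo_scal_fun scalerDr !scalerA kalg_central.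
Qed.

Definition endo_scal (c : K) : endo M :=
  Endo (introT (asboolP _) (endo_scal_linear c)).

Lemma endo_scal_zmod_morphism : zmod_morphism endo_scal.
Proof.
move=> c d; apply: endo_eq => x.
by rewrite /= /endo_scal_fun rmorphB scalerBl.
Qed.

Lemma endo_scal_monoid_morphism : monoid_morphism endo_scal.
Proof.
split=> [|c d]; apply: endo_eq => x; rewrite /= /endo_scal_fun.
  by rewrite rmorph1 scale1r.
by rewrite rmorphM scalerA kalg_central.
Qed.

HB.instance Definition _ :=
  GRing.isZmodMorphism.Build K (endo M) endo_scal endo_scal_zmod_morphism.
HB.instance Definition _ :=
  GRing.isMonoidMorphism.Build K (endo M) endo_scal endo_scal_monoid_morphism.

Lemma endo_central (c : K) (f : endo M) : endo_scal c * f = f * endo_scal c.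
Proof. by apply: endo_eq => x; rewrite /= /endo_scal_fun linearZ. Qed.

Definition endo_alg : kalgebra K := KAlgebra endo_central.

End EndomorphismAlgebra.

Record quiver (V : finType) := Quiver {
  arrow :> finType;
  src : arrow -> V;
  tgt : arrow -> V
}.
Arguments src {V Q} a : rename.
Arguments tgt {V Q} a : rename.

Section Quiver.
Variables (V : finType) (Q : quiver V).

Definition adjacent (u v : V) : bool :=
  [exists a : Q, (src a == u) && (tgt a == v) || (src a == v) && (tgt a == u)].

Definition connected_quiver : Prop := forall u v : V, connect adjacent u v.

Definition one_vertex_quiver : Prop := #|V| = 1%N /\ #|Q| = 0%N.

(* Paths are composed from left to right: a word a_1 ... a_n has
   tgt a_i = src a_(i+1). *)
Fixpoint walk (v : V) (l : seq Q) : bool :=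
  if l is a :: l' then (src a == v) && walk (tgt a) l' else true.

Definition walk_end (v : V) (l : seq Q) : V := last v (map tgt l).

Lemma walk_cat v l1 l2 :
  walk v (l1 ++ l2) = walk v l1 && walk (walk_end v l1) l2.
Proof. by elim: l1 v => [|a l1 IH] v //=; rewrite IH andbA. Qed.

Lemma walk_take i v l : walk v l -> walk v (take i l).
Proof. by rewrite -{1}(cat_take_drop i l) walk_cat => /andP[]. Qed.

Lemma walk_drop i v l : walk v l -> walk (walk_end v (take i l)) (drop i l).
Proof. by rewrite -{1}(cat_take_drop i l) walk_cat => /andP[]. Qed.

Definition qpath : Type := {x : V * seq Q | walk x.1 x.2}.
HB.instance Definition _ := [isSub of qpath for @sval _ _].
HB.instance Definition _ := [Countable of qpath by <:].

Definition pstart (p : qpath) : V := (val p).1.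
Definition pword (p : qpath) : seq Q := (val p).2.
Definition pend (p : qpath) : V := walk_end (pstart p) (pword p).
Definition plen (p : qpath) : nat := size (pword p).
Definition is_cycle (p : qpath) : bool := pstart p == pend p.

Definition ptake (i : nat) (p : qpath) : qpath :=
  exist _ (pstart p, take i (pword p)) (walk_take i (valP p)).
Definition pdrop (i : nat) (p : qpath) : qpath :=
  exist _ (walk_end (pstart p) (take i (pword p)), drop i (pword p))
    (walk_drop i (valP p)).

Lemma ptake_take i j p : (i <= j)%N -> ptake i (ptake j p) = ptake i p.
Proof. by move=> le_ij; apply: val_inj; rewrite /= /pword /= take_takel. Qed.

Lemma pdrop_take i j p :
  (i <= j)%N -> pdrop i (ptake j p) = ptake (j - i) (pdrop i p).
Proof.
move=> le_ij; apply: val_inj; rewrite /= /pword /pstart /= take_takel //.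
by rewrite take_drop subnK.
Qed.

Lemma pdrop_drop i j p :
  (i <= j)%N -> pdrop (j - i) (pdrop i p) = pdrop j p.
Proof.
move=> le_ij; apply: val_inj; rewrite /= /pword /pstart /=.
rewrite drop_drop subnK //; congr (_, _).
rewrite /walk_end -last_cat -map_cat; congr (last _ (map _ _)).
by rewrite take_drop subnK // -{1}(take_takel _ le_ij) cat_take_drop.
Qed.

Lemma ptake_size p : ptake (plen p) p = p.
Proof. by apply: val_inj; case: p => -[v l] vl; rewrite /= /pstart /pword take_size. Qed.

Lemma pdrop0 p : pdrop 0 p = p.
Proof. by apply: val_inj; case: p => -[v l] vl; rewrite /= /pstart /pword take0 drop0. Qed.

End Quiver.

Lemma triangular_sum (T : nmodType) (F : nat -> nat -> T) n :
  \sum_(0 <= j < n) \sum_(0 <= m < n - j) F j m =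
  \sum_(0 <= i < n) \sum_(0 <= j < i.+1) F j (i - j)%N.
Proof.
elim: n => [|n IH]; first by rewrite !big_nil.
rewrite [RHS]big_nat_recr //= -IH.
transitivity (\sum_(0 <= j < n.+1)
    (\sum_(0 <= m < n - j) F j m + F j (n - j)%N)).
  apply: eq_big_nat => j /andP[_ lt_jn].
  by rewrite subSn // big_nat_recr.
rewrite big_split /= [X in X + _ = _]big_nat_recr //=.
by rewrite subnn (big_geq (leqnn 0)) addr0.
Qed.

(* The complete path algebra: the product over all i of the spans of the paths
   of length i is the space of all functions from paths to K, a function being
   the family of coefficients of a formal sum of paths. *)
Section CompletePathAlgebra.
Variables (K : comPzRingType) (V : finType) (Q : quiver V).

Definition cpa : Type := qpath Q -> K.

HB.instance Definition _ := gen_eqMixin cpa.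
HB.instance Definition _ := gen_choiceMixin cpa.

Implicit Types f g h : cpa.

Definition cpa_zero : cpa := fun _ => 0.
Definition cpa_opp f : cpa := fun p => - f p.
Definition cpa_add f g : cpa := fun p => f p + g p.
Definition cpa_one : cpa := fun p => (pword p == [::])%:R.
Definition cpa_mul f g : cpa := fun p =>
  \sum_(i < (plen p).+1) f (ptake i p) * g (pdrop i p).
Definition cpa_scale (c : K) f : cpa := fun p => c * f p.

Lemma cpa_addA : associative cpa_add.
Proof. by move=> f g h; apply/funext => p; rewrite /cpa_add addrA. Qed.
Lemma cpa_addC : commutative cpa_add.
Proof. by move=> f g; apply/funext => p; rewrite /cpa_add addrC. Qed.
Lemma cpa_add0 : left_id cpa_zero cpa_add.
Proof. by move=> f; apply/funext => p; rewrite /cpa_add add0r. Qed.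
Lemma cpa_addN : left_inverse cpa_zero cpa_opp cpa_add.
Proof. by move=> f; apply/funext => p; rewrite /cpa_add addNr. Qed.

HB.instance Definition _ :=
  GRing.isZmodule.Build cpa cpa_addA cpa_addC cpa_add0 cpa_addN.

Lemma cpa_mulA : associative cpa_mul.
Proof.
move=> f g h; apply/funext => p; rewrite /cpa_mul.
set n := plen p.
pose F j m := f (ptake j p) * g (ptake m (pdrop j p)) * h (pdrop m (pdrop j p)).
transitivity (\sum_(0 <= j < n.+1) \sum_(0 <= m < n.+1 - j) F j m).
  rewrite big_mkord; apply: eq_bigr => j _; rewrite big_mkord big_distrr /=.
  rewrite subSn -1?ltnS ?ltn_ord // /plen /pword size_drop.
  by apply: eq_bigr => m _; rewrite mulrA.
rewrite triangular_sum big_mkord; apply: eq_bigr => i _.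
have le_in : (i <= n)%N by rewrite -ltnS.
rewrite big_mkord big_distrl /= /plen /pword size_takel //.
apply: eq_bigr => j _; have le_ji : (j <= i)%N by rewrite -ltnS.
by rewrite /F ptake_take // pdrop_take // pdrop_drop.
Qed.

Lemma cpa_mul1l : left_id cpa_one cpa_mul.
Proof.
move=> f; apply/funext => p; rewrite /cpa_mul big_ord_recl /= pdrop0.
rewrite big1 => [|i _].
  by rewrite /cpa_one /pword /= take0 eqxx mul1r addr0.
by rewrite /cpa_one -size_eq0 /pword /= size_takel ?mul0r.
Qed.

Lemma cpa_mul1r : right_id cpa_one cpa_mul.
Proof.
move=> f; apply/funext => p; rewrite /cpa_mul big_ord_recr /= ptake_size.
rewrite big1 => [|i _].
  by rewrite /cpa_one /pword /= drop_size eqxx mulr1 add0r.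
rewrite /cpa_one -size_eq0 /pword /= size_drop subn_eq0 leqNgt.
by rewrite -/(pword p) -/(plen p) ltn_ord mulr0.
Qed.

Lemma cpa_mulDl : left_distributive cpa_mul +%R.
Proof.
move=> f g h; apply/funext => p.
rewrite /cpa_mul /+%R /= /cpa_add -big_split /=.
by apply: eq_bigr => i _; rewrite mulrDl.
Qed.

Lemma cpa_mulDr : right_distributive cpa_mul +%R.
Proof.
move=> f g h; apply/funext => p.
rewrite /cpa_mul /+%R /= /cpa_add -big_split /=.
by apply: eq_bigr => i _; rewrite mulrDr.
Qed.

HB.instance Definition _ := GRing.Zmodule_isPzRing.Build cpa
  cpa_mulA cpa_mul1l cpa_mul1r cpa_mulDl cpa_mulDr.

Lemma cpa_scaleA c d f : cpa_scale c (cpa_scale d f) = cpa_scale (c * d) f.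
Proof. by apply/funext => p; rewrite /cpa_scale mulrA. Qed.
Lemma cpa_scale1 : left_id 1 cpa_scale.
Proof. by move=> f; apply/funext => p; rewrite /cpa_scale mul1r. Qed.
Lemma cpa_scaleDr : right_distributive cpa_scale +%R.
Proof. by move=> c f g; apply/funext => p; apply: mulrDr. Qed.
Lemma cpa_scaleDl f : {morph cpa_scale^~ f : c d / c + d}.
Proof. by move=> c d; apply/funext => p; apply: mulrDl. Qed.

HB.instance Definition _ := GRing.Zmodule_isLmodule.Build K cpa
  cpa_scaleA cpa_scale1 cpa_scaleDr cpa_scaleDl.

Lemma cpaDE f g p : (f + g) p = f p + g p. Proof. by []. Qed.
Lemma cpaNE f p : (- f) p = - f p. Proof. by []. Qed.
Lemma cpaZE (c : K) f p : (c *: f) p = c * f p. Proof. by []. Qed.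
Lemma cpaME f g p :
  (f * g) p = \sum_(i < (plen p).+1) f (ptake i p) * g (pdrop i p).
Proof. by []. Qed.

Lemma cpa_scalerAl (c : K) (f g : cpa) : c *: (f * g) = (c *: f) * g.
Proof.
apply/funext => p; rewrite cpaZE !cpaME big_distrr /=.
by apply: eq_bigr => i _; rewrite cpaZE mulrA.
Qed.

Lemma cpa_scalerAr (c : K) (f g : cpa) : c *: (f * g) = f * (c *: g).
Proof.
apply/funext => p; rewrite cpaZE !cpaME big_distrr /=.
by apply: eq_bigr => i _; rewrite cpaZE mulrCA.
Qed.

Definition cpa_scal (c : K) : cpa := c *: (1 : cpa).

Lemma cpa_scal_zmod_morphism : zmod_morphism cpa_scal.
Proof. by move=> c d; rewrite /cpa_scal scalerBl. Qed.

Lemma cpa_scal_monoid_morphism : monoid_morphism cpa_scal.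
Proof.
split=> [|c d]; rewrite /cpa_scal ?scale1r //.
by rewrite -cpa_scalerAl mul1r scalerA.
Qed.

HB.instance Definition _ :=
  GRing.isZmodMorphism.Build K cpa cpa_scal cpa_scal_zmod_morphism.
HB.instance Definition _ :=
  GRing.isMonoidMorphism.Build K cpa cpa_scal cpa_scal_monoid_morphism.

Lemma cpa_central (c : K) f : cpa_scal c * f = f * cpa_scal c.
Proof.
by rewrite /cpa_scal -cpa_scalerAl -cpa_scalerAr mul1r mulr1.
Qed.

Definition cpa_alg : kalgebra K := KAlgebra cpa_central.

End CompletePathAlgebra.

Section PathAlgebraElements.
Variables (K : comPzRingType) (V : finType) (Q : quiver V).
Implicit Types (f g : cpa K Q) (S : cpa K Q -> Prop).

(* The basis element of a path (start and list of arrows); it is 0 if the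
   arrows do not form a path from v. *)
Definition path_elt (v : V) (l : seq Q) : cpa K Q :=
  fun p => (val p == (v, l))%:R.
Definition vertex_elt (v : V) : cpa K Q := path_elt v [::].
Definition arrow_elt (a : Q) : cpa K Q := path_elt (src a) [:: a].

(* The coefficient of a path; it is 0 if the arrows do not form a path. *)
Definition coef f (v : V) (l : seq Q) : K := oapp f 0 (insub (v, l)).

(* The n-th power of the radical consists of the elements whose coefficients
   vanish on all paths of length < n, since Q is finite. *)
Definition congr_rad (n : nat) f g : Prop :=
  forall p, (plen p < n)%N -> f p = g p.
Definition rad_closure S f : Prop :=
  forall n : nat, exists2 g, S g & congr_rad n f g.

End PathAlgebraElements.

Section ClosedIdeals.

Section Span.
Variables (A : pzRingType) (S : A -> Prop).

Lemma ideal_span0 : ideal_span S 0.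
Proof.
have z : 'I_0 -> A by move=> _; exact: 0.
by exists 0%N, z, z, z; split=> [[]|] //; rewrite big_ord0.
Qed.

Lemma ideal_spanD x y : ideal_span S x -> ideal_span S y -> ideal_span S (x + y).
Proof.
move=> [m [a [s [b [Ss ->]]]]] [n [a' [s' [b' [Ss' ->]]]]].
pose j (f : 'I_m -> A) (g : 'I_n -> A) (i : 'I_(m + n)) : A :=
  match split i with inl i1 => f i1 | inr i2 => g i2 end.
exists (m + n)%N, (j a a'), (j s s'), (j b b'); split=> [i|].
  by rewrite /j; case: split.
rewrite big_split_ord /=; congr (_ + _); apply: eq_bigr => i _; rewrite /j.
  by rewrite (unsplitK (inl _ i)).
by rewrite (unsplitK (inr _ i)).
Qed.

Lemma ideal_spanMl c x : ideal_span S x -> ideal_span S (c * x).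
Proof.
move=> [m [a [s [b [Ss ->]]]]].
exists m, (fun i => c * a i), s, b; split=> //.
by rewrite big_distrr /=; apply: eq_bigr => i _; rewrite !mulrA.
Qed.

Lemma ideal_spanMr c x : ideal_span S x -> ideal_span S (x * c).
Proof.
move=> [m [a [s [b [Ss ->]]]]].
exists m, a, s, (fun i => b i * c); split=> //.
by rewrite big_distrl /=; apply: eq_bigr => i _; rewrite !mulrA.
Qed.

Definition generated_ideal : ideal A :=
  Ideal ideal_span0 ideal_spanD ideal_spanMl ideal_spanMr.

End Span.

Variables (K : comPzRingType) (V : finType) (Q : quiver V).
Implicit Type I : ideal (cpa K Q).

Lemma rad_closure0 I : rad_closure I 0.
Proof. by move=> n; exists 0 => //; apply: ideal0. Qed.

Lemma rad_closureD I f g :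
  rad_closure I f -> rad_closure I g -> rad_closure I (f + g).
Proof.
move=> If Ig n; have [f' If' ff'] := If n; have [g' Ig' gg'] := Ig n.
exists (f' + g'); first exact: idealD.
by move=> p lt_pn; rewrite !cpaDE ff' // gg'.
Qed.

Lemma rad_closureMl I c f : rad_closure I f -> rad_closure I (c * f).
Proof.
move=> If n; have [f' If' ff'] := If n.
exists (c * f'); first exact: idealMl.
move=> p lt_pn; rewrite !cpaME; apply: eq_bigr => i _; congr (_ * _).
apply: ff'; apply: leq_ltn_trans lt_pn.
by rewrite /plen /pword /= size_drop leq_subr.
Qed.

Lemma rad_closureMr I c f : rad_closure I f -> rad_closure I (f * c).
Proof.
move=> If n; have [f' If' ff'] := If n.
exists (f' * c); first exact: idealMr.
move=> p lt_pn; rewrite !cpaME; apply: eq_bigr => i _; congr (_ * _).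
apply: ff'; apply: leq_ltn_trans lt_pn.
by rewrite /plen /pword /= size_take; case: ltnP => // /ltnW.
Qed.

Definition closure_ideal I : ideal (cpa K Q) :=
  Ideal (@rad_closure0 I) (@rad_closureD I) (@rad_closureMl I)
    (@rad_closureMr I).

Definition closed_ideal (S : cpa K Q -> Prop) : ideal (cpa K Q) :=
  closure_ideal (generated_ideal S).

End ClosedIdeals.

Section Potentials.
Variables (K : comPzRingType) (V : finType) (Q : quiver V).
Implicit Types W : cpa K Q.

(* W lies in the product over i >= m of the spans of the cycles of length i *)
Definition cyclic_from (m : nat) W : Prop :=
  forall p, W p != 0 -> is_cycle p /\ (m <= plen p)%N.

Definition is_potential W : Prop := cyclic_from 2 W.
Definition is_reduced W : Prop := cyclic_from 3 W.

(* a_1 ... a_d |-> sum over a_i = a of a_{i+1} ... a_d a_1 ... a_{i-1} *)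
Definition cyc_der_word (a : Q) (l : seq Q) : cpa K Q :=
  \sum_(i < size l | nth a l i == a)
    path_elt K (tgt a) (drop i.+1 l ++ take i l).

(* The continuous linear extension: only the finitely many cycles of length
   n + 1 contribute to the coefficient of a path of length n. *)
Definition cyc_der (a : Q) W : cpa K Q := fun p =>
  \sum_(t : (plen p).+1.-tuple Q)
    coef W (src (thead t)) t * cyc_der_word a t p.

Lemma coef_path_elt (p : qpath Q) v l :
  coef (path_elt K (pstart p) (pword p)) v l = ((v, l) == val p)%:R.
Proof.
rewrite /coef; case: insubP => [q _ vq|/negP nvl].
  by rewrite -vq /= /path_elt /pstart /pword -surjective_pairing.
by case: eqP => // vl; case: nvl; have := valP p; rewrite -vl.
Qed.

Lemma cyc_der_path_elt (a : Q) (p : qpath Q) : (0 < plen p)%N ->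
  cyc_der a (path_elt K (pstart p) (pword p)) = cyc_der_word a (pword p).
Proof.
move=> p_gt0; apply/funext => q; rewrite /cyc_der.
have [eq_pq|neq_pq] := eqVneq (plen q).+1 (plen p); last first.
  rewrite big1 => [|t _]; last first.
    rewrite coef_path_elt; case: eqP => [vt|]; last by rewrite mul0r.
    by case/eqP: neq_pq; rewrite /plen /pword -vt /= size_tuple.
  rewrite /cyc_der_word; elim/big_ind: _ => // [f g f0 g0|i _].
    by rewrite cpaDE -f0 -g0 addr0.
  rewrite /path_elt; case: eqP => // vq; case/eqP: neq_pq.
  rewrite {1}/plen /pword vq /= size_cat size_drop size_takel 1?ltnW //.
  by rewrite -addSn -subSn ?ltn_ord // subSS subnK // ltnW.
have szp : size (pword p) == (plen q).+1 by rewrite eq_pq.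
rewrite (bigD1 (Tuple szp)) //= big1 => [|t /negP nt].
  rewrite addr0 coef_path_elt.
  suff -> : (src (thead (Tuple szp)), tval (Tuple szp)) == val p.
    by rewrite mul1r.
  have : tval (Tuple szp) = pword p by [].
  move: (Tuple szp) => t {szp eq_pq}; case: p p_gt0 => -[v [|b l]] //= vp _ vt.
  case/andP: (vp) => /= /eqP sb _.
  have tb : thead t = b by rewrite /thead (tnth_nth b) vt.
  by rewrite tb sb vt.
rewrite coef_path_elt; case: eqP => [vt|]; last by rewrite mul0r.
by case: nt; apply/eqP/val_inj; rewrite /= /pword -vt.
Qed.

Definition rotation_diff (f : cpa K Q) : Prop :=
  exists (a : Q) (l : seq Q),
    [/\ walk (src a) (a :: l), walk_end (src a) (a :: l) = src a
      & f = path_elt K (src a) (a :: l) - path_elt K (tgt a) (rcons l a)].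

Definition cyc_equiv W W' : Prop :=
  rad_closure (lin_span rotation_diff) (W - W').

Definition jacobian_alg W : kalgebra K :=
  quot_alg (A := cpa_alg K Q)
    (closed_ideal (fun f => exists a : Q, f = cyc_der a W)).

Definition is_cut W (C : {set Q}) : Prop :=
  forall p, W p != 0 -> count [in C] (pword p) = 1%N.

Definition cut_quiver (C : {set Q}) : quiver V :=
  @Quiver V {a : Q | a \notin C} (fun a => src (val a)) (fun a => tgt (val a)).

(* The part of f supported on the paths without arrows in C *)
Definition cut_restrict (C : {set Q}) (f : cpa K Q) : cpa K (cut_quiver C) :=
  fun p => coef f (pstart p) (map val (pword p)).
Arguments cut_restrict : clear implicits.

Definition cut_relation W (C : {set Q}) (c : Q) : cpa K (cut_quiver C) :=
  cut_restrict C (cyc_der c W).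
Arguments cut_relation : clear implicits.

Definition cut_jacobian W (C : {set Q}) : kalgebra K :=
  quot_alg (A := cpa_alg K (cut_quiver C))
    (closed_ideal (fun f => exists2 c, c \in C & f = cut_relation W C c)).

Definition vertex_idem W (C : {set Q}) (i : V) : cut_jacobian W C :=
  quot_pi _ (vertex_elt K (Q := cut_quiver C) i).

Definition minimal_cut_relations W (C : {set Q}) : Prop :=
  forall c, c \in C ->
    ~ closed_ideal
        (fun f => exists2 c', c' \in C :\ c & f = cut_relation W C c')
        (cut_relation W C c).

Definition algebraic_cut W (C : {set Q}) : Prop :=
  [/\ is_cut W C, finite_dimensional (cut_jacobian W C),
      gl_dim_le (cut_jacobian W C) 2 & minimal_cut_relations W C].

Definition strict_source (C : {set Q}) (k : V) : Prop :=
  forall a : Q, (tgt a = k -> a \in C) /\ (src a = k -> a \notin C).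

End Potentials.

Record graded_QP (K : comPzRingType) (V : finType) := GradedQP {
  gquiver : quiver V;
  gpot : cpa K gquiver;
  gdeg : gquiver -> int
}.
Arguments gpot {K V} g.
Arguments gdeg {K V} g a.

Section GradedQPs.
Variables (K : comPzRingType) (V : finType).

Definition path_deg (Q : quiver V) (d : Q -> int) (p : qpath Q) : int :=
  \sum_(a <- pword p) d a.

Definition homogeneous (Q : quiver V) (d : Q -> int) (n : int) (f : cpa K Q) :=
  forall p, f p != 0 -> path_deg d p = n.

Definition is_graded_QP (X : graded_QP K V) : Prop :=
  is_potential (gpot X) /\ homogeneous (gdeg X) 1 (gpot X).

Definition cut_deg (Q : quiver V) (C : {set Q}) (a : Q) : int :=
  if a \in C then 1 else 0.

Definition degree_one_arrows (X : graded_QP K V) : {set gquiver X} :=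
  [set a | gdeg X a == 1].

Definition is_trivial (X : graded_QP K V) : Prop :=
  (forall p, gpot X p != 0 -> is_cycle p /\ plen p = 2%N) /\
  alg_isomorphic (jacobian_alg (gpot X))
    (cpa_alg K (@Quiver V void (of_void V) (of_void V))).

Section DirectSum.
Variables Q Q' : quiver V.

Definition sum_quiver : quiver V :=
  @Quiver V (Q + Q')%type
    (fun x => match x with inl a => src a | inr b => src b end)
    (fun x => match x with inl a => tgt a | inr b => tgt b end).

Definition get_inl (x : sum_quiver) : option Q :=
  if x is inl a then Some a else None.
Definition get_inr (x : sum_quiver) : option Q' :=
  if x is inr b then Some b else None.

Definition embed_inl (f : cpa K Q) : cpa K sum_quiver := fun p =>
  if all get_inl (pword p) then coef f (pstart p) (pmap get_inl (pword p))
  else 0.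
Definition embed_inr (f : cpa K Q') : cpa K sum_quiver := fun p =>
  if all get_inr (pword p) then coef f (pstart p) (pmap get_inr (pword p))
  else 0.

End DirectSum.
Arguments embed_inl {Q Q'} f _.
Arguments embed_inr {Q Q'} f _.

Definition direct_sum (X Y : graded_QP K V) : graded_QP K V :=
  @GradedQP K V (sum_quiver (gquiver X) (gquiver Y))
    (embed_inl (gpot X) + embed_inr (gpot Y))
    (fun x => match x with inl a => gdeg X a | inr b => gdeg Y b end).

Definition graded_right_equiv (X Y : graded_QP K V) : Prop :=
  exists phi : {rmorphism cpa K (gquiver X) -> cpa K (gquiver Y)},
    [/\ scalable phi /\ bijective phi,
        forall i : V, phi (vertex_elt K i) = vertex_elt K i,
        forall (n : int) f, homogeneous (gdeg X) n f ->
          homogeneous (gdeg Y) n (phi f)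
      & cyc_equiv (phi (gpot X)) (gpot Y)].

Definition is_reduced_part (X R : graded_QP K V) : Prop :=
  exists T : graded_QP K V,
    [/\ is_graded_QP R /\ is_reduced (gpot R), is_graded_QP T /\ is_trivial T
      & graded_right_equiv X (direct_sum R T)].

End GradedQPs.

Section LeftMutation.
Variables (K : comPzRingType) (V : finType) (Q : quiver V) (k : V).

Definition common_arrow := {a : Q | (src a != k) && (tgt a != k)}.
Definition out_arrow := {a : Q | src a == k}.
Definition in_arrow := {b : Q | tgt b == k}.

(* In this order: the arrows a common to Q and Q', the composites [ba],
   the reversed arrows a* and the reversed arrows b*. *)
Definition mut_arrow : Type :=
  ((common_arrow + in_arrow * out_arrow) + (out_arrow + in_arrow))%type.

Definition mut_src (x : mut_arrow) : V :=
  match x with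
  | inl (inl a) => src (val a)
  | inl (inr (b, a)) => src (val b)
  | inr (inl a) => tgt (val a)
  | inr (inr b) => k
  end.

Definition mut_tgt (x : mut_arrow) : V :=
  match x with
  | inl (inl a) => tgt (val a)
  | inl (inr (b, a)) => tgt (val a)
  | inr (inl a) => k
  | inr (inr b) => src (val b)
  end.

Definition mut_quiver : quiver V := @Quiver V mut_arrow mut_src mut_tgt.

Definition mut_deg (d : Q -> int) (x : mut_arrow) : int :=
  match x with
  | inl (inl a) => d (val a)
  | inl (inr (b, a)) => d (val a) + d (val b)
  | inr (inl a) => - d (val a)
  | inr (inr b) => - d (val b) + 1
  end.

(* The path of Q that an arrow a or [ba] stands for *)
Definition unbracket (x : mut_quiver) : option (seq Q) :=
  match x with
  | inl (inl a) => Some [:: val a]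
  | inl (inr (b, a)) => Some [:: val b; val a]
  | inr _ => None
  end.

(* [W]: replacing the compositions ba through k by [ba] is a bijection from the
   cycles of Q not starting at k to the cycles of Q' not starting at k that
   consist of arrows a and [ba]; its inverse is the concatenation of the
   unbracketed arrows. *)
Definition bracket (W : cpa K Q) : cpa K mut_quiver := fun p =>
  if all unbracket (pword p)
  then coef W (pstart p) (flatten (pmap unbracket (pword p))) else 0.

Definition mut_cubic : cpa K mut_quiver :=
  \sum_(b : in_arrow) \sum_(a : out_arrow)
    arrow_elt K (inl (inr (b, a)) : mut_quiver)
    * arrow_elt K (inr (inl a) : mut_quiver)
    * arrow_elt K (inr (inr b) : mut_quiver).

Definition pre_mutation (W : cpa K Q) (d : Q -> int) : graded_QP K V :=
  GradedQP (bracket W + mut_cubic) (mut_deg d).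

Definition no_cycle_starts_at (W : cpa K Q) : Prop :=
  forall p, W p != 0 -> pstart p != k.

(* R is a left mutation at k of the QP (Q,W) with cut C; the mutation is
   defined only up to graded right-equivalence. *)
Definition is_left_mutation (W : cpa K Q) (C : {set Q}) (R : graded_QP K V) :=
  exists W0 : cpa K Q,
    [/\ is_graded_QP (GradedQP W0 (cut_deg C)),
        cyc_equiv W W0, no_cycle_starts_at W0
      & is_reduced_part (pre_mutation W0 (cut_deg C)) R].

End LeftMutation.

(* For orthogonal idempotents e_i of sum 1 in A and P_i = A e_i: T is the direct
   sum of A/P_k, the direct sum of the P_i with i <> k, and of the cokernel of a
   minimal left add(A/P_k)-approximation of P_k.  Such T is unique up to
   isomorphism. *)
Definition is_left_tilting_mutation (A : pzRingType) (V : finType) (e : V -> A)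
    (k : V) (T : lmodType A) : Prop :=
  let P := left_ideal (e k) in
  let P' := left_ideal (\sum_(i | i != k) e i) in
  exists (X N : lmodType A) (f : {linear P -> X}) (g : {linear X -> N}),
    [/\ left_approximation P' f, left_minimal f, is_cokernel f g
      & mod_isomorphic T (P' * N)%type].

(* Main.v *)
From HB Require Import structures.
From mathcomp Require Import all_boot all_order all_algebra.
From mathcomp Require Import boolp functions.
Require Import Defs.

Set Implicit Arguments.
Unset Strict Implicit.
Unset Printing Implicit Defensive.

Import Order.TTheory GRing.Theory Num.Theory.
Local Open Scope ring_scope.

(** Let [A] be the truncated Jacobian algebra of the QP with cut [C].  Since [k]
    is a strict source, [k] is a source of the quiver of [A], and the relations
    of [A] that start at [k] are the derivatives [r b] of the potential along
    the arrows [b] that end at [k].  Write [r b] as the sum of the [a * D b a]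
    over the arrows [a] that start at [k].

    The mutated potential is linear in the arrows of degree 1.  Its derivatives
    along the common arrows in [C] are the relations of [A] that do not start at
    [k], and its derivative along the composite [ba] is [D b a] plus the product
    of the reversed arrows of [a] and [b] ([relation_com], [relation_comp]).  So
    the truncated Jacobian algebra of the premutation is generated by the
    arrows of [A] that do not start at [k], an arrow [a*] to [k] for each [a], and an
    arrow [b*] from [k] to the start of [b] for each [b], and its relations are
    the old ones together with [a* b* = - D b a].

    On the other side, the left approximation of [A e_k] is given by all the
    arrows [a], so that the tilting module is generated by an element [t],
    spanning the sum of the other projective modules, and elements [n a] with
    the sum of the [a n_a] equal to zero ([tilting_presentation]).  The old
    arrows act on [t] by right multiplication, [a*] maps [t] to [n a], and [b*]
    maps [n a] to [- D b a t].  This is a homomorphism from the mutated algebra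
    to the endomorphism algebra ([Phi_exists]).

    That it is bijective comes down to the exactness of the complex of right
    modules with the maps [z |-> (sum_b D b a z_b)_a] and
    [y |-> sum_a a y_a], which begins a projective resolution of the simple right
    module at [k].  Exactness in the middle ([I_lquot]) says that the relations
    starting at [k] are generated by the [r b]; it gives surjectivity
    ([Phi_surj]).  Injectivity at the left end ([D_independent]) is where the
    cut has to be algebraic: the relations are minimal, so the kernel lies in
    the radical, and since the global dimension is at most 2 a third Tor group
    vanishes, which spreads the kernel into all the powers of the radical
    ([zigzag]); these vanish eventually because [A] is finite dimensional.
    Every element of the mutated algebra has a normal form with at most one
    [b*], at the beginning, and at most one [a*], at the end ([normal_all]), and
    injectivity on normal forms follows ([nf_kernel]).

    It remains to pass from the premutation to its reduced part
    ([reduced_part_iso]).  The chain rule for cyclic derivatives ([cyc_bil_hom])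
    shows that right-equivalences preserve Jacobian ideals; for potentials of
    degree 1 the derivatives along arrows of degree 0 lie in the ideal of the
    cut, which makes this work for the truncated algebras; and the arrows of a
    trivial summand are zero in the quotient. *)

(** * Coefficients in complete path algebras *)

Section Coefficients.
Variables (K : comPzRingType) (V : finType) (Q : quiver V).
Implicit Types (f g h : cpa K Q) (v w : V) (l m : seq Q) (a : Q).

Lemma coefE f (p : qpath Q) : coef f (pstart p) (pword p) = f p.
Proof. by rewrite /coef -surjective_pairing valK. Qed.

Lemma coef_nwalk f v l : ~~ walk v l -> coef f v l = 0.
Proof. by rewrite /coef => nvl; rewrite insubF //=; apply: negbTE. Qed.

Lemma coef_walk f v l (vl : walk v l) :
  coef f v l = f (exist _ (v, l) vl).
Proof. by rewrite -[RHS]coefE. Qed.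

Lemma cpaP f g : (forall v l, walk v l -> coef f v l = coef g v l) -> f = g.
Proof.
move=> fg; apply/funext => p; rewrite -!coefE; apply: fg.
exact: (valP p).
Qed.

Lemma coefD f g v l : coef (f + g) v l = coef f v l + coef g v l.
Proof. by rewrite /coef; case: insub => //=; rewrite addr0. Qed.

Lemma coefN f v l : coef (- f) v l = - coef f v l.
Proof. by rewrite /coef; case: insub => //=; rewrite oppr0. Qed.

Lemma coefB f g v l : coef (f - g) v l = coef f v l - coef g v l.
Proof. by rewrite coefD coefN. Qed.

Lemma coef0 v l : coef (0 : cpa K Q) v l = 0.
Proof. by rewrite /coef; case: insub. Qed.

Lemma coefZ (c : K) f v l : coef (c *: f) v l = c * coef f v l.
Proof. by rewrite /coef; case: insub => //=; rewrite mulr0. Qed.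

Lemma coef_sum (I : Type) (r : seq I) (P : pred I) (F : I -> cpa K Q) v l :
  coef (\sum_(i <- r | P i) F i) v l = \sum_(i <- r | P i) coef (F i) v l.
Proof.
elim/big_rec2: _ => [|i y1 y2 _ <-]; first exact: coef0.
exact: coefD.
Qed.

Lemma coef1 v l : coef (1 : cpa K Q) v l = (l == [::])%:R.
Proof.
have [vl|nvl] := boolP (walk v l); first by rewrite coef_walk.
by rewrite coef_nwalk //; case: l nvl.
Qed.

Lemma coefM f g v l :
  coef (f * g) v l =
  \sum_(i < (size l).+1)
     coef f v (take i l) * coef g (walk_end v (take i l)) (drop i l).
Proof.
have [vl|nvl] := boolP (walk v l).
  rewrite coef_walk cpaME; apply: eq_bigr => i _.
  by rewrite -!coefE.
rewrite coef_nwalk // big1 // => i _.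
have [vt|nvt] := boolP (walk v (take i l)); last by rewrite coef_nwalk ?mul0r.
rewrite [X in _ * X]coef_nwalk ?mulr0 //.
by apply: contra nvl => dv; rewrite -(cat_take_drop i l) walk_cat vt.
Qed.

Lemma coefM_nil f g v : coef (f * g) v [::] = coef f v [::] * coef g v [::].
Proof. by rewrite coefM big_ord_recl big_ord0 addr0. Qed.

Lemma coef_path w m v l :
  coef (path_elt K w m) v l = (walk v l && ((v, l) == (w, m)))%:R.
Proof.
have [vl|nvl] := boolP (walk v l); first by rewrite coef_walk.
by rewrite coef_nwalk.
Qed.

Lemma coef_vertexM v f w l :
  coef (vertex_elt K v * f) w l = (w == v)%:R * coef f w l.
Proof.
rewrite coefM big_ord_recl /= big1 => [|i _]; last first.
  rewrite coef_path; case: l i => [|x l] [i lti] //=.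
  by rewrite xpair_eqE /= andbF andbF mul0r.
by rewrite addr0 take0 drop0 coef_path /= xpair_eqE eqxx andbT.
Qed.

Lemma coef_Mvertex v f w l :
  coef (f * vertex_elt K v) w l = coef f w l * (walk_end w l == v)%:R.
Proof.
rewrite coefM big_ord_recr /= big1 => [|i _]; last first.
  rewrite coef_path xpair_eqE -size_eq0 size_drop subn_eq0 leqNgt ltn_ord.
  by rewrite andbF andbF mulr0.
by rewrite add0r take_size drop_size coef_path /= xpair_eqE eqxx andbT.
Qed.

Lemma coef_arrowM_nil a f w : coef (arrow_elt K a * f) w [::] = 0.
Proof.
rewrite coefM big_ord_recl big_ord0 addr0 /= coef_path.
by rewrite xpair_eqE /= andbF mul0r.
Qed.

Lemma coef_arrowM_cons a f w x l : coef (arrow_elt K a * f) w (x :: l) =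
  ((w == src a) && (x == a))%:R * coef f (tgt x) l.
Proof.
rewrite coefM big_ord_recl /= coef_path xpair_eqE /= andbF mul0r add0r.
rewrite big_ord_recl /= take0 drop0 big1 ?addr0 => [|i _].
  rewrite coef_path xpair_eqE /= eqseq_cons eqxx !andbT.
  by case: (x =P a) => [->|_]; rewrite ?andbF ?andbT 1?eq_sym ?andbb.
rewrite coef_path xpair_eqE eqseq_cons.
case: l i => [|y l] [i lti] //=.
by rewrite !andbF mul0r.
Qed.

Lemma path_eltM v l w m : walk v l ->
  path_elt K v l * path_elt K w m =
  if walk_end v l == w then path_elt K v (l ++ m) else 0.
Proof.
move=> vl; apply: cpaP => u s us; rewrite coefM.
under eq_bigr => i _ do
  rewrite !coef_path walk_take //= (walk_drop i us) /= !xpair_eqE.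
have [uv|nuv] := eqVneq u v; last first.
  rewrite big1 => [|i _]; last by rewrite /= mul0r.
  by case: ifP => _; rewrite ?coef0 // coef_path xpair_eqE (negbTE nuv) andbF.
subst u; move: us; have [->|nslm] := eqVneq s (l ++ m) => us; last first.
  rewrite big1 => [|i _].
    case: ifP => _; rewrite ?coef0 // coef_path xpair_eqE.
    by rewrite (negbTE nslm) !andbF.
  case: eqP => [tl|]; rewrite ?mul0r //; case: (drop i s =P m) => [dm|].
    by case/eqP: nslm; rewrite -tl -dm cat_take_drop.
  by rewrite andbF mulr0.
have lti : (size l < (size (l ++ m)).+1)%N by rewrite ltnS size_cat leq_addr.
rewrite (bigD1 (Ordinal lti)) //= big1 ?addr0 => [|i nil].
  rewrite take_size_cat // drop_size_cat // !eqxx /= mul1r andbT.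
  have [E|//] := eqVneq (walk_end v l) w; last by rewrite coef0.
  rewrite coef_path eqxx andbT walk_cat vl E.
  by move: us; rewrite walk_cat vl E /= => ->.
case: eqP => [tl|]; last by rewrite mul0r.
case/eqP: nil; apply: val_inj => /=; rewrite -{2}tl size_takel //.
by rewrite -ltnS.
Qed.

End Coefficients.

(** * The radical filtration *)

Section Radical.
Variables (K : comPzRingType) (V : finType) (Q : quiver V).
Implicit Types (f g h : cpa K Q) (v w : V) (l : seq Q) (a : Q).

Definition inrad (n : nat) (f : cpa K Q) : Prop :=
  forall v l, (size l < n)%N -> coef f v l = 0.

Lemma congr_radP n f g : congr_rad n f g <-> inrad n (f - g).
Proof.
split=> [fg v l ltl|fg p ltp].
  have [vl|nvl] := boolP (walk v l); last by rewrite coef_nwalk.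
  by rewrite coef_walk cpaDE cpaNE fg ?subrr.
have /eqP := fg (pstart p) (pword p) ltp.
by rewrite coefB !coefE subr_eq0 => /eqP.
Qed.

Lemma inrad_all f : inrad 0 f. Proof. by []. Qed.

Lemma inrad0 n : inrad n (0 : cpa K Q).
Proof. by move=> v l _; rewrite coef0. Qed.

Lemma inradD n f g : inrad n f -> inrad n g -> inrad n (f + g).
Proof. by move=> Hf Hg v l ltl; rewrite coefD Hf // Hg // addr0. Qed.

Lemma inradN n f : inrad n f -> inrad n (- f).
Proof. by move=> Hf v l ltl; rewrite coefN Hf // oppr0. Qed.

Lemma inradB n f g : inrad n f -> inrad n g -> inrad n (f - g).
Proof. by move=> Hf Hg; apply/inradD/inradN. Qed.

Lemma inradZ n c f : inrad n f -> inrad n (c *: f).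
Proof. by move=> Hf v l ltl; rewrite coefZ Hf // mulr0. Qed.

Lemma inrad_sum n (I : Type) (r : seq I) (P : pred I) (F : I -> cpa K Q) :
  (forall i, P i -> inrad n (F i)) -> inrad n (\sum_(i <- r | P i) F i).
Proof. by move=> HF; apply: big_ind => //; [apply: inrad0|apply: inradD]. Qed.

Lemma inrad_le m n f : (m <= n)%N -> inrad n f -> inrad m f.
Proof. by move=> lemn Hf v l ltl; apply: Hf; apply: leq_trans lemn. Qed.

Lemma inradM m n f g : inrad m f -> inrad n g -> inrad (m + n) (f * g).
Proof.
move=> Hf Hg v l ltl; rewrite coefM big1 // => i _.
have lei : (i <= size l)%N by rewrite -ltnS.
have [ltim|leim] := ltnP i m; first by rewrite Hf ?mul0r // size_takel.
rewrite [X in _ * X]Hg ?mulr0 // size_drop ltn_subLR //.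
by apply: leq_trans ltl _; rewrite leq_add2r.
Qed.

Lemma inradMl n f g : inrad n g -> inrad n (f * g).
Proof. exact: inradM (inrad_all f). Qed.

Lemma inradMr n f g : inrad n f -> inrad n (f * g).
Proof. by move=> Hf; rewrite -(addn0 n); apply: inradM. Qed.

Lemma inradX n f : inrad 1 f -> inrad n (f ^+ n).
Proof. by move=> Hf; elim: n => // n IH; rewrite exprS; apply: inradM Hf IH. Qed.

Lemma inrad_eq0 f : (forall n, inrad n f) -> f = 0.
Proof. by move=> Hf; apply: cpaP => v l _; rewrite coef0 (Hf (size l).+1). Qed.

Lemma inrad_path v l : inrad (size l) (path_elt K v l).
Proof.
move=> w m ltm; rewrite coef_path xpair_eqE.
by case: (m =P l) ltm => [->|_ _]; rewrite ?ltnn ?andbF.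
Qed.

Lemma inrad1P f : inrad 1 f <-> forall v, coef f v [::] = 0.
Proof. by split=> [Hf v|Hf v [|x l]] //; apply: Hf. Qed.

(** Elements with zero constant part are topologically nilpotent, so the
    geometric series inverts [1 - x]. *)
Lemma one_sub_inverse (x : cpa K Q) : inrad 1 x ->
  exists y, (1 - x) * y = 1 /\ y * (1 - x) = 1.
Proof.
move=> Hx; pose y : cpa K Q := fun p => (\sum_(i < (plen p).+1) x ^+ i) p.
have yE n : inrad n (y - \sum_(i < n) x ^+ i).
  apply/congr_radP => p ltp; rewrite /y -!coefE.
  rewrite -(subnKC ltp) big_split_ord /= [in RHS]coefD.
  rewrite [X in _ + X](_ : _ = 0) ?addr0 // coef_sum big1 // => i _.
  have Hi : inrad (plen p).+1 (x ^+ ((plen p).+1 + i)).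
    by rewrite exprD; apply/inradMr/inradX.
  exact: Hi.
have geo n : (1 - x) * \sum_(i < n) x ^+ i = 1 - x ^+ n.
  by rewrite -[LHS]opprK -mulNr opprB -subrX1 opprB.
have comm n : GRing.comm (1 - x) (\sum_(i < n) x ^+ i).
  apply: commr_sum => i _; apply: commr_sym; apply: commrB.
    exact: commr1.
  exact/commr_sym/commrX.
exists y; split; apply/eqP; rewrite -subr_eq0; apply/eqP/inrad_eq0 => n.
  rewrite -[y](subrK (\sum_(i < n) x ^+ i)) mulrDr geo.
  rewrite -addrA [1 - x ^+ n]addrC addrK.
  by apply: inradB; [apply: inradMl|apply: inradX].
rewrite -[y](subrK (\sum_(i < n) x ^+ i)) mulrDl -comm geo.
rewrite -addrA [1 - x ^+ n]addrC addrK.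
by apply: inradB; [apply: inradMr|apply: inradX].
Qed.

(** ** Approximation by finite sums of paths *)

Definition paths_lt (n : nat) : seq (qpath Q) :=
  undup (pmap insub
    (flatten [seq [seq (v, tval t) | v <- enum V, t <- enum {: i.-tuple Q}]
             | i <- iota 0 n])).

Lemma mem_paths_lt n p : (p \in paths_lt n) = (plen p < n)%N.
Proof.
rewrite mem_undup mem_pmap_sub; apply/flattenP/idP => /=.
  case=> s /mapP[i]; rewrite mem_iota => /andP[_ lti] ->.
  by case/allpairsP => -[v t] [_ _ /= pE]; rewrite /plen /pword (pE : val p = _) size_tuple.
move=> ltp; exists [seq (v, tval t) | v <- enum V, t <- enum {: (plen p).-tuple Q}].
  by apply: map_f; rewrite mem_iota.
apply/allpairsP; exists (pstart p, in_tuple (pword p)) => /=.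
by split; rewrite ?mem_enum //; apply: surjective_pairing.
Qed.

Notation basis p := (path_elt K (pstart p) (pword p)).

Lemma basisE (p q : qpath Q) : basis p q = (q == p)%:R.
Proof. by rewrite /path_elt -surjective_pairing. Qed.

Lemma trunc_congr n f : inrad n (f - \sum_(p <- paths_lt n) f p *: basis p).
Proof.
apply/congr_radP => q ltq; rewrite -[RHS]coefE coef_sum.
under eq_bigr => p _ do rewrite coefZ coefE basisE.
rewrite (bigD1_seq q) ?undup_uniq ?mem_paths_lt //= eqxx mulr1.
by rewrite big1 ?addr0 // => p; rewrite eq_sym => /negbTE ->; rewrite mulr0.
Qed.

(** Truncating at length [n] leaves a finite combination of paths; this takes
    the place of density arguments for the radical-adic topology. *)
Lemma cpa_ind (P : cpa K Q -> Prop) (n : nat) f :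
  P 0 -> (forall g h, P g -> P h -> P (g + h)) ->
  (forall p, f p != 0 -> P (f p *: basis p)) ->
  (forall g h, inrad n (g - h) -> P h -> P g) -> P f.
Proof.
move=> P0 PD Pp Pc; apply: (Pc _ _ (@trunc_congr n f)).
apply: big_ind => // p _; have [->|nz] := eqVneq (f p) 0; first by rewrite scale0r.
exact: Pp.
Qed.

(** ** Splitting off the first arrow *)

Definition lquot (a : Q) (f : cpa K Q) : cpa K Q := fun p =>
  if pstart p == tgt a then coef f (src a) (a :: pword p) else 0.

Lemma coef_lquot a f v l :
  coef (lquot a f) v l = if v == tgt a then coef f (src a) (a :: l) else 0.
Proof.
have [vl|nvl] := boolP (walk v l); first by rewrite coef_walk.
rewrite coef_nwalk //; case: eqP nvl => // -> nvl.
by rewrite coef_nwalk //= eqxx.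
Qed.

Lemma lquot_is_linear a : linear (lquot a).
Proof.
move=> c f g; apply: cpaP => v l _; rewrite coefD coefZ !coef_lquot.
by case: eqP => _; rewrite ?coefD ?coefZ // mulr0 addr0.
Qed.

HB.instance Definition _ a :=
  GRing.isLinear.Build K (cpa K Q) (cpa K Q) *:%R (lquot a) (lquot_is_linear a).

Lemma inrad_lquot n a f : inrad n.+1 f -> inrad n (lquot a f).
Proof. by move=> Hf v l ltl; rewrite coef_lquot Hf // if_same. Qed.

Lemma lquotM a f g :
  lquot a (f * g) = lquot a f * g + coef f (src a) [::] *: lquot a g.
Proof.
apply: cpaP => v l _; rewrite coefD coefZ coefM !coef_lquot.
have [->|nv] := eqVneq v (tgt a); last first.
  by rewrite mulr0 addr0 big1 // => i _; rewrite coef_lquot (negbTE nv) mul0r.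
rewrite coefM big_ord_recl /= addrC; congr (_ + _).
by apply: eq_bigr => i _; rewrite coef_lquot eqxx.
Qed.

Lemma lquot_arrow a b : lquot a (arrow_elt K b) = (a == b)%:R *: vertex_elt K (tgt a).
Proof.
apply: cpaP => v l vl; rewrite coefZ coef_lquot !coef_path vl /=.
case: (v =P tgt a) => [vE|nv].
  subst v; rewrite !xpair_eqE eqseq_cons /= vl !eqxx /=.
  by case: (a =P b) => [->|_]; rewrite ?eqxx ?andbF ?mul0r ?mul1r.
by rewrite xpair_eqE (introF eqP nv) /= mulr0.
Qed.

Lemma lquot_vertexl a f : lquot a f = vertex_elt K (tgt a) * lquot a f.
Proof.
apply: cpaP => v l _; rewrite coef_vertexM coef_lquot.
by case: eqP; rewrite ?mul1r ?mul0r.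
Qed.

Lemma arrow_decomp f : inrad 1 f -> f = \sum_a arrow_elt K a * lquot a f.
Proof.
move=> /inrad1P Hf; apply: cpaP => v [|x l] vl; rewrite coef_sum.
  by rewrite Hf big1 // => a _; rewrite coef_arrowM_nil.
rewrite (bigD1 x) //= big1 => [|a nax]; rewrite coef_arrowM_cons.
  have /andP[/eqP sx _] := vl.
  by rewrite -sx !eqxx mul1r addr0 coef_lquot eqxx.
by rewrite [x == a]eq_sym (negbTE nax) andbF mul0r.
Qed.

(** ** Idempotents of the vertices *)

Lemma vertex_eltM v w :
  vertex_elt K (Q := Q) v * vertex_elt K w = (v == w)%:R *: vertex_elt K v.
Proof.
rewrite path_eltM // /walk_end /=.
by case: eqP => [->|_]; rewrite ?scale1r ?scale0r.
Qed.

Lemma vertex_sum : \sum_v vertex_elt K (Q := Q) v = 1.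
Proof.
apply: cpaP => v l vl; rewrite coef1 coef_sum (bigD1 v) //= big1 => [|w nwv].
  by rewrite coef_path vl xpair_eqE eqxx addr0.
by rewrite coef_path xpair_eqE eq_sym (negbTE nwv) andbF.
Qed.

Lemma src_arrow a : vertex_elt K (src a) * arrow_elt K a = arrow_elt K a.
Proof. by rewrite path_eltM // eqxx. Qed.

Lemma arrow_tgt a : arrow_elt K a * vertex_elt K (tgt a) = arrow_elt K a.
Proof. by rewrite path_eltM /walk_end /= ?eqxx. Qed.

Lemma path_elt_cons v a l : walk v (a :: l) ->
  path_elt K v (a :: l) = arrow_elt K a * path_elt K (tgt a) l.
Proof. by case/andP => /eqP <- _; rewrite path_eltM /walk_end /= ?eqxx. Qed.

Lemma scale_cpa_scal (c : K) f : c *: f = cpa_scal c * f.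
Proof. by rewrite /cpa_scal -cpa_scalerAl mul1r. Qed.

End Radical.

Notation basis K p := (path_elt K (pstart p) (pword p)).

(** * Substitution along a partial map of quivers *)

Section Substitution.
Variables (V : finType) (Q1 Q2 : quiver V).

Record quiver_pmap := QuiverPmap {
  qpmap :> Q2 -> option Q1;
  qpmap_ends : forall y x, qpmap y = Some x -> src y = src x /\ tgt y = tgt x
}.

Lemma walk_pmap (t : quiver_pmap) v l : all (qpmap t) l -> walk v (pmap (qpmap t) l) = walk v l.
Proof.
elim: l v => //= y l IH v; case E: (t y) => [x|] //= /IH ->.
by have [<- <-] := qpmap_ends E.
Qed.

Lemma walk_end_pmap (t : quiver_pmap) v l :
  all (qpmap t) l -> walk_end v (pmap (qpmap t) l) = walk_end v l.
Proof.
rewrite /walk_end; elim: l v => //= y l IH v; case E: (t y) => [x|] //= /IH ->.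
by have [_ <-] := qpmap_ends E.
Qed.

Lemma size_pmap_all (t : quiver_pmap) l : all (qpmap t) l -> size (pmap (qpmap t) l) = size l.
Proof. by rewrite size_pmap all_count => /eqP. Qed.

Variable K : comPzRingType.

(** Coefficients are pulled back along [t], by zero where [t] is undefined.  Both
    the restriction to a subquiver and the extension by zero from a subquiver
    are of this form, which makes them ring morphisms at once. *)
Definition subst (t : quiver_pmap) (f : cpa K Q1) : cpa K Q2 := fun p =>
  if all (qpmap t) (pword p) then coef f (pstart p) (pmap (qpmap t) (pword p)) else 0.

Lemma coef_subst t f v l :
  coef (subst t f) v l = if all (qpmap t) l then coef f v (pmap (qpmap t) l) else 0.
Proof.
have [vl|nvl] := boolP (walk v l); first by rewrite coef_walk.
rewrite coef_nwalk //; case: ifP => // tl.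
by rewrite coef_nwalk // walk_pmap.
Qed.

Lemma subst_is_linear t : linear (subst t).
Proof.
move=> c f g; apply: cpaP => v l _; rewrite coefD coefZ !coef_subst.
by case: ifP => _; rewrite ?coefD ?coefZ // mulr0 addr0.
Qed.

HB.instance Definition _ t :=
  GRing.isLinear.Build K (cpa K Q1) (cpa K Q2) *:%R (subst t) (subst_is_linear t).

Lemma subst_is_monoid_morphism t : monoid_morphism (subst t).
Proof.
split=> [|f g]; apply: cpaP => v l vl.
  rewrite coef_subst !coef1; case: ifP => [tl|]; last by case: l vl.
  by rewrite -!size_eq0 size_pmap_all.
rewrite coef_subst !coefM; case: ifP => tl.
  rewrite size_pmap_all //; apply: eq_bigr => i _; rewrite !coef_subst.
  have pl : pmap (qpmap t) l = pmap (qpmap t) (take i l) ++ pmap (qpmap t) (drop i l).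
    by rewrite -pmap_cat cat_take_drop.
  move: tl; rewrite -{1}(cat_take_drop i l) all_cat => /andP[tt td].
  have si : size (pmap (qpmap t) (take i l)) = i.
    by rewrite size_pmap_all // size_takel // -ltnS.
  rewrite pl tt td take_size_cat // drop_size_cat //.
  by rewrite walk_end_pmap.
rewrite big1 // => i _; rewrite !coef_subst.
move: tl; rewrite -{1}(cat_take_drop i l) all_cat.
by case: (all (qpmap t) (take i l)) => /= [->|_]; rewrite ?mulr0 ?mul0r.
Qed.

HB.instance Definition _ t :=
  GRing.isMonoidMorphism.Build (cpa K Q1) (cpa K Q2) (subst t)
    (subst_is_monoid_morphism t).

Lemma subst_vertex t v : subst t (vertex_elt K v) = vertex_elt K v.
Proof.
apply: cpaP => w l wl; rewrite coef_subst !coef_path wl !xpair_eqE /=.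
case: ifP => tl; last by case: l tl {wl} => //= y l _; rewrite andbF.
rewrite walk_pmap // wl; case: l tl {wl} => //= y l.
by case: (qpmap t y) => //= x _; rewrite !andbF.
Qed.

Lemma inrad_subst t n f : inrad n f -> inrad n (subst t f).
Proof.
move=> Hf v l ltl; rewrite coef_subst; case: ifP => // tl.
by rewrite Hf // size_pmap_all.
Qed.

End Substitution.

(** * Closed ideals and quotient algebras *)

Section ClosedIdealTheory.
Variables (K : comPzRingType) (V : finType) (Q : quiver V).
Implicit Types (f g : cpa K Q) (S P : cpa K Q -> Prop).

Definition rad_closed P : Prop :=
  forall f, (forall n, exists2 g, P g & inrad n (f - g)) -> P f.

Lemma closed_ideal_closed S : rad_closed (closed_ideal S).
Proof.
move=> f Hf n; have [g Ig fg] := Hf n; have [h Sh gh] := Ig n.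
exists h => //; apply/congr_radP; rewrite -(subrKA g).
by apply: inradD => //; apply/congr_radP.
Qed.

Lemma mem_closed_ideal S f : S f -> closed_ideal S f.
Proof.
move=> Sf n; exists f => //; exists 1%N, (fun=> 1), (fun=> f), (fun=> 1).
by split=> //; rewrite big_ord_recl big_ord0 mul1r mulr1 addr0.
Qed.

Lemma closed_ideal_ind S P : P 0 -> (forall f g, P f -> P g -> P (f + g)) ->
  (forall a f, P f -> P (a * f)) -> (forall a f, P f -> P (f * a)) ->
  (forall f, S f -> P f) -> rad_closed P ->
  forall f, closed_ideal S f -> P f.
Proof.
move=> P0 PD Pl Pr PS Pcl f Sf; apply: Pcl => n.
have [g [m [a [s [b [Ss ->]]]]] /congr_radP fg] := Sf n.
exists (\sum_i a i * s i * b i) => //; apply: big_ind => // i _.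
by apply/Pr/Pl/PS.
Qed.

Lemma closed_ideal_min S (J : ideal (cpa K Q)) : rad_closed J ->
  (forall f, S f -> J f) -> forall f, closed_ideal S f -> J f.
Proof.
move=> Jcl SJ; apply: closed_ideal_ind Jcl => //.
- exact: ideal0.
- exact: idealD.
- exact: idealMl.
- exact: idealMr.
Qed.

Lemma idealB (A : pzRingType) (I : ideal A) x y : I x -> I y -> I (x - y).
Proof. by move=> Ix Iy; apply/idealD/idealN. Qed.

Lemma ideal_sum (A : pzRingType) (I : ideal A) (T : Type) (r : seq T)
    (p : pred T) (F : T -> A) :
  (forall i, p i -> I (F i)) -> I (\sum_(i <- r | p i) F i).
Proof. by move=> HF; apply: big_ind => //; [apply: ideal0|apply: idealD]. Qed.

Lemma ideal_congr (A : pzRingType) (I : ideal A) x y : I (x - y) -> I y -> I x.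
Proof. by move=> Ixy Iy; rewrite -(subrK y x); apply: idealD. Qed.

Lemma idealZ (I : ideal (cpa K Q)) c f : I f -> I (c *: f).
Proof. by rewrite scale_cpa_scal; apply: idealMl. Qed.

End ClosedIdealTheory.

Lemma quot_pi0P (A : pzRingType) (I : ideal A) x : quot_pi I x = 0 <-> I x.
Proof.
by rewrite -(rmorph0 (quot_pi I)); split=> [/quot_piP|Ix]; [|apply/quot_piP]; rewrite subr0.
Qed.

Lemma inj_surj_bij (A B : Type) (f : A -> B) :
  injective f -> (forall y, exists x, f x = y) -> bijective f.
Proof.
move=> inj_f /choice[g gK]; exists g => // x.
exact: inj_f.
Qed.

Section AlgebraIsomorphisms.
Variable K : comPzRingType.
Implicit Types A B : kalgebra K.

Lemma alg_isomorphic_sym A B : alg_isomorphic A B -> alg_isomorphic B A.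
Proof.
move=> [F [Fs [G FK GK]]].
have injF : injective F := can_inj FK.
have Gz : zmod_morphism G by move=> u v; apply: injF; rewrite GK rmorphB !GK.
have Gm : monoid_morphism G.
  by split=> [|u v]; apply: injF; rewrite GK ?rmorph1 // rmorphM !GK.
pose Ga := GRing.isZmodMorphism.Build _ _ G Gz.
pose Gb := GRing.isMonoidMorphism.Build _ _ G Gm.
pose Gr : {rmorphism B -> A} := HB.pack G Ga Gb.
exists Gr; split=> [c|]; last by exists F.
by apply: injF; rewrite /= GK Fs.
Qed.

Lemma alg_isomorphic_trans A B C :
  alg_isomorphic A B -> alg_isomorphic B C -> alg_isomorphic A C.
Proof.
move=> [F [Fs Fb]] [G [Gs Gb]]; exists (G \o F); split=> [c|].
  by rewrite /= Fs Gs.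
exact: bij_comp.
Qed.

Lemma quot_iso A B (I : ideal A) (F : {rmorphism A -> B}) :
  (forall c, F (kalg_scal A c) = kalg_scal B c) ->
  (forall y, exists x, F x = y) -> (forall x, F x = 0 <-> I x) ->
  alg_isomorphic (quot_alg I) B.
Proof.
move=> Fs Fsurj Fker; pose G (u : quot_ring I) : B := F (quot_repr u).
have GE x : G (quot_pi I x) = F x.
  apply/eqP; rewrite -subr_eq0 -rmorphB; apply/eqP/Fker/quot_piP.
  exact: quot_reprK.
have Gz : zmod_morphism G.
  move=> u v; rewrite -(quot_reprK u) -(quot_reprK v).
  by rewrite -rmorphB !GE rmorphB.
have Gm : monoid_morphism G.
  split=> [|u v]; first by rewrite -(rmorph1 (@quot_pi _ I)) GE rmorph1.
  rewrite -(quot_reprK u) -(quot_reprK v).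
  by rewrite -rmorphM !GE rmorphM.
pose Ga := GRing.isZmodMorphism.Build _ _ G Gz.
pose Gb := GRing.isMonoidMorphism.Build _ _ G Gm.
pose Gr : {rmorphism quot_ring I -> B} := HB.pack G Ga Gb.
exists Gr; split=> [c|]; first by rewrite /= GE Fs.
apply: inj_surj_bij => [u v|y].
  rewrite -(quot_reprK u) -(quot_reprK v) /= !GE => E.
  by apply/quot_piP/Fker; rewrite rmorphB E subrr.
by have [x <-] := Fsurj y; exists (quot_pi I x); rewrite /= GE.
Qed.

End AlgebraIsomorphisms.

(** * Homomorphisms out of a complete path algebra *)

Section Homomorphisms.
Variables (K : fieldType) (V : finType) (Q : quiver V).
Implicit Types (v w : V) (l : seq Q) (f g : cpa K Q).

Section Linear.
Variables (S : kalgebra K) (F : {rmorphism cpa K Q -> S}).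
Hypothesis Fs : forall c, F (cpa_scal c) = kalg_scal S c.

Lemma rmorph_cpaZ c f : F (c *: f) = kalg_scal S c * F f.
Proof. by rewrite scale_cpa_scal rmorphM Fs. Qed.

(** A linear homomorphism is compatible with the radical filtrations: it
    maps [1 - c x] to a unit for every scalar [c] and every [x] in the
    radical, which forces the constant part of the image of [x] to vanish. *)
Lemma hom_inrad (Q' : quiver V) (G : {rmorphism cpa K Q -> cpa K Q'}) n f :
  (forall c, G (cpa_scal c) = cpa_scal c) -> inrad n f -> inrad n (G f).
Proof.
move=> Gs; have Gr x : inrad 1 x -> inrad 1 (G x).
  move=> Hx; apply/inrad1P => v; apply/eqP/negPn/negP => nz.
  set c := coef (G x) v [::] in nz.
  have [y [xy _]] := one_sub_inverse (inradZ c^-1 Hx).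
  have := congr1 (fun z => coef (G z) v [::]) xy.
  rewrite /= rmorphM coefM_nil rmorphB rmorph1 scale_cpa_scal rmorphM Gs.
  rewrite -scale_cpa_scal coefB coefZ !coef1 /= -/c mulVf // subrr mul0r.
  by move/eqP; rewrite eq_sym oner_eq0.
elim: n f => // n IH f Hf.
rewrite (arrow_decomp (inrad_le _ Hf)) // rmorph_sum; apply: inrad_sum => a _.
rewrite rmorphM -add1n; apply: inradM (Gr _ _) (IH _ (inrad_lquot _ Hf)).
by apply/inrad1P => v; rewrite coef_path xpair_eqE !andbF.
Qed.

End Linear.

(** Vanishing on a power of the radical is the form of continuity that is
    available when the target carries no topology. *)
Lemma cpa_hom_ext (S : kalgebra K) (F G : {rmorphism cpa K Q -> S}) M :
  (forall c, F (cpa_scal c) = kalg_scal S c) ->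
  (forall c, G (cpa_scal c) = kalg_scal S c) ->
  (forall f, inrad M f -> F f = 0) -> (forall f, inrad M f -> G f = 0) ->
  (forall v, F (vertex_elt K v) = G (vertex_elt K v)) ->
  (forall a, F (arrow_elt K a) = G (arrow_elt K a)) -> F =1 G.
Proof.
move=> Fs Gs FM GM FGv FGa f.
have FGp v l : walk v l -> F (path_elt K v l) = G (path_elt K v l).
  elim: l v => [|a l IH] v vl; first exact: FGv.
  by rewrite path_elt_cons // !rmorphM FGa IH //; case/andP: vl.
apply: (@cpa_ind _ _ _ (fun f => F f = G f) M).
- by rewrite !rmorph0.
- by move=> g h Eg Eh; rewrite !rmorphD Eg Eh.
- move=> p _; rewrite (rmorph_cpaZ Fs) (rmorph_cpaZ Gs) FGp //.
  exact: (valP p).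
move=> g h gh Eh; rewrite -(subrK h g) [LHS]rmorphD [RHS]rmorphD Eh.
by rewrite (FM _ gh) (GM _ gh).
Qed.

Section Lift.
Variables (S : kalgebra K) (eps : V -> S) (E : Q -> S) (M : nat).
Hypothesis epsM : forall v w, eps v * eps w = if v == w then eps v else 0.
Hypothesis eps_sum : \sum_v eps v = 1.
Hypothesis srcE : forall a, eps (src a) * E a = E a.
Hypothesis Etgt : forall a, E a * eps (tgt a) = E a.

Definition lift_word v l : S := eps v * \prod_(a <- l) E a.

Hypothesis longE : forall v l, walk v l -> (M <= size l)%N -> lift_word v l = 0.

Definition lift (f : cpa K Q) : S :=
  \sum_(p <- paths_lt Q M) kalg_scal S (f p) * lift_word (pstart p) (pword p).

Lemma lift_zmod_morphism : zmod_morphism lift.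
Proof.
move=> f g; rewrite /lift -sumrB; apply: eq_bigr => p _.
by rewrite -mulrBl -rmorphB.
Qed.

HB.instance Definition _ :=
  GRing.isZmodMorphism.Build (cpa K Q) S lift lift_zmod_morphism.

Lemma liftZ c f : lift (c *: f) = kalg_scal S c * lift f.
Proof.
rewrite /lift big_distrr; apply: eq_bigr => p _ /=.
by rewrite cpaZE rmorphM mulrA.
Qed.

Lemma lift_inrad f : inrad M f -> lift f = 0.
Proof.
move=> Hf; rewrite /lift big_seq big1 // => p; rewrite mem_paths_lt => ltp.
by rewrite -coefE Hf // rmorph0 mul0r.
Qed.

Lemma lift_congr f g : inrad M (f - g) -> lift f = lift g.
Proof. by move/lift_inrad => /= E0; apply/eqP; rewrite -subr_eq0 -raddfB /= E0. Qed.

Lemma lift_path v l : walk v l -> lift (path_elt K v l) = lift_word v l.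
Proof.
move=> vl; have [leM|ltM] := leqP M (size l).
  by rewrite longE // lift_inrad //; apply: (inrad_le leM); apply: inrad_path.
pose p0 : qpath Q := exist _ (v, l) vl.
rewrite /lift (bigD1_seq p0) ?undup_uniq ?mem_paths_lt //= big1 => [|p np].
  by rewrite addr0 /path_elt eqxx rmorph1 mul1r.
by rewrite /path_elt (_ : (_ == _) = false) ?rmorph0 ?mul0r //; apply: negbTE.
Qed.

Lemma lift_word_end v l w : walk v l ->
  lift_word v l * eps w = if walk_end v l == w then lift_word v l else 0.
Proof.
rewrite /lift_word; elim: l v => [|a l IH] v.
  move=> _; rewrite big_nil mulr1 epsM /walk_end /=.
  by case: eqP => [->|].
case/andP=> /eqP <- al; rewrite big_cons !mulrA srcE -(Etgt a) -!mulrA.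
rewrite [eps _ * (_ * _)]mulrA IH // /walk_end /=.
by case: eqP => _; rewrite ?mulr0.
Qed.

Lemma liftM_path v l w m : walk v l -> walk w m ->
  lift (path_elt K v l * path_elt K w m) =
  lift (path_elt K v l) * lift (path_elt K w m).
Proof.
move=> vl wm; rewrite path_eltM // !lift_path // [in RHS]/lift_word.
rewrite [RHS]mulrA lift_word_end //; case: eqP => [E0|_].
  rewrite lift_path ?walk_cat ?vl ?E0 //.
  by rewrite /lift_word big_cat mulrA.
by rewrite raddf0 mul0r.
Qed.

Lemma lift_monoid_morphism : monoid_morphism lift.
Proof.
split.
  rewrite -(vertex_sum K Q) raddf_sum -eps_sum; apply: eq_bigr => v _.
  by rewrite /= /vertex_elt lift_path // /lift_word big_nil mulr1.
move=> f g; pose P f := lift (f * g) = lift f * lift g.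
apply: (@cpa_ind _ _ _ P M); rewrite /P.
- by rewrite mul0r raddf0 mul0r.
- by move=> f1 f2 E1 E2; rewrite mulrDl !raddfD /= E1 E2 mulrDl.
- move=> p _; rewrite -cpa_scalerAl !liftZ -mulrA; congr (_ * _).
  set b := path_elt _ _ _; pose P' g := lift (b * g) = lift b * lift g.
  apply: (@cpa_ind _ _ _ P' M); rewrite /P'.
  + by rewrite mulr0 raddf0 mulr0.
  + by move=> f1 f2 E1 E2; rewrite mulrDr !raddfD /= E1 E2 mulrDr.
  + move=> q _; rewrite -cpa_scalerAr !liftZ liftM_path; last 2 first.
    * exact: (valP p).
    * exact: (valP q).
    by rewrite mulrA kalg_central mulrA.
  move=> f1 f2 f12 E2; rewrite (lift_congr f12) -E2.
  by apply: lift_congr; rewrite -mulrBr; apply: inradMl.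
move=> f1 f2 f12 E2; rewrite (lift_congr f12) -E2.
by apply: lift_congr; rewrite -mulrBl; apply: inradMr.
Qed.

HB.instance Definition _ :=
  GRing.isMonoidMorphism.Build (cpa K Q) S lift lift_monoid_morphism.

(** The universal property: a representation of the quiver in which long
    words vanish extends to the complete path algebra. *)
Lemma cpa_lift : exists F : {rmorphism cpa K Q -> S},
  [/\ forall c, F (cpa_scal c) = kalg_scal S c,
      forall f, inrad M f -> F f = 0,
      forall v, F (vertex_elt K v) = eps v
    & forall a, F (arrow_elt K a) = E a].
Proof.
exists lift; split.
- by move=> c; rewrite /= /cpa_scal liftZ rmorph1 mulr1.
- exact: lift_inrad.
- by move=> v; rewrite /= /vertex_elt lift_path // /lift_word big_nil mulr1.
- move=> a; rewrite /= /arrow_elt lift_path /= ?eqxx //.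
  by rewrite /lift_word big_cons big_nil mulr1 srcE.
Qed.

End Lift.
End Homomorphisms.

(** * Cyclic derivatives and the chain rule *)

Section CyclicDerivatives.
Variables (K : comPzRingType) (V : finType) (Q : quiver V).
Implicit Types (f g h W : cpa K Q) (v w : V) (l : seq Q) (a b : Q).

(** In a path [l] from [v], the coefficient of the subpath between the positions
    [x] and [y]. *)
Definition seg v l (x y : nat) f : K :=
  if (x <= y)%N then coef f (walk_end v (take x l)) (drop x (take y l)) else 0.

(** The same for the path that runs from the position [m] to the end of [l],
    through [b], and on from the start of [l] to the position [i]. *)
Definition wrap v l b (m i : nat) f : K :=
  coef f (walk_end v (take m l)) (drop m l ++ b :: take i l).

(** [cyc_bil b f h] is the bilinear form of the cyclic derivative: for a path
    [f] it is the sum, over the factorisations [f = u b v], of [v h u]; the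
    cyclic derivative is its value at [h = 1]. *)
Definition cyc_bil b f h : cpa K Q := fun p =>
  if pstart p == tgt b then
    \sum_(0 <= m < (plen p).+1) \sum_(0 <= i < (plen p).+1)
      wrap (pstart p) (pword p) b m i f * seg (pstart p) (pword p) i m h
  else 0.

Lemma walk_end_cat v l1 l2 : walk_end v (l1 ++ l2) = walk_end (walk_end v l1) l2.
Proof. by rewrite /walk_end map_cat last_cat. Qed.

Lemma walk_end_seg v l x z : (x <= z)%N ->
  walk_end (walk_end v (take x l)) (drop x (take z l)) = walk_end v (take z l).
Proof.
by move=> lexz; rewrite -walk_end_cat -{1}(take_takel l lexz) cat_take_drop.
Qed.

Lemma sum_nat_shift n x y (F : nat -> K) : (x <= y)%N -> (y <= n)%N ->
  (forall z, (z <= n)%N -> (z < x)%N || (y < z)%N -> F z = 0) ->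
  \sum_(0 <= z < n.+1) F z = \sum_(s < (y - x).+1) F (x + s)%N.
Proof.
move=> lexy leyn F0; rewrite (@big_cat_nat _ _ _ x) //=; last first.
  by rewrite leqW // (leq_trans lexy).
rewrite big_nat_cond big1 ?add0r => [|z /andP[/andP[_ ltz] _]]; last first.
  by rewrite F0 ?ltz // (leq_trans (ltnW ltz)) // (leq_trans lexy).
rewrite (@big_cat_nat _ _ _ y.+1) //=; last by rewrite leqW.
rewrite [X in _ + X]big_nat_cond [X in _ + X]big1 ?addr0; last first.
  by move=> z /andP[/andP[ltz lez] _]; rewrite F0 ?ltz ?orbT.
rewrite -{1}(add0n x) big_addn -subSn // big_mkord.
by apply: eq_bigr => s _; rewrite addnC.
Qed.

Lemma segM v l x y f g : (y <= size l)%N ->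
  seg v l x y (f * g) =
  \sum_(0 <= z < (size l).+1) seg v l x z f * seg v l z y g.
Proof.
move=> leyl; have [lexy|ltyx] := leqP x y; last first.
  rewrite /seg leqNgt ltyx /= big1_seq // => z _.
  case: leqP => [lexz|]; last by rewrite mul0r.
  by rewrite leqNgt (leq_trans ltyx) // mulr0.
rewrite (sum_nat_shift lexy leyl) => [|z _ /orP[ltzx|ltyz]]; last 2 first.
- by rewrite /seg (leqNgt x) ltzx mul0r.
- by rewrite /seg (leqNgt z) ltyz mulr0.
rewrite {1}/seg lexy coefM size_drop size_takel //.
apply: eq_bigr => s _; have les : (x + s <= y)%N.
  by rewrite -leq_subRL // -ltnS.
rewrite take_drop drop_drop [(s + x)%N]addnC take_takel // /seg leq_addr les.
by rewrite walk_end_seg // leq_addr.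
Qed.

Lemma wrapM v l b m i f g : (m <= size l)%N -> (i <= size l)%N -> v = tgt b ->
  wrap v l b m i (f * g) =
  \sum_(0 <= z < (size l).+1) seg v l m z f * wrap v l b z i g +
  \sum_(0 <= z < (size l).+1) wrap v l b m z f * seg v l z i g.
Proof.
move=> lem lei vb; rewrite /wrap coefM size_cat /= size_drop size_takel //.
rewrite -addSn big_split_ord /=; congr (_ + _).
  rewrite (sum_nat_shift lem) // => [|z lez /orP[ltzm|ltz]]; last 2 first.
  - by rewrite /seg leqNgt ltzm mul0r.
  - by rewrite ltnNge lez in ltz.
  apply: eq_bigr => s _; have les : (s <= size l - m)%N by rewrite -ltnS.
  have lems : (m + s <= size l)%N by rewrite -leq_subRL.
  rewrite takel_cat ?size_drop // drop_cat size_drop.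
  have -> : (if (s < size l - m)%N then drop s (drop m l) ++ b :: take i l
             else drop (s - (size l - m)) (b :: take i l)) =
            drop (m + s) l ++ b :: take i l.
    case: ltnP => [_|ges]; first by rewrite drop_drop addnC.
    have -> : s = (size l - m)%N :> nat by apply/eqP; rewrite eqn_leq les ges.
    by rewrite subnn subnKC // drop_size.
  rewrite /seg leq_addr take_drop [(s + m)%N]addnC.
  by rewrite walk_end_seg // leq_addr.
rewrite (@sum_nat_shift _ 0 i) // => [|z _ /= ltiz]; last first.
  by rewrite /seg leqNgt ltiz mulr0.
rewrite subn0; apply: eq_bigr => s _; have les : (s <= i)%N by rewrite -ltnS.
rewrite add0n take_cat drop_cat size_drop !ltnNge.
rewrite (leq_trans (leqnSn _) (leq_addr s _)) /= addSn -addnS addKn /=.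
rewrite take_takel // /seg les; congr (_ * coef g _ _).
by rewrite !walk_end_cat vb.
Qed.

(** Cutting a cyclic word into three pieces: the distinguished arrow [b] lies
    in the first or in the second factor of [f g]. *)
Lemma cyc_bil_leibniz b f g h :
  cyc_bil b (f * g) h = cyc_bil b f (g * h) + cyc_bil b g (h * f).
Proof.
apply/funext => p; rewrite cpaDE /cyc_bil; case: eqP => [vb|]; last by rewrite addr0.
move: (pstart p) vb => v vb; rewrite /plen; move: (pword p) => l.
set n := (size l).+1.
have lt_n (x : nat) : (0 <= x < n)%N -> (x <= size l)%N by rewrite ltnS.
transitivity (\sum_(0 <= m < n) \sum_(0 <= i < n) \sum_(0 <= z < n)
    (seg v l m z f * wrap v l b z i g * seg v l i m h +
     wrap v l b m z f * seg v l z i g * seg v l i m h)).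
  apply: eq_big_nat => m /lt_n lem; apply: eq_big_nat => i /lt_n lei.
  by rewrite wrapM // mulrDl !big_distrl -big_split.
under eq_bigr => m _ do under eq_bigr => i _ do rewrite big_split.
under eq_bigr => m _ do rewrite big_split.
rewrite big_split addrC; congr (_ + _).
  under eq_bigr => m _ do rewrite exchange_big_nat.
  rewrite exchange_big_nat; apply: eq_big_nat => z /lt_n lez.
  rewrite exchange_big_nat; apply: eq_bigr => i _; rewrite segM // big_distrr.
  by apply: eq_bigr => m _; rewrite /= [seg v l i m h * _]mulrC mulrCA mulrA.
apply: eq_big_nat => m /lt_n lem; rewrite exchange_big_nat.
apply: eq_bigr => z _; rewrite segM // big_distrr.
by apply: eq_bigr => i _; rewrite /= mulrA.
Qed.

Lemma segD v l x y f g : seg v l x y (f + g) = seg v l x y f + seg v l x y g.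
Proof. by rewrite /seg; case: ifP; rewrite ?coefD ?addr0. Qed.

Lemma segZ v l x y c f : seg v l x y (c *: f) = c * seg v l x y f.
Proof. by rewrite /seg; case: ifP; rewrite ?coefZ ?mulr0. Qed.

Lemma cyc_bil_linearl b h : linear (cyc_bil b ^~ h).
Proof.
move=> c f g; apply/funext => p; rewrite cpaDE cpaZE /cyc_bil.
case: ifP => _; last by rewrite mulr0 addr0.
rewrite big_distrr -big_split; apply: eq_bigr => m _ /=.
rewrite big_distrr -big_split; apply: eq_bigr => i _ /=.
by rewrite /wrap coefD coefZ mulrDl mulrA.
Qed.

Lemma cyc_bil_linearr b f : linear (cyc_bil b f).
Proof.
move=> c g h; apply/funext => p; rewrite cpaDE cpaZE /cyc_bil.
case: ifP => _; last by rewrite mulr0 addr0.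
rewrite big_distrr -big_split; apply: eq_bigr => m _ /=.
rewrite big_distrr -big_split; apply: eq_bigr => i _ /=.
by rewrite segD segZ mulrDr mulrCA.
Qed.

HB.instance Definition _ b f :=
  GRing.isLinear.Build K (cpa K Q) (cpa K Q) *:%R (cyc_bil b f) (cyc_bil_linearr b f).

Lemma cyc_bilDl b f g h : cyc_bil b (f + g) h = cyc_bil b f h + cyc_bil b g h.
Proof. by have := cyc_bil_linearl b h 1 f g; rewrite !scale1r. Qed.

Lemma cyc_bil0l b h : cyc_bil b 0 h = 0.
Proof. by have := cyc_bil_linearl b h (-1) 0 0; rewrite !scaleN1r !addNr. Qed.

Lemma cyc_bilZl b c f h : cyc_bil b (c *: f) h = c *: cyc_bil b f h.
Proof. by rewrite -[c *: f]addr0 (cyc_bil_linearl b h) cyc_bil0l addr0. Qed.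

Lemma cyc_bilBl b f g h : cyc_bil b (f - g) h = cyc_bil b f h - cyc_bil b g h.
Proof. by rewrite cyc_bilDl -scaleN1r cyc_bilZl scaleN1r. Qed.

Lemma inrad_cyc_bill n b f h : inrad n.+1 f -> inrad n (cyc_bil b f h).
Proof.
move=> Hf v l ltl; have [vl|nvl] := boolP (walk v l); last by rewrite coef_nwalk.
rewrite coef_walk /cyc_bil /plen /pword /=; case: ifP => // _.
rewrite big1 // => m _; rewrite big1 // => i _.
rewrite /seg; case: leqP => [leim|]; last by rewrite mulr0.
rewrite /wrap Hf ?mul0r // size_cat /= size_drop addnS ltnS.
apply: leq_trans ltl; rewrite ltnS; have [lem|ltm] := leqP m (size l).
  by rewrite size_takel ?(leq_trans leim) // -leq_subRL ?leq_subr // subKn.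
by rewrite (eqP (ltnW ltm : _ - _ == 0)%N) size_take; case: ltnP => // /ltnW.
Qed.

Lemma inrad_cyc_bilr n b f h : inrad n h -> inrad n (cyc_bil b f h).
Proof.
move=> Hh v l ltl; have [vl|nvl] := boolP (walk v l); last by rewrite coef_nwalk.
rewrite coef_walk /cyc_bil /plen /pword /=; case: ifP => // _.
rewrite big1 // => m _; rewrite big1 // => i _.
rewrite /seg; case: leqP => [leim|]; last by rewrite mulr0.
rewrite Hh ?mulr0 // size_drop; apply: leq_ltn_trans (leq_subr _ _) _.
by apply: leq_ltn_trans ltl; rewrite size_take; case: ltnP => // /ltnW.
Qed.

Lemma cyc_bil_vertex b v h : cyc_bil b (vertex_elt K v) h = 0.
Proof.
apply/funext => p; rewrite /cyc_bil; case: ifP => // _.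
rewrite big1 // => m _; rewrite big1 // => i _.
rewrite /wrap coef_path xpair_eqE; case: (drop _ _) => [|x l] /=;
by rewrite ?andbF mul0r.
Qed.

Lemma cyc_bil_vertexl b v f h :
  cyc_bil b (vertex_elt K v * f) h = cyc_bil b f (h * vertex_elt K v).
Proof. by rewrite cyc_bil_leibniz cyc_bil_vertex add0r. Qed.

Lemma cyc_bil_vertexr b v f h :
  cyc_bil b (f * vertex_elt K v) h = cyc_bil b f (vertex_elt K v * h).
Proof. by rewrite cyc_bil_leibniz cyc_bil_vertex addr0. Qed.

Lemma cyc_bil_arrow b a h : cyc_bil b (arrow_elt K a) h =
  (a == b)%:R *: (vertex_elt K (tgt b) * h * vertex_elt K (src b)).
Proof.
apply: cpaP => v l vl; rewrite coefZ coef_Mvertex coef_vertexM coef_walk.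
rewrite /cyc_bil /plen /pword /pstart /=; case: eqP => [vb|]; last first.
  by rewrite !mul0r mulr0.
have wE m i : wrap v l b m i (arrow_elt K a) =
    [&& a == b, drop m l == [::], take i l == [::] &
        walk_end v (take m l) == src b]%:R.
  rewrite /wrap coef_path xpair_eqE.
  case: (drop m l) => [|x s].
    rewrite cat0s eqseq_cons; case: (take i l) => [|y s]; last by rewrite /= !andbF.
    rewrite /= [src b == _]eq_sym eqxx !andbT; set u := walk_end _ _.
    case: (u =P src b) => [->|nu]; last by rewrite !andbF.
    by have [->|] := eqVneq b a; rewrite ?eqxx // !andbF.
  suff -> : ((x :: s) ++ b :: take i l == [:: a]) = false by rewrite !andbF.
  by rewrite cat_cons eqseq_cons; case: s => [|y s]; rewrite andbF.
rewrite big_nat_recr //= big_nat_cond big1 ?add0r => [|m /andP[/andP[_ ltm] _]].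
  rewrite big_nat_recl //= big_nat_cond big1 ?addr0 => [|i /andP[/andP[_ lti] _]].
    rewrite wE drop_size take0 take_size /= /seg /= take0 drop0 take_size mul1r.
    by case: (a == b); rewrite /= ?mul0r // mul1r mulrC.
  rewrite wE; case: l {vl wE} lti => //= x l _.
  by rewrite !andbF mul0r.
rewrite big1 // => i _; rewrite wE -size_eq0 size_drop subn_eq0 leqNgt ltm.
by rewrite andbF mul0r.
Qed.

(** ** Comparison with the cyclic derivative *)

Lemma cyclic_coef W v l : (forall p, W p != 0 -> is_cycle p) ->
  walk_end v l != v -> coef W v l = 0.
Proof.
move=> Wc nvl; have [vl|] := boolP (walk v l); last exact: coef_nwalk.
rewrite coef_walk; apply/eqP/negPn/negP => /Wc.
by rewrite /is_cycle /pend /pstart /pword /= eq_sym (negbTE nvl).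
Qed.

Lemma cyc_der_is_linear a : linear (cyc_der (K := K) a).
Proof.
move=> c f g; apply/funext => p; rewrite cpaDE cpaZE /cyc_der big_distrr.
rewrite -big_split; apply: eq_bigr => t _ /=.
by rewrite coefD coefZ mulrDl mulrA.
Qed.

HB.instance Definition _ a :=
  GRing.isLinear.Build K (cpa K Q) (cpa K Q) *:%R (cyc_der a) (cyc_der_is_linear a).

Lemma inrad_cyc_der n a W : inrad n.+1 W -> inrad n (cyc_der a W).
Proof.
move=> HW v l ltl; have [vl|nvl] := boolP (walk v l); last by rewrite coef_nwalk.
rewrite coef_walk /cyc_der big1 // => t _; rewrite HW ?mul0r //.
by rewrite size_tuple.
Qed.

Lemma cyc_derE a W (p : qpath Q) : (forall p, W p != 0 -> is_cycle p) ->
  cyc_der a W p =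
  if pstart p == tgt a then
    \sum_(j < (plen p).+1)
      coef W (walk_end (pstart p) (take j (pword p)))
             (drop j (pword p) ++ a :: take j (pword p))
  else 0.
Proof.
move=> Wc; rewrite /cyc_der; set n := plen p.
have wordE (t : n.+1.-tuple Q) : cyc_der_word K a t p = \sum_(i < n.+1)
    if nth a t i == a then (val p == (tgt a, drop i.+1 t ++ take i t))%:R else 0.
  rewrite -big_mkcond /cyc_der_word.
  rewrite -(big_mkord (fun i => nth a t i == a)
    (fun i => (val p == (tgt a, drop i.+1 t ++ take i t))%:R)).
  rewrite -(big_mkord (fun i => nth a t i == a)
    (fun i => path_elt K (tgt a) (drop i.+1 t ++ take i t))) size_tuple.
  by elim/big_rec2: _ => // i y1 y2 _ <-.
under eq_bigr => t _ do rewrite wordE big_distrr.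
rewrite exchange_big (reindex_inj rev_ord_inj) /=.
rewrite -[if _ then _ else _]/(if pstart p == tgt a then _ else 0).
have lE (t : n.+1.-tuple Q) (j : 'I_n.+1) :
    nth a t (n.+1 - j.+1) == a ->
    pword p = drop (n.+1 - j.+1).+1 t ++ take (n.+1 - j.+1) t ->
    tval t = drop j (pword p) ++ a :: take j (pword p).
  have lej : (j <= n)%N by rewrite -ltnS.
  have szd : size (drop (n.+1 - j.+1).+1 t) = j.
    by rewrite size_drop size_tuple !subSS subKn.
  move=> /eqP na ->; rewrite drop_size_cat // take_size_cat //.
  rewrite -{1}(cat_take_drop (n.+1 - j.+1) t); congr (_ ++ _).
  by rewrite (drop_nth a) ?na // size_tuple subSS ltnS leq_subr.
have [vb|nvb] := eqVneq (pstart p) (tgt a); last first.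
  rewrite big1 // => j _; rewrite big1 // => t _; case: ifP => _; last exact: mulr0.
  rewrite (_ : _ == _ = false) ?mulr0 //; apply: contraNF nvb => /eqP pE.
  by rewrite /pstart (pE : val p = _).
apply: eq_bigr => j _; have lej : (j <= n)%N by rewrite -ltnS.
have szt : size (drop j (pword p) ++ a :: take j (pword p)) == n.+1.
  by rewrite size_cat /= size_drop size_takel // addnS subnK.
rewrite (bigD1 (Tuple szt)) //= [X in _ + X]big1 ?addr0 => [|t nt]; last first.
  case: ifP => na; last exact: mulr0.
  rewrite (_ : _ == _ = false) ?mulr0 //; apply: contraNF nt => /eqP pE.
  by apply/eqP/val_inj/lE => //; rewrite /pword (pE : val p = _).
have szd : size (drop j (pword p)) = (n.+1 - j.+1)%N by rewrite size_drop subSS.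
rewrite [X in coef W X _](_ : _ = src (nth a (drop j (pword p) ++ a :: take j (pword p)) 0));
  last by rewrite /thead (tnth_nth a).
set c := coef W _ _; have -> : c = coef W (walk_end (pstart p) (take j (pword p)))
    (drop j (pword p) ++ a :: take j (pword p)).
  rewrite /c; have := walk_drop j (valP p); rewrite -/(pword p) -/(pstart p).
  case Ed: (drop j (pword p)) => [|x s] /= => [_|/andP[/eqP -> //]].
  set u := walk_end _ _; have [<- //|nu] := eqVneq (src a) u.
  rewrite [RHS]coef_nwalk /= ?(negbTE nu) //; apply: cyclic_coef => //.
  by rewrite /walk_end /= -vb eq_sym.
rewrite nth_cat szd ltnn subnn /= eqxx -szd take_size_cat //.
rewrite -cat_rcons drop_size_cat ?size_rcons // cat_take_drop -vb.
by rewrite /pstart /pword -surjective_pairing eqxx mulr1.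
Qed.

Lemma cyc_der_bil a W : (forall p, W p != 0 -> is_cycle p) ->
  cyc_der a W = cyc_bil a W 1.
Proof.
move=> Wc; apply/funext => p; rewrite cyc_derE // /cyc_bil; case: ifP => // _.
rewrite -(big_mkord xpredT (fun j => coef W (walk_end (pstart p) (take j (pword p)))
             (drop j (pword p) ++ a :: take j (pword p)))).
apply: eq_big_nat => j /andP[_ ltj].
rewrite (bigD1_seq j) ?mem_index_iota ?iota_uniq //= big1 => [|i nij].
  rewrite /seg leqnn coef1 [drop j (take j _)]drop_oversize ?eqxx ?mulr1 ?addr0 //.
  by rewrite size_take; case: ltnP.
rewrite /seg; case: leqP => [leij|]; last by rewrite mulr0.
rewrite coef1 -size_eq0 size_drop size_takel // subn_eq0 leqNgt.
by rewrite ltn_neqAle nij leij mulr0.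
Qed.

Lemma cyc_bil_ideal (I : ideal (cpa K Q)) b f h :
  rad_closed I -> I h -> I (cyc_bil b f h).
Proof.
move=> Icl Ih; apply: Icl => n.
exists (cyc_bil b (\sum_(p <- paths_lt Q n.+1) f p *: basis K p) h); last first.
  by rewrite -cyc_bilBl; apply/inrad_cyc_bill/trunc_congr.
elim/big_ind: _ => [|g1 g2|p _]; first by rewrite cyc_bil0l; apply: ideal0.
  by rewrite cyc_bilDl; apply: idealD.
rewrite cyc_bilZl; apply: idealZ; case: p => -[v l] vl.
rewrite /pstart /pword /= in vl *.
elim: l v vl h Ih => [|a l IH] v vl h Ih.
  by rewrite cyc_bil_vertex; apply: ideal0.
rewrite path_elt_cons // cyc_bil_leibniz; apply: idealD.
  by rewrite cyc_bil_arrow; apply/idealZ/idealMr/idealMl/idealMl.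
by apply: IH; [case/andP: vl|apply: idealMr].
Qed.

End CyclicDerivatives.

Section ChainRule.
Variables (K : fieldType) (V : finType) (Q Q' : quiver V).
Variable G : {rmorphism cpa K Q -> cpa K Q'}.
Hypothesis Gs : forall c, G (cpa_scal c) = cpa_scal c.
Hypothesis Gv : forall v, G (vertex_elt K v) = vertex_elt K v.

(** Both sides are bilinear, obey the same Leibniz rule in [f], and agree on
    arrows; for [h = 1] this is the chain rule for cyclic derivatives. *)
Lemma cyc_bil_hom b f h : cyc_bil b (G f) (G h) =
  \sum_a cyc_bil b (G (arrow_elt K a)) (G (cyc_bil a f h)).
Proof.
have GZ c x : G (c *: x) = c *: G x.
  by rewrite !scale_cpa_scal rmorphM Gs.
have arrowE a x : cyc_bil b (G (arrow_elt K a)) x = cyc_bil b (G (arrow_elt K a))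
    (vertex_elt K (tgt a) * x * vertex_elt K (src a)).
  have Ga : G (arrow_elt K a) =
      vertex_elt K (src a) * G (arrow_elt K a) * vertex_elt K (tgt a).
    by rewrite -!Gv -!rmorphM src_arrow arrow_tgt.
  by rewrite {1}Ga cyc_bil_vertexr cyc_bil_vertexl.
have pathE v l x : walk v l -> cyc_bil b (G (path_elt K v l)) (G x) =
    \sum_a cyc_bil b (G (arrow_elt K a)) (G (cyc_bil a (path_elt K v l) x)).
  elim: l v x => [|c l IH] v x vl.
    rewrite Gv cyc_bil_vertex big1 // => a _.
    by rewrite cyc_bil_vertex rmorph0 raddf0.
  rewrite path_elt_cons // rmorphM cyc_bil_leibniz -!rmorphM IH; last by case/andP: vl.
  under [in RHS]eq_bigr => a _ do rewrite cyc_bil_leibniz rmorphD raddfD.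
  rewrite big_split; congr (_ + _); rewrite (bigD1 c) //= big1 => [|a nac].
    by rewrite cyc_bil_arrow eqxx scale1r addr0 arrowE !rmorphM !Gv.
  by rewrite cyc_bil_arrow eq_sym (negbTE nac) scale0r rmorph0 raddf0.
apply/eqP; rewrite -subr_eq0; apply/eqP/inrad_eq0 => N.
set R := fun f => \sum_a cyc_bil b (G (arrow_elt K a)) (G (cyc_bil a f h)).
have RB x y : R (x - y) = R x - R y.
  rewrite /R -sumrB; apply: eq_bigr => a _.
  by rewrite cyc_bilBl rmorphB raddfB.
pose D x := cyc_bil b (G x) (G h) - R x.
rewrite -/(R f) -/(D f).
have DB x y : D (x - y) = D x - D y.
  by rewrite /D RB rmorphB cyc_bilBl !opprD addrACA.
have DN x : inrad N.+1 x -> inrad N (D x).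
  move=> Hx; apply: inradB; first exact/inrad_cyc_bill/hom_inrad.
  apply: inrad_sum => a _; apply: inrad_cyc_bilr; apply: hom_inrad => //.
  exact: inrad_cyc_bill.
apply: (@cpa_ind _ _ _ (fun x => inrad N (D x)) N.+1).
- by rewrite -(subrr 0) DB subrr; apply: inrad0.
- move=> x y Dx Dy; rewrite -[y]opprK -[- y]add0r !DB -[0](subrr 0) DB subrr sub0r.
  by rewrite opprK; apply: inradD.
- move=> p _; rewrite /D /R GZ cyc_bilZl pathE; last exact: (valP p).
  rewrite scaler_sumr -sumrB; apply: inrad_sum => a _.
  by rewrite cyc_bilZl GZ linearZ subrr; apply: inrad0.
by move=> x y xy Dy; rewrite -[D x](subrK (D y)) -DB; apply: inradD (DN _ xy) Dy.
Qed.

End ChainRule.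

Section CyclicInvariance.
Variables (K : comPzRingType) (V : finType) (Q : quiver V).
Implicit Types (f g h W : cpa K Q) (v w : V) (l : seq Q) (a b : Q).

Lemma cyclic_decomp W : (forall p, W p != 0 -> is_cycle p) ->
  W = \sum_v vertex_elt K v * W * vertex_elt K v.
Proof.
move=> Wc; apply: cpaP => v l vl; rewrite coef_sum (bigD1 v) //= big1 => [|w nwv].
  rewrite coef_Mvertex coef_vertexM eqxx mul1r addr0.
  by have [//|nc] := eqVneq (walk_end v l) v; rewrite ?mulr1 // cyclic_coef // mul0r.
by rewrite coef_Mvertex coef_vertexM eq_sym (negbTE nwv) !mul0r.
Qed.

Lemma cyclic_of_decomp W : W = \sum_v vertex_elt K v * W * vertex_elt K v ->
  forall p, W p != 0 -> is_cycle p.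
Proof.
move=> WE p; apply: contraR => nc; rewrite WE -coefE coef_sum; apply/eqP/big1 => v _.
rewrite coef_Mvertex coef_vertexM -/(pend p).
have [pv|] := eqVneq (pstart p) v; last by rewrite !mul0r.
rewrite (_ : _ == v = false) ?mulr0 //; apply: contraNF nc => /eqP ev.
by rewrite /is_cycle pv -ev.
Qed.

Lemma cyc_der_rotation a f : rotation_diff f -> cyc_der a f = 0.
Proof.
move=> [b [l [bl be ->]]].
have al : walk (tgt b) l by case/andP: bl.
have El : walk_end (tgt b) l = src b by [].
have cyc v s : walk_end v s = v ->
    forall p, path_elt K v s p != 0 -> is_cycle p.
  move=> Ev p; rewrite /path_elt; case: (val p =P _) => [pE _|_ /eqP/(_ erefl)] //.
  by rewrite /is_cycle /pend /pstart /pword (pE : val p = _) /= Ev.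
have lbE : path_elt K (tgt b) (rcons l b) = path_elt K (tgt b) l * arrow_elt K b.
  by rewrite path_eltM // El eqxx cats1.
have Elb : walk_end (tgt b) (rcons l b) = tgt b by rewrite -cats1 walk_end_cat.
rewrite linearB /= !cyc_der_bil; try exact: cyc.
rewrite path_elt_cons // lbE !cyc_bil_leibniz !mulr1 !mul1r.
by rewrite [X in _ - X]addrC subrr.
Qed.

Lemma cyc_equiv_der W W' : cyc_equiv W W' ->
  forall a, cyc_der a W = cyc_der a W'.
Proof.
move=> WW' a; apply/eqP; rewrite -subr_eq0; apply/eqP/inrad_eq0 => n.
have [g [m [c [s [sR ->]]]] /congr_radP Wg] := WW' n.+1.
have E0 : cyc_der a (\sum_i c i *: s i) = 0.
  by rewrite linear_sum big1 // => i _; rewrite linearZ /= cyc_der_rotation ?scaler0.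
have -> : cyc_der a W - cyc_der a W' = cyc_der a (W - W' - \sum_i c i *: s i).
  by rewrite !linearB /= E0 subr0.
exact: inrad_cyc_der.
Qed.

End CyclicInvariance.

Section JacobianIdeals.
Variables (K : fieldType) (V : finType) (Q Q' : quiver V).
Variable G : {rmorphism cpa K Q -> cpa K Q'}.
Hypothesis Gs : forall c, G (cpa_scal c) = cpa_scal c.
Hypothesis Gv : forall v, G (vertex_elt K v) = vertex_elt K v.

Lemma cyclic_hom W : (forall p, W p != 0 -> is_cycle p) ->
  forall p, G W p != 0 -> is_cycle p.
Proof.
move=> Wc; apply: cyclic_of_decomp; rewrite {1}(cyclic_decomp Wc) rmorph_sum.
by apply: eq_bigr => v _; rewrite !rmorphM !Gv.
Qed.

(** By the chain rule, the Jacobian ideal of the image of a potential lies in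
    every closed ideal containing the images of its cyclic derivatives. *)
Lemma cyc_der_hom (I : ideal (cpa K Q')) W : (forall p, W p != 0 -> is_cycle p) ->
  rad_closed I -> (forall a, I (G (cyc_der a W))) ->
  forall b, I (cyc_der b (G W)).
Proof.
move=> Wc Icl IW b; rewrite cyc_der_bil; last exact: cyclic_hom.
rewrite -(rmorph1 G) cyc_bil_hom //; apply: ideal_sum => a _.
by apply: cyc_bil_ideal => //; rewrite -cyc_der_bil.
Qed.

End JacobianIdeals.

Section DerivativeCoefficients.
Variables (K : comPzRingType) (V : finType) (Q : quiver V).

Lemma coef_cyc_der a (W : cpa K Q) v l : (forall p, W p != 0 -> is_cycle p) ->
  coef (cyc_der a W) v l =
  if v == tgt a then \sum_(j < (size l).+1)
    coef W (walk_end v (take j l)) (drop j l ++ a :: take j l)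
  else 0.
Proof.
move=> Wc; have [vl|nvl] := boolP (walk v l); first by rewrite coef_walk cyc_derE.
rewrite coef_nwalk //; case: eqP => // va; rewrite big1 // => j _.
rewrite coef_nwalk //; apply: contra nvl; rewrite walk_cat /= -va.
by case/and3P=> wd _ wt; rewrite -(cat_take_drop j l) walk_cat wt.
Qed.

Lemma cyc_der_src a (W : cpa K Q) : (forall p, W p != 0 -> is_cycle p) ->
  vertex_elt K (tgt a) * cyc_der a W = cyc_der a W.
Proof.
move=> Wc; apply: cpaP => v l _; rewrite coef_vertexM coef_cyc_der //.
by case: eqP => _; rewrite ?mul1r ?mul0r.
Qed.

Lemma cyc_der_tgt a (W : cpa K Q) : (forall p, W p != 0 -> is_cycle p) ->
  cyc_der a W * vertex_elt K (src a) = cyc_der a W.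
Proof.
move=> Wc; apply: cpaP => v l _; rewrite coef_Mvertex coef_cyc_der //.
case: eqP => [va|_]; last by rewrite mul0r.
case: (walk_end v l =P _) => [_|nve]; first by rewrite mulr1.
rewrite mulr0 big1 // => j _; rewrite coef_nwalk //.
apply: contra_notN nve; rewrite walk_cat /= -walk_end_cat cat_take_drop.
by case/and3P=> _ /eqP ->.
Qed.

End DerivativeCoefficients.

(** * Truncated Jacobian algebras as quotients of the whole path algebra *)

Section PreimageIdeal.
Variables (A B : pzRingType) (F : {rmorphism A -> B}) (I : ideal B).

Lemma preim_ideal0 : I (F 0).
Proof. by rewrite rmorph0; apply: ideal0. Qed.
Lemma preim_idealD x y : I (F x) -> I (F y) -> I (F (x + y)).
Proof. by rewrite rmorphD; apply: idealD. Qed.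
Lemma preim_idealMl a x : I (F x) -> I (F (a * x)).
Proof. by rewrite rmorphM; apply: idealMl. Qed.
Lemma preim_idealMr a x : I (F x) -> I (F (x * a)).
Proof. by rewrite rmorphM; apply: idealMr. Qed.

Definition preim_ideal : ideal A :=
  Ideal preim_ideal0 preim_idealD preim_idealMl preim_idealMr.

Lemma preim_idealE x : preim_ideal x = I (F x). Proof. by []. Qed.

End PreimageIdeal.

Lemma rad_closed_preim (K : comPzRingType) (V : finType) (Q Q' : quiver V)
    (F : {rmorphism cpa K Q -> cpa K Q'}) (I : ideal (cpa K Q')) :
  (forall n f, inrad n f -> inrad n (F f)) ->
  rad_closed I -> rad_closed (preim_ideal F I).
Proof.
move=> Fc Icl f Hf; apply: Icl => n; have [g Ig fg] := Hf n.
by exists (F g) => //; rewrite -rmorphB; apply: Fc.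
Qed.

Section Cuts.
Variables (K : comPzRingType) (V : finType) (Q : quiver V).
Implicit Types (C : {set Q}) (W f : cpa K Q).

Lemma cut_pmap_ends C (y : cut_quiver C) (x : Q) :
  Some (val y) = Some x -> src y = src x /\ tgt y = tgt x.
Proof. by case=> <-. Qed.

Definition cut_pmap C := QuiverPmap (@cut_pmap_ends C).

Definition restr C : cpa K Q -> cpa K (cut_quiver C) := subst (cut_pmap C).
Arguments restr : clear implicits.

HB.instance Definition _ C := GRing.RMorphism.on (restr C).
HB.instance Definition _ C := GRing.Linear.on (restr C).

Lemma coef_restr C f v (l : seq (cut_quiver C)) :
  coef (restr C f) v l = coef f v (map val l).
Proof.
rewrite coef_subst.
have -> : all (qpmap (cut_pmap C)) l by apply/allP.
by congr coef; elim: l => //= a l ->.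
Qed.

Lemma cut_restrictE C f : cut_restrict (C := C) f = restr C f.
Proof. by apply/funext => p; rewrite -[RHS]coefE coef_restr. Qed.

Lemma cut_ext_ends C (y : Q) (x : cut_quiver C) :
  insub y = Some x -> src y = src x /\ tgt y = tgt x.
Proof. by case: insubP => // u _ <- [<-]. Qed.

Definition cut_ext C := QuiverPmap (@cut_ext_ends C).

Definition ext C : cpa K (cut_quiver C) -> cpa K Q := subst (cut_ext C).
Arguments ext : clear implicits.

HB.instance Definition _ C := GRing.RMorphism.on (ext C).
HB.instance Definition _ C := GRing.Linear.on (ext C).

Lemma ext_restrK C : cancel (ext C) (restr C).
Proof.
move=> f; apply: cpaP => v l vl; rewrite coef_restr coef_subst.
have -> : all (qpmap (cut_ext C)) (map val l).
  by apply/allP => _ /mapP[x _ ->]; rewrite /= insubT ?(valP x).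
congr coef; elim: l {vl} => //= a l ->.
by rewrite valK.
Qed.

(** The kernel of the projection of the whole path algebra onto the truncated
    Jacobian algebra *)
Definition cut_ideal W C : ideal (cpa K Q) := preim_ideal (restr C)
  (closed_ideal (fun g => exists2 c, c \in C & g = cut_relation W c)).

Lemma cut_ideal_closed W C : rad_closed (cut_ideal W C).
Proof.
by apply: rad_closed_preim (@closed_ideal_closed _ _ _ _); exact: inrad_subst.
Qed.

Lemma cut_ideal_restr0 W C f : restr C f = 0 -> cut_ideal W C f.
Proof. by rewrite /= => ->; apply: (ideal0 (closed_ideal _)). Qed.

Lemma cut_ideal_der W C c : c \in C -> cut_ideal W C (cyc_der c W).
Proof.
move=> cC; rewrite /= -cut_restrictE; apply: mem_closed_ideal.
by exists c.
Qed.

(** Modulo the arrows of [C] an element equals the extension by zero of its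
    restriction, so [cut_ideal] is the least closed ideal with these elements. *)
Lemma cut_ideal_min W C (J : ideal (cpa K Q)) : rad_closed J ->
  (forall f, restr C f = 0 -> J f) ->
  (forall c, c \in C -> J (cyc_der c W)) ->
  forall f, cut_ideal W C f -> J f.
Proof.
move=> Jcl J0 JW f If.
have Jf x : J (x - ext C (restr C x)).
  by apply: J0; rewrite rmorphB /= ext_restrK subrr.
have Jext x : J x -> J (ext C (restr C x)).
  by move=> Jx; rewrite -[ext _ _](subKr x); apply: idealB.
apply: ideal_congr (Jf f) _; move: If => /=; move: (restr C f).
apply: (closed_ideal_ind (P := fun x => J (ext C x))).
- by rewrite rmorph0; apply: ideal0.
- by move=> x y Jx Jy; rewrite rmorphD; apply: idealD.
- by move=> a x Jx; rewrite rmorphM; apply: idealMl.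
- by move=> a x Jx; rewrite rmorphM; apply: idealMr.
- by move=> _ [c cC ->]; rewrite /cut_relation cut_restrictE; apply/Jext/JW.
- move=> x Hx; apply: Jcl => n; have [g Jg xg] := Hx n.
  by exists (ext C g) => //; rewrite -rmorphB; apply: inrad_subst.
Qed.

End Cuts.
Arguments restr {K V Q} C f.
Arguments ext {K V Q} C f.

(** Right-equivalences and projections onto summands are homomorphisms of the
    whole path algebras and need not respect the subquivers without the cuts;
    [cut_ideal] describes both algebras as quotients on that level. *)
Lemma cut_jacobian_iso (K : fieldType) (V : finType) (Q Q' : quiver V)
    (W : cpa K Q) (C : {set Q}) (W' : cpa K Q') (C' : {set Q'})
    (F : {rmorphism cpa K Q -> cpa K Q'}) :
  (forall c, F (cpa_scal c) = cpa_scal c) ->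
  (forall g, exists f, restr C' (F f) = g) ->
  (forall f, cut_ideal W C f <-> cut_ideal W' C' (F f)) ->
  alg_isomorphic (cut_jacobian W C) (cut_jacobian W' C').
Proof.
move=> Fs Fsurj FI.
have restr_scal (Q0 : quiver V) (C0 : {set Q0}) (c : K) :
    restr C0 (cpa_scal c) = cpa_scal c.
  by rewrite /cpa_scal linearZ /= rmorph1.
pose A : kalgebra K := cpa_alg K Q.
have isoX : alg_isomorphic (quot_alg (A := A) (cut_ideal W C)) (cut_jacobian W C).
  pose G := @quot_pi (cpa K (cut_quiver C))
    (closed_ideal (fun f => exists2 c, c \in C & f = cut_relation W c)) \o restr C.
  apply: (@quot_iso K A (cut_jacobian W C) _ G).
  - by move=> c; rewrite /= restr_scal.
  - move=> y; exists (ext C (quot_repr y)).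
    by rewrite /= ext_restrK quot_reprK.
  - by move=> x; apply: quot_pi0P.
pose G := @quot_pi (cpa K (cut_quiver C'))
  (closed_ideal (fun f => exists2 c, c \in C' & f = cut_relation W' c)) \o (restr C' \o F).
apply: alg_isomorphic_trans (alg_isomorphic_sym isoX) _.
apply: (@quot_iso K A (cut_jacobian W' C') _ G).
- by move=> c; rewrite /= Fs restr_scal.
- move=> y; have [f Ef] := Fsurj (quot_repr y); exists f.
  by rewrite /= Ef quot_reprK.
by move=> x; rewrite FI; apply: quot_pi0P.
Qed.

(** Up to a high power of the radical, [f] is a finite combination of paths, each
    of them a multiple of an arrow of the ideal. *)
Lemma ideal_of_arrows (K : comPzRingType) (V : finType) (Q : quiver V)
    (J : ideal (cpa K Q)) (S : pred Q) f : rad_closed J ->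
  (forall a, S a -> J (arrow_elt K a)) ->
  (forall v l, ~~ has S l -> coef f v l = 0) -> J f.
Proof.
move=> Jcl JS fS; apply: Jcl => n.
exists (\sum_(p <- paths_lt Q n) f p *: basis K p); last exact: trunc_congr.
apply: ideal_sum => p _; have [|nS] := boolP (has S (pword p)); last first.
  by rewrite -coefE fS // scale0r; apply: ideal0.
move=> pS; apply: idealZ; case: p pS => -[v l] vl; rewrite /pstart /pword /=.
rewrite /= in vl; elim: l v vl => //= a l IH v vl /orP[Sa|Sl].
  by rewrite path_elt_cons //; apply/idealMr/JS.
by rewrite path_elt_cons //; apply/idealMl/IH => //; case/andP: vl.
Qed.

(** * Invariance under graded right-equivalence *)

Section TransportIdeal.
Variables (K : fieldType) (V : finType) (Q Q' : quiver V).
Variables (G : {rmorphism cpa K Q -> cpa K Q'}) (H : {rmorphism cpa K Q' -> cpa K Q}).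
Hypothesis Gs : forall c, G (cpa_scal c) = cpa_scal c.
Hypothesis Hs : forall c, H (cpa_scal c) = cpa_scal c.
Hypothesis Hv : forall v, H (vertex_elt K v) = vertex_elt K v.
Hypothesis HK : cancel H G.

(** The potential [W] may be replaced by [H U] since only its cyclic derivatives
    enter; the chain rule along [H] then moves the question to the derivatives
    of [U], which lie in the ideal by hypothesis. *)
Lemma cut_ideal_hom (C : {set Q}) (C' : {set Q'}) W W' U :
  (forall f, restr C f = 0 -> restr C' (G f) = 0) ->
  (forall p, U p != 0 -> is_cycle p) ->
  (forall c, cyc_der c W = cyc_der c (H U)) ->
  (forall b, cut_ideal W' C' (cyc_der b U)) ->
  forall f, cut_ideal W C f -> cut_ideal W' C' (G f).
Proof.
move=> G0 Uc WU JU; pose J := preim_ideal G (cut_ideal W' C').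
have Jcl : rad_closed J.
  by apply: rad_closed_preim (@cut_ideal_closed _ _ _ _ _) => n f; apply: hom_inrad.
apply: (@cut_ideal_min _ _ _ W C J) => // [f /G0|c _].
  exact: cut_ideal_restr0.
rewrite WU; apply: cyc_der_hom => // a.
by rewrite /J preim_idealE HK; apply: JU.
Qed.

End TransportIdeal.

Section Degrees.
Variables (K : fieldType) (V : finType).

Definition wdeg (Q : quiver V) (d : Q -> int) (l : seq Q) : int := \sum_(a <- l) d a.

Lemma homogeneousE (Q : quiver V) d n (f : cpa K Q) :
  homogeneous d n f <-> forall v l, coef f v l != 0 -> wdeg d l = n.
Proof.
split=> [Hf v l|Hf p]; last by rewrite -coefE => /Hf.
have [vl|nvl] := boolP (walk v l); last by rewrite coef_nwalk ?eqxx.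
by rewrite coef_walk => /Hf.
Qed.

Section ZeroOne.
Variables (Q : quiver V) (d : Q -> int).
Hypothesis d01 : forall a, d a = 0 \/ d a = 1.
Notation C := [set a | d a == 1].

Lemma deg_ge0 a : 0 <= d a. Proof. by case: (d01 a) => ->. Qed.

Lemma wdeg_ge0 l : 0 <= wdeg d l.
Proof. by apply: sumr_ge0 => a _; apply: deg_ge0. Qed.

Lemma wdeg_le_size l : wdeg d l <= (size l)%:Z.
Proof.
elim: l => [|a l IH]; rewrite /wdeg ?big_nil // big_cons /= -add1n PoszD.
by apply: lerD => //; case: (d01 a) => ->.
Qed.

Lemma wdeg_eq0 l : (wdeg d l == 0) = all (fun a => a \notin C) l.
Proof.
rewrite psumr_eq0 => [|a _]; last exact: deg_ge0.
by apply: eq_all => a; rewrite !inE; case: (d01 a) => ->.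
Qed.

Lemma restr_eq0 (f : cpa K Q) :
  restr C f = 0 <-> forall v l, wdeg d l = 0 -> coef f v l = 0.
Proof.
split=> [Hf v l /eqP|Hf]; last first.
  apply: cpaP => v l _; rewrite coef0 coef_restr; apply/Hf/eqP.
  by rewrite wdeg_eq0; apply/allP => _ /mapP[a _ ->]; apply: (valP a).
rewrite wdeg_eq0 => lC.
have [s ->] : exists s : seq (cut_quiver C), l = map val s.
  elim: l lC => [|a l IH] /=; first by exists [::].
  case/andP=> aC /IH[s ->].
  by exists ((Sub a aC : cut_quiver C) :: s).
by rewrite -coef_restr Hf coef0.
Qed.

(** The derivatives along the arrows of the cut are generators; all terms of a
    derivative along an arrow of degree 0 keep the degree 1 and hence run
    through the cut. *)
Lemma cut_ideal_der_all (W : cpa K Q) : (forall p, W p != 0 -> is_cycle p) ->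
  homogeneous d 1 W -> forall b, cut_ideal W C (cyc_der b W).
Proof.
move=> Wc /homogeneousE W1 b; have [bC|nbC] := boolP (b \in C).
  exact: cut_ideal_der.
apply/cut_ideal_restr0/restr_eq0 => v l l0.
rewrite coef_cyc_der //; case: ifP => // _; apply: big1 => j _.
apply/eqP/negPn/negP => /W1; rewrite /wdeg big_cat big_cons /=.
have -> : d b = 0 by move: nbC; rewrite inE; case: (d01 b) => ->.
rewrite add0r addrC -big_cat cat_take_drop.
by move: l0; rewrite /wdeg => ->.
Qed.

End ZeroOne.

Lemma coef_hom_eq0 (Q Q' : quiver V) (G : {rmorphism cpa K Q -> cpa K Q'}) f w m :
  (forall c, G (cpa_scal c) = cpa_scal c) ->
  (forall p, f p != 0 -> coef (G (basis K p)) w m = 0) -> coef (G f) w m = 0.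
Proof.
move=> Gs Hf; apply: (@cpa_ind _ _ _ (fun g => coef (G g) w m = 0) (size m).+1).
- by rewrite rmorph0 coef0.
- by move=> g h Eg Eh; rewrite rmorphD coefD Eg Eh addr0.
- by move=> p /Hf; rewrite !scale_cpa_scal rmorphM Gs -scale_cpa_scal coefZ => ->; rewrite mulr0.
move=> g h gh Eh; rewrite -(subrK h g) rmorphD coefD Eh addr0.
by apply: (hom_inrad Gs gh).
Qed.

Section GradedIso.
Variables (Q Q' : quiver V) (d : Q -> int) (d' : Q' -> int).
Variables (G : {rmorphism cpa K Q -> cpa K Q'}) (H : {rmorphism cpa K Q' -> cpa K Q}).
Hypothesis Gs : forall c, G (cpa_scal c) = cpa_scal c.
Hypothesis Hs : forall c, H (cpa_scal c) = cpa_scal c.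
Hypothesis GK : cancel G H.
Hypothesis HK : cancel H G.
Hypothesis Gd : forall (n : int) f, homogeneous d n f -> homogeneous d' n (G f).
Hypothesis d01 : forall a, d a = 0 \/ d a = 1.

Definition deg_part n (f : cpa K Q) : cpa K Q :=
  fun p => if wdeg d (pword p) == n then f p else 0.

Lemma coef_deg_part n f v l :
  coef (deg_part n f) v l = if wdeg d l == n then coef f v l else 0.
Proof.
have [vl|nvl] := boolP (walk v l); first by rewrite !coef_walk.
by rewrite !coef_nwalk // if_same.
Qed.

Lemma deg_part_homogeneous n f : homogeneous d n (deg_part n f).
Proof.
apply/homogeneousE => v l; rewrite coef_deg_part.
by case: (wdeg d l =P n) => // _; rewrite eqxx.
Qed.

(** A graded isomorphism respects degrees path by path, because it is continuous
    and paths are homogeneous. *)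
Lemma graded_coef_eq0 f w m :
  (forall p, f p != 0 -> wdeg d (pword p) != wdeg d' m) -> coef (G f) w m = 0.
Proof.
move=> Hf; apply: coef_hom_eq0 => // p /Hf; apply: contra_neq_eq => nz.
have bh : homogeneous d (wdeg d (pword p)) (basis K p).
  apply/homogeneousE => v l; rewrite coef_path xpair_eqE.
  by case: (l =P _) => [->|_] //; rewrite !andbF eqxx.
by have /homogeneousE /(_ _ _ nz) := Gd bh.
Qed.

(** The arrow [y] is the image of its preimage [x]; only the part of [x] of
    degree [d' y] can contribute to the coefficient of [y], and that part is 0
    in negative degree and lies in the square of the radical in degree at
    least 2. *)
Lemma graded_iso_deg01 y : d' y = 0 \/ d' y = 1.
Proof.
pose x := H (arrow_elt K y); pose n := d' y.
have y1 : coef (G x) (src y) [:: y] = 1.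
  by rewrite /x HK coef_path /= !eqxx.
have xn : coef (G (x - deg_part n x)) (src y) [:: y] = 0.
  apply: graded_coef_eq0 => p; rewrite /wdeg big_seq1 -/(wdeg d (pword p)) -/n => nz.
  by apply: contraNneq nz => E; rewrite cpaDE cpaNE /deg_part E eqxx subrr.
have {}xn : coef (G (deg_part n x)) (src y) [:: y] = 1.
  by move: xn; rewrite rmorphB coefB y1 => /eqP; rewrite subr_eq0 eq_sym => /eqP.
have xr : ~ inrad 2 (deg_part n x).
  move=> /(hom_inrad Gs)/(_ (src y) [:: y] isT) E.
  by have := oner_neq0 K; rewrite -xn E eqxx.
rewrite -/n; case: (ltrP n 0) => [n0|n0].
  case: xr => v l _; rewrite coef_deg_part; case: eqP => // E.
  by move: n0; rewrite -E ltNge wdeg_ge0.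
case: (ltrP n 2) => [n2|n2]; last first.
  case: xr => v l ltl; rewrite coef_deg_part; case: eqP => // E.
  move: n2; rewrite -E => /le_trans/(_ (wdeg_le_size d01 l)).
  by rewrite lez_nat leqNgt ltl.
have int01 (i : int) : 0 <= i -> i < 2 -> i = 0 \/ i = 1.
  by case: i => [[|[|?]]|?] // _ _; [left|right].
exact: int01.
Qed.

Notation C := [set a | d a == 1].
Notation C' := [set a | d' a == 1].

Lemma graded_restr f : restr C f = 0 -> restr C' (G f) = 0.
Proof.
move/(restr_eq0 d01) => Hf; apply/(restr_eq0 graded_iso_deg01) => w m m0.
apply: graded_coef_eq0 => p; rewrite m0 -coefE => nz.
by apply: contraNneq nz => p0; rewrite Hf.
Qed.

Lemma graded_restr_inv g : restr C' g = 0 -> restr C (H g) = 0.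
Proof.
move=> g0; set f := H g; have Gf : G f = g by apply: HK.
have f1 : restr C' (G (f - deg_part 0 f)) = 0.
  apply/graded_restr/(restr_eq0 d01) => v l l0.
  by rewrite coefB coef_deg_part l0 eqxx subrr.
have f0 : deg_part 0 f = 0.
  apply: (can_inj GK); rewrite rmorph0; apply: cpaP => v l _; rewrite coef0.
  have [l0|nl0] := eqVneq (wdeg d' l) 0; last first.
    apply/eqP; apply: contraR nl0 => nz; apply/eqP.
    by have /homogeneousE/(_ _ _ nz) := Gd (@deg_part_homogeneous 0 f).
  have {}f1 : restr C' (G (deg_part 0 f)) = 0.
    by move: f1; rewrite rmorphB Gf rmorphB /= g0 sub0r => /eqP; rewrite oppr_eq0 => /eqP.
  by move/(restr_eq0 graded_iso_deg01): f1; apply.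
apply/(restr_eq0 d01) => v l l0.
by have := congr1 (fun u => coef u v l) f0; rewrite /= coef_deg_part l0 eqxx coef0.
Qed.

End GradedIso.
End Degrees.

(** * Splitting off a trivial summand *)

Section FullEmbedding.
Variables (K : comPzRingType) (V : finType) (Q1 Q2 : quiver V).
Variables (t : quiver_pmap Q1 Q2) (s : Q1 -> Q2).
Hypothesis tK : forall x, qpmap t (s x) = Some x.

Lemma cyclic_subst (W : cpa K Q1) : (forall p, W p != 0 -> is_cycle p) ->
  forall p, subst t W p != 0 -> is_cycle p.
Proof.
move=> Wc p; rewrite /subst; case: ifP => [tp|_]; last by rewrite eqxx.
apply: contraR => nc; apply/eqP/cyclic_coef => //.
by rewrite walk_end_pmap // eq_sym.
Qed.

Lemma cyc_der_subst (W : cpa K Q1) x : (forall p, W p != 0 -> is_cycle p) ->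
  cyc_der (s x) (subst t W) = subst t (cyc_der x W).
Proof.
move=> Wc; apply: cpaP => v l _; rewrite coef_subst !coef_cyc_der //; last first.
  exact: cyclic_subst.
have [_ ->] := qpmap_ends (tK x).
have [tl|ntl] := boolP (all (qpmap t) l); last first.
  case: ifP => // _; apply: big1 => j _.
  rewrite coef_subst ifN // all_cat /= tK /=.
  by apply: contra ntl => /andP[dl tl]; rewrite -(cat_take_drop j l) all_cat tl.
case: ifP => // _; rewrite size_pmap_all //; apply: eq_bigr => j _.
have /andP[tt dt] : all (qpmap t) (take j l) && all (qpmap t) (drop j l).
  by rewrite -all_cat cat_take_drop.
have lE : pmap (qpmap t) l = pmap (qpmap t) (take j l) ++ pmap (qpmap t) (drop j l).
  by rewrite -pmap_cat cat_take_drop.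
have st : size (pmap (qpmap t) (take j l)) = j.
  by rewrite size_pmap_all // size_takel // -ltnS.
rewrite coef_subst all_cat /= tK tt dt /= pmap_cat /= tK /= lE.
by rewrite take_size_cat // drop_size_cat // walk_end_pmap.
Qed.

Lemma cyc_der_subst0 (W : cpa K Q1) y : (forall p, W p != 0 -> is_cycle p) ->
  qpmap t y = None -> cyc_der y (subst t W) = 0.
Proof.
move=> Wc ty; apply/funext => p; rewrite cyc_derE; last exact: cyclic_subst.
case: ifP => // _; apply: big1 => j _.
by rewrite coef_subst all_cat /= ty andbF.
Qed.

End FullEmbedding.

(** Linear homomorphisms preserve the radical, and the radical of the path
    algebra of a quiver without arrows is zero; so the isomorphism of triviality
    kills every arrow. *)
Lemma trivial_arrow (K : fieldType) (V : finType) (T : graded_QP K V) :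
  is_trivial T -> forall a, closed_ideal
    (fun f => exists b : gquiver T, f = cyc_der b (gpot T)) (arrow_elt K a).
Proof.
move=> [_ [F [Fs Fb]]] a.
set I := closed_ideal _.
pose G : {rmorphism cpa K (gquiver T) -> _} := F \o @quot_pi _ I.
have Gs c : G (cpa_scal c) = cpa_scal c by rewrite -[RHS]Fs.
have G0 : G (arrow_elt K a) = 0.
  apply: cpaP => v [|[]//] _; rewrite coef0; apply: (hom_inrad (n := 1) Gs) => //.
  by apply/inrad1P => w; rewrite coef_path xpair_eqE !andbF.
have /quot_piP : quot_pi I (arrow_elt K a) = quot_pi I 0.
  by apply: (bij_inj Fb); rewrite [LHS]G0; apply/esym/(rmorph0 G).
by rewrite subr0.
Qed.

Section TrivialSummand.
Variables (K : fieldType) (V : finType) (R T : graded_QP K V).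
Notation Y := (direct_sum R T).
Notation QY := (sum_quiver (gquiver R) (gquiver T)).
Notation CR := (degree_one_arrows R).
Notation CY := (degree_one_arrows Y).

Lemma get_inl_ends (y : QY) (x : gquiver R) :
  get_inl y = Some x -> src y = src x /\ tgt y = tgt x.
Proof. by case: y => //= a [<-]. Qed.

Lemma get_inr_ends (y : QY) (x : gquiver T) :
  get_inr y = Some x -> src y = src x /\ tgt y = tgt x.
Proof. by case: y => //= a [<-]. Qed.

Lemma inl_ends (y : gquiver R) (x : QY) :
  Some (inl y : QY) = Some x -> src y = src x /\ tgt y = tgt x.
Proof. by case=> <-. Qed.

Definition inl_pmap := QuiverPmap get_inl_ends.
Definition inr_pmap := QuiverPmap get_inr_ends.
Definition first_pmap := QuiverPmap inl_ends.

Lemma coef_first (f : cpa K QY) v l :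
  coef (subst first_pmap f) v l = coef f v (map inl l).
Proof.
rewrite coef_subst.
have -> : all (qpmap first_pmap) l by apply/allP.
by congr coef; elim: l => //= a l ->.
Qed.

Lemma first_inlK : cancel (subst (K := K) inl_pmap) (subst first_pmap).
Proof.
move=> f; apply: cpaP => v l vl; rewrite coef_first coef_subst.
have -> : all (qpmap inl_pmap) (map inl l) by apply/allP => _ /mapP[x _ ->].
by congr coef; elim: l {vl} => //= a l ->.
Qed.

Hypothesis Rg : is_graded_QP R.
Hypothesis Tg : is_graded_QP T.
Hypothesis Ttriv : is_trivial T.
Hypothesis d01 : forall a, gdeg Y a = 0 \/ gdeg Y a = 1.

Let Rcyc p : gpot R p != 0 -> is_cycle p. Proof. by case/(proj1 Rg). Qed.
Let Tcyc p : gpot T p != 0 -> is_cycle p. Proof. by case/(proj1 Tg). Qed.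

Lemma gpot_sum : gpot Y = subst inl_pmap (gpot R) + subst inr_pmap (gpot T).
Proof. by []. Qed.

Lemma sum_cyclic p : gpot Y p != 0 -> is_cycle p.
Proof.
rewrite gpot_sum cpaDE; apply: contraR => nc.
rewrite (_ : subst inl_pmap _ _ = 0) ?add0r; last first.
  by apply/eqP; apply: contraR nc; apply: cyclic_subst Rcyc _.
by apply: contraR nc; apply: cyclic_subst Tcyc _.
Qed.

Lemma sum_homogeneous : homogeneous (gdeg Y) 1 (gpot Y).
Proof.
have /homogeneousE R1 := proj2 Rg; have /homogeneousE T1 := proj2 Tg.
apply/homogeneousE => v l; rewrite gpot_sum coefD !coef_subst.
have dE1 : all (qpmap inl_pmap) l -> wdeg (gdeg Y) l = wdeg (gdeg R) (pmap (qpmap inl_pmap) l).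
  by rewrite /wdeg; elim: l => [|[a|a] l IH] //=; rewrite ?big_nil // !big_cons => /IH ->.
have dE2 : all (qpmap inr_pmap) l -> wdeg (gdeg Y) l = wdeg (gdeg T) (pmap (qpmap inr_pmap) l).
  by rewrite /wdeg; elim: l {dE1} => [|[a|a] l IH] //=; rewrite ?big_nil // !big_cons => /IH ->.
case: ifP => [l1|_]; last first.
  by rewrite add0r; case: ifP => [l2|]; rewrite ?eqxx // dE2 //; apply: T1.
case: ifP => [l2|_]; last by rewrite addr0 dE1 //; apply: R1.
have [/T1|] := boolP (coef (gpot T) v (pmap (qpmap inr_pmap) l) != 0); first by rewrite dE2.
by rewrite negbK => /eqP ->; rewrite addr0 dE1 //; apply: R1.
Qed.

Lemma cyc_der_inl a : cyc_der (inl a : QY) (gpot Y) = subst inl_pmap (cyc_der a (gpot R)).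
Proof.
rewrite gpot_sum linearD /= (cyc_der_subst0 (y := (inl a : QY)) Tcyc) // addr0.
by apply: (@cyc_der_subst _ _ _ _ inl_pmap inl).
Qed.

Lemma cyc_der_inr b : cyc_der (inr b : QY) (gpot Y) = subst inr_pmap (cyc_der b (gpot T)).
Proof.
rewrite gpot_sum linearD /= (cyc_der_subst0 (y := (inr b : QY)) Rcyc) // add0r.
by apply: (@cyc_der_subst _ _ _ _ inr_pmap inr).
Qed.

Lemma sum_der_all y : cut_ideal (gpot Y) CY (cyc_der y (gpot Y)).
Proof. exact: (cut_ideal_der_all d01 sum_cyclic sum_homogeneous). Qed.

Lemma subst_arrow_inr b :
  subst inr_pmap (arrow_elt K b) = arrow_elt K (inr b : QY).
Proof.
apply: cpaP => v l vl; rewrite coef_subst !coef_path vl !xpair_eqE.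
case: ifP => [tl|ntl]; last first.
  by case: eqP => //= _; case: eqP => // lE; rewrite lE in ntl.
rewrite walk_pmap // vl; congr (nat_of_bool (_ && (_ && _)))%:R.
by case: l tl {vl} => [|[a|a] [|[c|c] l]].
Qed.

Lemma trivial_arrow_mem b : cut_ideal (gpot Y) CY (arrow_elt K (inr b : QY)).
Proof.
rewrite -subst_arrow_inr; move: (arrow_elt K b) (trivial_arrow Ttriv b).
pose J := preim_ideal (subst inr_pmap) (cut_ideal (gpot Y) CY).
apply: (closed_ideal_min (J := J)) => [|_ [c ->]].
  by apply: rad_closed_preim (@cut_ideal_closed _ _ _ _ _); apply: inrad_subst.
by rewrite /J preim_idealE; have := sum_der_all (inr c : QY); rewrite cyc_der_inr.
Qed.

Let dR01 a : gdeg R a = 0 \/ gdeg R a = 1. Proof. exact: (d01 (inl a)). Qed.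

Lemma restr_first (f : cpa K QY) : restr CY f = 0 -> restr CR (subst first_pmap f) = 0.
Proof.
move/(restr_eq0 d01) => Hf; apply/(restr_eq0 dR01) => v l l0.
by rewrite coef_first Hf // -l0 /wdeg big_map.
Qed.

Lemma restr_inl (f : cpa K (gquiver R)) : restr CR f = 0 -> restr CY (subst inl_pmap f) = 0.
Proof.
move/(restr_eq0 dR01) => Hf; apply/(restr_eq0 d01) => v l l0.
rewrite coef_subst; case: ifP => // tl; apply: Hf; rewrite -l0 /wdeg.
by elim: l tl {l0} => [|[a|a] l IH] //=; rewrite ?big_nil // !big_cons => /IH ->.
Qed.

(** The derivative along an arrow of the trivial summand is a combination of
    arrows of that summand. *)
Lemma first_der_inr b :
  subst first_pmap (cyc_der (inr b : QY) (gpot Y)) = 0 :> cpa K (gquiver R).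
Proof.
apply: cpaP => v l _; rewrite coef0 cyc_der_inr coef_first coef_subst.
case: l => [|a l] //=; apply: (inrad_cyc_der (n := 1)) => // w m ltm.
have [wm|nwm] := boolP (walk w m); last by rewrite coef_nwalk.
rewrite coef_walk; apply/eqP; apply: contraTT ltm => /(proj1 Ttriv)[_].
by rewrite /plen /pword /= => ->.
Qed.

(** All arrows of the trivial summand lie in the ideal, so nothing is lost by
    setting them to zero. *)
Lemma cut_ideal_sum (f : cpa K QY) :
  cut_ideal (gpot Y) CY f <-> cut_ideal (gpot R) CR (subst first_pmap f).
Proof.
split.
  pose J := preim_ideal (subst first_pmap) (cut_ideal (gpot R) CR).
  apply: (@cut_ideal_min _ _ _ _ CY J).
  - by apply: rad_closed_preim (@cut_ideal_closed _ _ _ _ _); apply: inrad_subst.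
  - by move=> g /restr_first; apply: cut_ideal_restr0.
  move=> c cC; rewrite /J preim_idealE.
  change (cut_ideal (gpot R) CR (subst first_pmap (cyc_der c (gpot Y)))).
  case: c cC => [a|b] aC.
    have -> : subst first_pmap (cyc_der (inl a : QY) (gpot Y)) = cyc_der a (gpot R).
      by rewrite cyc_der_inl first_inlK.
    by apply: cut_ideal_der; move: aC; rewrite !inE.
  have -> : subst first_pmap (cyc_der (inr b : QY) (gpot Y)) = 0.
    exact: first_der_inr.
  exact: ideal0.
move=> If; rewrite -[f](subrK (subst inl_pmap (subst first_pmap f))).
apply: idealD; last first.
  pose J := preim_ideal (subst inl_pmap) (cut_ideal (gpot Y) CY).
  move: (subst first_pmap f) If; apply: (@cut_ideal_min _ _ _ _ CR J).
  - by apply: rad_closed_preim (@cut_ideal_closed _ _ _ _ _); apply: inrad_subst.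
  - by move=> g /restr_inl; apply: cut_ideal_restr0.
  move=> c cC; rewrite /J preim_idealE.
  by have := sum_der_all (inl c : QY); rewrite cyc_der_inl.
apply: (@ideal_of_arrows _ _ QY (cut_ideal (gpot Y) CY)
          (fun y => if y is inr _ then true else false)).
- exact: cut_ideal_closed.
- by move=> [//|b] _; apply: trivial_arrow_mem.
move=> v l nl; have [tl lE] : all (qpmap inl_pmap) l /\
    map inl (pmap (qpmap inl_pmap) l) = l.
  by elim: l nl => [|[a|a] l IH] //= /IH [-> ->].
by rewrite coefB coef_subst tl coef_first lE subrr.
Qed.

End TrivialSummand.

(** The right-equivalence identifies the ideals by the chain rule.  This needs
    all the derivatives on both sides to lie in the ideal of the cut, hence the
    degrees 0 and 1, which the right-equivalence transports. *)
Theorem reduced_part_iso (K : fieldType) (V : finType) (X R : graded_QP K V) :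
  (forall a, gdeg X a = 0 \/ gdeg X a = 1) ->
  (forall p, gpot X p != 0 -> is_cycle p) -> homogeneous (gdeg X) 1 (gpot X) ->
  is_reduced_part X R ->
  alg_isomorphic (cut_jacobian (gpot X) (degree_one_arrows X))
    (cut_jacobian (gpot R) (degree_one_arrows R)).
Proof.
move=> d01 Xc X1 [T [[Rg _] [Tg Ttriv] [G [[Gsc [H GK HK]] Gv Gd GW]]]].
have Gs c : G (cpa_scal c) = cpa_scal c by rewrite /cpa_scal Gsc rmorph1.
have Hz : zmod_morphism H by move=> u v; apply: (can_inj GK); rewrite HK rmorphB !HK.
have Hm : monoid_morphism H.
  by split=> [|u v]; apply: (can_inj GK); rewrite HK ?rmorph1 // rmorphM !HK.
pose Ha := GRing.isZmodMorphism.Build _ _ H Hz.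
pose Hb := GRing.isMonoidMorphism.Build _ _ H Hm.
pose Hr : {rmorphism cpa K (gquiver (direct_sum R T)) -> cpa K (gquiver X)} :=
  HB.pack H Ha Hb.
have Hs c : Hr (cpa_scal c) = cpa_scal c by rewrite -Gs [LHS]GK.
have Hv v : Hr (vertex_elt K v) = vertex_elt K v by rewrite -Gv [LHS]GK.
have dY01 := graded_iso_deg01 (H := Hr) Gs HK Gd d01.
have Yall := sum_der_all Rg Tg dY01.
have der b : cyc_der b (G (gpot X)) = cyc_der b (gpot (direct_sum R T)).
  exact: cyc_equiv_der.
have GWc : forall p, G (gpot X) p != 0 -> is_cycle p by apply: cyclic_hom.
pose F : {rmorphism _ -> _} := subst (K := K) (first_pmap R T) \o G.
apply: (@cut_jacobian_iso _ _ _ _ _ _ _ _ F) => [c|g|f].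
- by rewrite /= Gs /cpa_scal linearZ /= rmorph1.
- exists (H (subst (inl_pmap R T) (ext (degree_one_arrows R) g))).
  by rewrite /= HK first_inlK ext_restrK.
have XY : cut_ideal (gpot X) (degree_one_arrows X) f <->
    cut_ideal (gpot (direct_sum R T)) (degree_one_arrows (direct_sum R T)) (G f).
  split.
    apply: (@cut_ideal_hom _ _ _ _ G Hr Gs Hs Hv HK _ _ _ _ (G (gpot X))) => //.
    - exact: (graded_restr (H := Hr) Gs HK Gd d01).
    - by move=> c; rewrite [Hr _]GK.
    - by move=> b; rewrite der; apply: Yall.
  move=> If; rewrite -[f]GK.
  apply: (@cut_ideal_hom _ _ _ _ Hr G Hs Gs Gv GK _ _ _ _ (gpot X) _ _ _ _ _ If) => //.
  - exact: (graded_restr_inv (H := Hr) Gs GK HK Gd d01).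
  - by move=> b; apply: (cut_ideal_der_all d01 Xc X1).
rewrite XY; exact: (cut_ideal_sum Rg Tg Ttriv dY01).
Qed.

(** * Projective modules and a vanishing theorem in global dimension two *)

Lemma big_supp_eq (T : nmodType) (X : eqType) (s s' : seq X) (F : X -> T) :
  uniq s -> uniq s' -> {subset s <= s'} -> (forall x, x \notin s -> F x = 0) ->
  \sum_(x <- s) F x = \sum_(x <- s') F x.
Proof.
move=> us us' ss' F0; rewrite [RHS](bigID (mem s)) /= [X in _ + X]big1 ?addr0 //.
rewrite -[RHS]big_filter; apply/perm_big/uniq_perm => //; first exact: filter_uniq.
by move=> x; rewrite mem_filter; case xs: (x \in s) => //=; rewrite ss'.
Qed.

(** ** Free modules *)

Section FreeModule.
Variables (A : pzRingType) (X : choiceType).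

Definition fin_supp : (X -> A^o) -> bool :=
  fun f => `[< exists2 s : seq X, uniq s & forall x, x \notin s -> f x = 0 >].

Fact fin_supp_closed : subsemimod_closed fin_supp.
Proof.
split; first split.
- by apply/asboolP; exists [::].
- move=> f g /asboolP[s us fs] /asboolP[s' us' gs]; apply/asboolP.
  exists (undup (s ++ s')); first exact: undup_uniq.
  move=> x; rewrite mem_undup mem_cat negb_or => /andP[xs xs'].
  have -> : (f + g) x = f x + g x by [].
  by rewrite fs // gs // addr0.
- move=> a f /asboolP[s us fs]; apply/asboolP; exists s => // x xs.
  have -> : (a *: f) x = a *: f x by [].
  by rewrite fs // scaler0.
Qed.

Definition free_mod : Type := {f : X -> A^o | fin_supp f}.
HB.instance Definition _ := [isSub of free_mod for @sval _ _].
HB.instance Definition _ := [Choice of free_mod by <:].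
HB.instance Definition _ := GRing.SubChoice_isSubLmodule.Build
  A (X -> A^o) fin_supp free_mod fin_supp_closed.

Lemma free_modP (f : free_mod) :
  exists2 s : seq X, uniq s & forall x, x \notin s -> val f x = 0.
Proof. exact: (asboolP _ (valP f)). Qed.

End FreeModule.

Section DualBasis.
Variables (A : pzRingType) (Q : lmodType A).

Definition free_supp (f : free_mod A Q) : seq Q :=
  projT1 (cid2 (free_modP f)).

Lemma free_supp_uniq f : uniq (free_supp f).
Proof. by rewrite /free_supp; case: cid2. Qed.

Lemma free_supp0 f x : x \notin free_supp f -> val f x = 0.
Proof. by rewrite /free_supp; case: cid2 => s us fs; apply: fs. Qed.

Definition free_ev (f : free_mod A Q) : Q := \sum_(x <- free_supp f) (val f x : A) *: x.

Lemma free_evE f s : uniq s -> {subset free_supp f <= s} ->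
  free_ev f = \sum_(x <- s) (val f x : A) *: x.
Proof.
move=> us fs; apply: big_supp_eq => //; first exact: free_supp_uniq.
by move=> x /free_supp0 ->; rewrite scale0r.
Qed.

Lemma free_ev_linear : linear free_ev.
Proof.
move=> a f g; pose s := undup (free_supp (a *: f + g) ++ free_supp f ++ free_supp g).
have us : uniq s by apply: undup_uniq.
rewrite !(@free_evE _ s) //; try by move=> x xs; rewrite mem_undup !mem_cat xs ?orbT.
rewrite scaler_sumr -big_split; apply: eq_bigr => x _ /=.
by rewrite [X in X *: x = _](_ : _ = a * val f x + val g x) // scalerDl scalerA.
Qed.

HB.instance Definition _ :=
  GRing.isLinear.Build A (free_mod A Q) Q *:%R free_ev free_ev_linear.

Lemma free_ev_surj y : exists f, free_ev f = y.
Proof.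
pose d : Q -> A^o := fun x => if x == y then 1 else 0.
have dP : fin_supp d.
  by apply/asboolP; exists [:: y] => // x; rewrite inE /d => /negbTE ->.
exists (exist _ d dP); rewrite (@free_evE _ (undup (y :: free_supp (exist _ d dP)))).
- rewrite (bigD1_seq y) ?undup_uniq ?mem_undup ?inE ?eqxx //= big1 => [|x nxy].
    by rewrite addr0 /d eqxx scale1r.
  by rewrite /d (negbTE nxy) scale0r.
- exact: undup_uniq.
- by move=> x xs; rewrite mem_undup inE xs orbT.
Qed.

(** The dual basis lemma, for the generating family of all elements of [Q].  The
    finite support [s] is common to a finite family of elements. *)
Lemma dual_basis : projective Q ->
  exists c : Q -> Q -> A,
    [/\ forall x, c 0 x = 0, forall x q r, c (q + r) x = c q x + c r x,
      forall x a q, c (a *: q) x = a * c q x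
    & forall (I : finType) (q : I -> Q), exists s : seq Q,
       forall i, q i = \sum_(x <- s) c (q i) x *: x].
Proof.
move=> /(_ _ _ (free_ev : {linear free_mod A Q -> Q}) idfun free_ev_surj)[h hK].
exists (fun q x => val (h q) x); split=> [x|x q r|x a q|I q].
- by rewrite linear0.
- by rewrite linearD.
- by rewrite linearZ.
exists (undup (flatten [seq free_supp (h (q i)) | i <- enum I])) => i.
rewrite -[LHS](hK (q i)); apply: free_evE; first exact: undup_uniq.
move=> x xs; rewrite mem_undup; apply/flattenP.
by exists (free_supp (h (q i))) => //; apply: map_f; rewrite mem_enum.
Qed.

End DualBasis.

(** ** The top of the algebra as a module *)

Section QuotientModule.
Variables (A : pzRingType) (J : ideal A).

Definition quot_mod : Type := quot_ring J.
HB.instance Definition _ := GRing.Zmodule.on quot_mod.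
Definition quot_mod_scale (a : A) (u : quot_mod) : quot_mod :=
  (quot_pi J a * (u : quot_ring J)).

Fact quot_mod_scaleA a b u :
  quot_mod_scale a (quot_mod_scale b u) = quot_mod_scale (a * b) u.
Proof. by rewrite /quot_mod_scale rmorphM mulrA. Qed.
Fact quot_mod_scale1 : left_id 1 quot_mod_scale.
Proof. by move=> u; rewrite /quot_mod_scale rmorph1 mul1r. Qed.
Fact quot_mod_scaleDr : right_distributive quot_mod_scale +%R.
Proof. by move=> a u v; rewrite /quot_mod_scale; apply: mulrDr. Qed.
Fact quot_mod_scaleDl u : {morph quot_mod_scale^~ u : a b / a + b}.
Proof. by move=> a b; rewrite /quot_mod_scale rmorphD; apply: mulrDl. Qed.
HB.instance Definition _ := GRing.Zmodule_isLmodule.Build A quot_mod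
  quot_mod_scaleA quot_mod_scale1 quot_mod_scaleDr quot_mod_scaleDl.

Definition quot_mod_pi (a : A^o) : quot_mod := quot_pi J a.
Fact quot_mod_pi_linear : linear quot_mod_pi.
Proof. by move=> a x y; rewrite /quot_mod_pi rmorphD [in LHS]rmorphM. Qed.
HB.instance Definition _ :=
  GRing.isLinear.Build A A^o quot_mod *:%R quot_mod_pi quot_mod_pi_linear.

End QuotientModule.

(** The matrices [rho] and [delta] stand for the beginning of a projective
    resolution of a simple right module over [A], exact in the middle by
    [exact1], with [J] the radical; the idempotents [eta a] and [sigma b] cut
    out its projective terms. *)
Section Zigzag.
Variables (A : pzRingType) (J : ideal A) (O B : finType).
Variables (rho eta : O -> A) (delta : B -> O -> A) (sigma : B -> A).
Hypothesis rho_delta : forall b, \sum_a rho a * delta b a = 0.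
Hypothesis eta_delta : forall b a, eta a * delta b a = delta b a.
Hypothesis delta_sigma : forall b a, delta b a * sigma b = delta b a.
Hypothesis sigma_idem : forall b, sigma b * sigma b = sigma b.
Hypothesis exact1 : forall y : O -> A, \sum_a rho a * y a = 0 ->
  exists z : B -> A, forall a, eta a * y a = \sum_b delta b a * z b.

Definition delta_ker (z : B -> A) : Prop := forall a, \sum_b delta b a * z b = 0.

Hypothesis minimal : forall z, delta_ker z -> forall b, J (sigma b * z b).
Hypothesis gl2 : gl_dim_le A 2.

Lemma exact1_projective (Q : lmodType A) (y : O -> Q) : projective Q ->
  \sum_a rho a *: y a = 0 ->
  exists z : B -> Q, forall a, eta a *: y a = \sum_b delta b a *: z b.
Proof.
move=> /dual_basis[c [c0 cD cZ cS]] y0; have [s yE] := cS _ y.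
have cy x : \sum_a rho a * c (y a) x = 0.
  rewrite -[RHS](c0 x) -y0; elim/big_rec2: _ => [|a u v _ ->]; first by rewrite c0.
  by rewrite cD cZ.
have /choice[z zE] x := exact1 (cy x).
exists (fun b => \sum_(x <- s) z x b *: x) => a.
rewrite {1}yE scaler_sumr; under eq_bigr => x _ do rewrite scalerA zE scaler_suml.
rewrite exchange_big; apply: eq_bigr => b _; rewrite scaler_sumr.
by apply: eq_bigr => x _; rewrite scalerA.
Qed.

Lemma exact2_projective (Q : lmodType A) (y : B -> Q) : projective Q ->
  (forall a, \sum_b delta b a *: y b = 0) ->
  exists (c : Q -> B -> A) (s : seq Q), (forall x, delta_ker (c x)) /\
    forall b, y b = \sum_(x <- s) c x b *: x.
Proof.
move=> /dual_basis[c [c0 cD cZ cS]] y0; have [s yE] := cS _ y.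
exists (fun x b => c (y b) x), s; split=> // x a.
rewrite -[RHS](c0 x) -(y0 a); elim/big_rec2: _ => [|b u v _ ->]; first by rewrite c0.
by rewrite cD cZ.
Qed.

(** The third Tor group of the top of [A] vanishes; chasing the double complex
    formed by a projective resolution of the left module [A / J] and the
    complex of right modules given by [rho] and [delta] shows that every
    element of the kernel of [delta] is a combination of elements of this
    kernel with coefficients in [J] on the right. *)
Lemma zigzag z b0 (P : A -> Prop) : delta_ker z ->
  P 0 -> (forall x y, P x -> P y -> P (x + y)) ->
  (forall w r, delta_ker w -> J r -> P (sigma b0 * w b0 * r)) ->
  P (sigma b0 * z b0).
Proof.
move=> zK P0 PD Pr; pose z' b := sigma b * z b.
have z'K : delta_ker z'.
  by move=> a; rewrite -[RHS](zK a); apply: eq_bigr => b _; rewrite mulrA delta_sigma.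
have [L1 [Q0 [i0 [p0 [projQ0 [i0inj p0surj p0ker] [L2 [Q1 [i1 [p1 [projQ1 ex1 projL2]]]]]]]]]] :=
  gl2 (quot_mod J : lmodType A).
case: ex1 => i1inj p1surj p1ker.
have pi_surj : forall u : quot_mod J, exists x : A^o, quot_mod_pi J x = u.
  by move=> u; exists (quot_repr (u : quot_ring J)); apply: quot_reprK.
have [theta thetaE] := projQ0 _ _ (quot_mod_pi J : {linear A^o -> quot_mod J}) p0 pi_surj.
have thetaJ q : p0 q = 0 -> J (theta q : A).
  move=> q0; have := thetaE q; rewrite q0 /= /quot_mod_pi.
  by rewrite -[0 in RHS](rmorph0 (quot_pi J)) => /quot_piP; rewrite subr0.
have [q0 q0E] := p0surj (quot_mod_pi J 1).
have /choice[w wE] b : exists q1 : Q1, i0 (p1 q1) = z' b *: q0.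
  have /p0ker[l lE] : p0 (z' b *: q0) = 0.
    rewrite linearZ /= q0E -linearZ /= /quot_mod_pi -(rmorph0 (quot_pi J)).
    by apply/quot_piP; rewrite subr0; apply/idealMr/minimal.
  by have [q1 q1E] := p1surj l; exists q1; rewrite q1E.
have /choice[l lE] a : exists l : L2, \sum_b delta b a *: w b = i1 l.
  apply/p1ker/i0inj; rewrite [RHS]linear0 !linear_sum.
  transitivity ((\sum_b delta b a * z' b) *: q0); last by rewrite z'K scale0r.
  by rewrite scaler_suml; apply: eq_bigr => b _; rewrite !linearZ /= wE scalerA.
have etal a : eta a *: l a = l a.
  apply: i1inj; rewrite linearZ /= -lE scaler_sumr.
  by apply: eq_bigr => b _; rewrite scalerA eta_delta.
have rhol : \sum_a rho a *: l a = 0.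
  apply: i1inj; rewrite linear0 linear_sum.
  under eq_bigr => a _ do rewrite linearZ /= -lE scaler_sumr.
  rewrite exchange_big big1 // => b _.
  under eq_bigr => a _ do rewrite scalerA.
  by rewrite -scaler_suml rho_delta scale0r.
have [u uE] := exact1_projective projL2 rhol.
have [c [s [cK cE]]] : exists (c : Q1 -> B -> A) (s : seq Q1),
    (forall x, delta_ker (c x)) /\
    forall b, w b - i1 (u b) = \sum_(x <- s) c x b *: x.
  apply: exact2_projective => // a.
  under eq_bigr => b _ do rewrite scalerBr.
  rewrite sumrB lE -etal uE linear_sum -sumrB big1 // => b _.
  by rewrite linearZ subrr.
have zE b : z' b *: q0 = \sum_(x <- s) c x b *: i0 (p1 x).
  rewrite -wE -[w b](subrK (i1 (u b))) linearD /= [X in _ + X](_ : _ = 0); last first.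
    by apply/p1ker; exists (u b).
  rewrite addr0 cE !linear_sum; apply: eq_bigr => x _.
  by rewrite !linearZ.
have z'E : sigma b0 * z b0 =
    sigma b0 * z' b0 * (1 - (theta q0 : A)) +
    \sum_(x <- s) sigma b0 * c x b0 * (theta (i0 (p1 x)) : A).
  have -> : \sum_(x <- s) sigma b0 * c x b0 * (theta (i0 (p1 x)) : A) =
      sigma b0 * (theta (z' b0 *: q0) : A).
    rewrite zE linear_sum big_distrr; apply: eq_bigr => x _.
    by rewrite linearZ /= -mulrA.
  have -> : (theta (z' b0 *: q0) : A) = z' b0 * (theta q0 : A) by rewrite linearZ.
  by rewrite mulrBr mulr1 [sigma b0 * (_ * theta q0)]mulrA subrK /z' mulrA sigma_idem.
rewrite z'E; apply: (PD).
  apply: Pr => //; have /quot_piP : quot_pi J 1 = quot_pi J (theta q0).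
    by rewrite -[RHS]/(quot_mod_pi J (theta q0)) thetaE q0E.
  by [].
elim: s {cE zE z'E} => [|x s IH]; first by rewrite big_nil.
rewrite big_cons; apply: (PD) => //; apply: (Pr) => //; apply: thetaJ.
by apply/p0ker; exists (p1 x).
Qed.

(** Iterating [zigzag], the entries of an element of the kernel lie in all the
    powers of the radical. *)
Lemma delta_ker_filtered (Jn : nat -> A -> Prop) :
  (forall x, Jn 0 x) -> (forall n, Jn n 0) ->
  (forall n x y, Jn n x -> Jn n y -> Jn n (x + y)) ->
  (forall n x y, Jn n x -> J y -> Jn n.+1 (x * y)) ->
  forall n z b, delta_ker z -> Jn n (sigma b * z b).
Proof.
move=> Ja J0 JD JM; elim=> [|n IH] z b zK; first exact: Ja.
apply: (@zigzag z b (Jn n.+1)) => // [x y|w r wK Jr]; first exact: JD.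
by apply: JM => //; apply: IH.
Qed.

End Zigzag.

(** * A presentation of the tilting module *)

Section LeftIdeals.
Variables (A : pzRingType) (e : A).

Definition lelt (x : A) : left_ideal e :=
  exist (left_ideal_pred e) (x * e) (introT (asboolP _) (ex_intro _ x erefl)).

Lemma lelt_scale (a x : A) : a *: lelt x = lelt (a * x).
Proof. by apply: val_inj; rewrite /= -mulrA. Qed.

Lemma lelt_val (x : left_ideal e) : e * e = e -> lelt (val x) = x.
Proof.
move=> ee; apply: val_inj => /=.
by have /asboolP[y ->] := valP x; rewrite -mulrA ee.
Qed.

End LeftIdeals.

(** The model is an algebra with a source: [kap] is the idempotent of the source,
    [eps] is its complement, and [rho a] are the arrows that start at the
    source, [eta a] being the idempotent of the end of the arrow.  The sets
    [Jn n] are the powers of the radical. *)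
Section Presentation.
Variables (A : pzRingType) (kap eps : A) (O : finType) (rho eta : O -> A).
Variables (Jn : nat -> A -> Prop) (N : nat).
Hypothesis kapK : kap * kap = kap.
Hypothesis epsK : eps * eps = eps.
Hypothesis etaK : forall a, eta a * eta a = eta a.
Hypothesis eta_eps : forall a, eta a * eps = eta a.
Hypothesis kap_rho : forall a, kap * rho a = rho a.
Hypothesis rho_eta : forall a, rho a * eta a = rho a.
Hypothesis rho_gen : forall y, exists z : O -> A,
  kap * y * eps = \sum_a rho a * z a.
Hypothesis Jn_all : forall x, Jn 0 x.
Hypothesis Jn0 : forall n, Jn n 0.
Hypothesis JnD : forall n x y, Jn n x -> Jn n y -> Jn n (x + y).
Hypothesis JnMl : forall n a x, Jn n x -> Jn n (a * x).
Hypothesis JnM1 : forall n x y, Jn n x -> Jn 1 y -> Jn n.+1 (x * y).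
Hypothesis JnN : forall x, Jn N x -> x = 0.
Hypothesis rho_rad : forall y : O -> A,
  \sum_a rho a * y a = 0 -> forall a, Jn 1 (eta a * y a).

Local Notation P := (left_ideal kap).
Local Notation P' := (left_ideal eps).

Definition rows_pred (w : {ffun O -> A^o}) : bool :=
  [forall a, (w a : A) * eta a == w a].

Fact rows_closed : subsemimod_closed rows_pred.
Proof.
split; first split.
- by apply/forallP => a; rewrite ffunE mul0r.
- move=> x y /forallP xP /forallP yP; apply/forallP => a.
  by rewrite ffunE mulrDl (eqP (xP a)) (eqP (yP a)).
- move=> c x /forallP xP; apply/forallP => a.
  by rewrite ffunE -[_ * _]mulrA (eqP (xP a)).
Qed.

(** The direct sum over [a] of the left ideals generated by [eta a] *)
Definition rows : Type := {w : {ffun O -> A^o} | rows_pred w}.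
HB.instance Definition _ := [isSub of rows for @sval _ _].
HB.instance Definition _ := [Choice of rows by <:].
HB.instance Definition _ := GRing.SubChoice_isSubLmodule.Build
  A {ffun O -> A^o} rows_pred rows rows_closed.

Definition ent (w : rows) (a : O) : A := val w a.

Fact mk_rowsP (x : O -> A) : rows_pred [ffun a => x a * eta a : A^o].
Proof. by apply/forallP => a; rewrite ffunE -[X in X == _]mulrA etaK. Qed.
Definition mk_rows (x : O -> A) : rows := exist rows_pred _ (mk_rowsP x).

Lemma ent_mk x a : ent (mk_rows x) a = x a * eta a.
Proof. by rewrite /ent /= ffunE. Qed.
Lemma ent_eta w a : ent w a * eta a = ent w a.
Proof. by have /forallP/(_ a)/eqP := valP w. Qed.
Lemma rows_eq w w' : ent w =1 ent w' -> w = w'.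
Proof. by move=> E; apply/val_inj/ffunP. Qed.
Lemma entD w w' a : ent (w + w') a = ent w a + ent w' a.
Proof. by rewrite /ent /= ffunE. Qed.
Lemma entZ c w a : ent (c *: w) a = c * ent w a.
Proof. by rewrite /ent /= ffunE. Qed.
Lemma ent0 a : ent 0 a = 0.
Proof. by rewrite /ent /= ffunE. Qed.
Lemma entB w w' a : ent (w - w') a = ent w a - ent w' a.
Proof. by rewrite -scaleN1r entD entZ mulN1r. Qed.
Lemma ent_sum (I : Type) (r : seq I) (F : I -> rows) a :
  ent (\sum_(i <- r) F i) a = \sum_(i <- r) ent (F i) a.
Proof. by elim/big_rec2: _ => [|i u v _ <-]; rewrite ?ent0 ?entD. Qed.

Definition unit_row (a : O) : rows := mk_rows (fun b => (b == a)%:R).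

Lemma rows_expand w : w = \sum_a ent w a *: unit_row a.
Proof.
apply: rows_eq => a; rewrite ent_sum (bigD1 a) //= big1 => [|b nba].
  by rewrite entZ ent_mk eqxx mul1r ent_eta addr0.
by rewrite entZ ent_mk eq_sym (negbTE nba) mul0r mulr0.
Qed.

(** The approximation given by all the arrows that start at the source *)
Definition emb_fun (p : P) : rows := mk_rows (fun a => val p * rho a).
Fact emb_linear : linear emb_fun.
Proof.
move=> c p q; apply: rows_eq => a; rewrite entD entZ !ent_mk /=.
by rewrite [_ *: _](_ : _ = c * (val p : A)) // !mulrDl !mulrA.
Qed.
HB.instance Definition _ := GRing.isLinear.Build A P rows *:%R emb_fun emb_linear.

Lemma ent_emb p a : ent (emb_fun p) a = val p * rho a.
Proof. by rewrite ent_mk -mulrA rho_eta. Qed.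

(** An endomorphism of [rows] fixing the image of [emb_fun] differs from the
    identity by entries in the radical, hence is bijective. *)
Lemma emb_minimal : left_minimal (emb_fun : {linear P -> rows}).
Proof.
move=> h hf; pose y b a := ent (h (unit_row b)) a.
have entE w a : ent (h w) a = \sum_b ent w b * y b a.
  rewrite {1}(rows_expand w) linear_sum ent_sum.
  by apply: eq_bigr => b _; rewrite linearZ entZ.
have yJ b a : Jn 1 (eta b * (y b a - (a == b)%:R * eta a)).
  apply: (rho_rad (y := fun b => y b a - (a == b)%:R * eta a)) => {b}.
  under eq_bigr => b _ do rewrite mulrBr.
  rewrite sumrB; apply/eqP; rewrite subr_eq0; apply/eqP.
  have := congr1 (ent^~ a) (hf (lelt kap 1)); rewrite /= entE ent_emb /= mul1r kap_rho.
  under eq_bigr => b _ do rewrite ent_emb /= mul1r kap_rho.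
  move=> ->; rewrite (bigD1 a) //= eqxx mul1r rho_eta big1 ?addr0 // => b nba.
  by rewrite eq_sym (negbTE nba) mul0r mulr0.
have DJ n w : (forall a, Jn n (ent w a)) -> forall a, Jn n.+1 (ent (h w - w) a).
  move=> wJ a; rewrite entB entE.
  rewrite (_ : _ - _ = \sum_b ent w b * (eta b * (y b a - (a == b)%:R * eta a))).
    by apply: big_ind => // [u v|b _]; [apply: JnD|apply: JnM1].
  under [in RHS]eq_bigr => b _ do rewrite mulrA ent_eta mulrBr.
  rewrite sumrB; congr (_ - _); rewrite (bigD1 a) //= eqxx mul1r ent_eta.
  by rewrite big1 ?addr0 // => b nba; rewrite eq_sym (negbTE nba) mul0r mulr0.
have zero w : (forall a, Jn N (ent w a)) -> w = 0.
  by move=> wJ; apply: rows_eq => a; rewrite ent0; apply: JnN.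
have JnNeg n x : Jn n x -> Jn n (- x) by rewrite -mulN1r; apply: JnMl.
apply: inj_surj_bij.
  move=> w w' E; apply/eqP; rewrite -subr_eq0; apply/eqP/zero.
  have {E} : h (w - w') = 0 by rewrite linearB E subrr.
  move: (w - w') => {}w E; elim: N => // n IH a.
  have -> : w = (-1) *: (h w - w) by rewrite E sub0r scaleN1r opprK.
  by rewrite entZ; apply/JnMl/DJ.
move=> w; have [x xE] : exists x, forall a, Jn N (ent (w - h x) a).
  elim: N => [|n [x IH]]; first by exists 0.
  exists (x + (w - h x)) => a.
  have -> : w - h (x + (w - h x)) = (-1) *: (h (w - h x) - (w - h x)).
    by rewrite scaleN1r opprB linearD opprD addrA.
  by rewrite entZ; apply/JnMl/DJ.
by exists x; apply/eqP; rewrite eq_sym -subr_eq0; apply/eqP/zero.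
Qed.

Lemma in_add_rows : in_add P' rows.
Proof.
pose i (w : rows) := [ffun j : 'I_#|O| => lelt eps (ent w (enum_val j))].
pose r (u : {ffun 'I_#|O| -> P'}) := mk_rows (fun a => val (u (enum_rank a))).
have iL : linear i.
  move=> c w w'; apply/ffunP => j; rewrite !ffunE entD entZ.
  by apply: val_inj; rewrite /= mulrDl -mulrA.
have rL : linear r.
  move=> c u u'; apply: rows_eq => a; rewrite entD entZ !ent_mk !ffunE /=.
  by rewrite [_ *: _](_ : _ = c * (val (u (enum_rank a)) : A)) // mulrDl mulrA.
pose ia := GRing.isLinear.Build A rows {ffun 'I_#|O| -> P'} *:%R i iL.
pose ra := GRing.isLinear.Build A {ffun 'I_#|O| -> P'} rows *:%R r rL.
pose il : {linear rows -> {ffun 'I_#|O| -> P'}} := HB.pack i ia.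
pose rl : {linear {ffun 'I_#|O| -> P'} -> rows} := HB.pack r ra.
exists #|O|, il, rl => w; apply: rows_eq => a.
rewrite ent_mk ffunE enum_rankK /= (_ : ent w a * eps = ent w a) ?ent_eta //.
by rewrite -(ent_eta w a) -mulrA eta_eps.
Qed.

(** A morphism from the left ideal of [kap] to a summand of a power of the left
    ideal of [eps] factors through [emb_fun]: its value at the generator is a
    right combination of the [rho a]. *)
Lemma add_factor (Y : lmodType A) (g : {linear P -> Y}) : in_add P' Y ->
  exists x : O -> Y, (forall a, eta a *: x a = x a) /\
    g (lelt kap 1) = \sum_a rho a *: x a.
Proof.
move=> [m [i [r irK]]]; pose v j : A := val (i (g (lelt kap 1)) j).
have genK : lelt kap 1 = kap *: lelt kap 1.
  by rewrite lelt_scale mulr1; apply: val_inj; rewrite /= mul1r kapK.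
have vE j : kap * v j * eps = v j.
  have -> : kap * v j = v j.
    by rewrite /v [in RHS]genK !linearZ ffunE.
  by have /asboolP[y] := valP (i (g (lelt kap 1)) j); rewrite /v => ->; rewrite -mulrA epsK.
have /choice[z zE] j : exists z : O -> A, v j = \sum_a rho a * z a.
  by have [z zE] := rho_gen (v j); exists z; rewrite -zE vE.
exists (fun a => r [ffun j => lelt eps (eta a * z j a)]); split=> [a|].
  rewrite -linearZ; congr (r _); apply/ffunP => j.
  by rewrite !ffunE lelt_scale mulrA etaK.
rewrite -[LHS]irK; under eq_bigr => a _ do rewrite -linearZ.
rewrite -linear_sum; congr (r _); apply/ffunP => j; rewrite sum_ffunE.
under eq_bigr => a _ do rewrite !ffunE lelt_scale mulrA rho_eta.
rewrite -[LHS]lelt_val // -/(v j) zE; apply: val_inj => /=.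
by rewrite big_distrl /=; elim/big_rec2: _ => // a u u' _ ->.
Qed.

Section FromTilting.
Variables (T X M : lmodType A) (f : {linear P -> X}) (g : {linear X -> M}).
Hypothesis fapp : left_approximation P' f.
Hypothesis fmin : left_minimal f.
Hypothesis cok : is_cokernel f g.
Hypothesis isoT : mod_isomorphic T (P' * M)%type.

(** Both [f] and [emb_fun] are minimal left approximations and therefore factor
    through each other by isomorphisms, so the cokernel is that of [emb_fun].
    The element [t] generates the summand [A eps], and [n a] is the image of the
    [a]-th generator of [rows] in the cokernel. *)
Lemma tilting_presentation : exists (t : T) (n : O -> T),
  [/\ eps *: t = t, forall a, eta a *: n a = n a, \sum_a rho a *: n a = 0,
      forall m, exists (x : A) (xa : O -> A), m = x *: t + \sum_a xa a *: n a
    & forall (x : A) (xa : O -> A), x *: t + \sum_a xa a *: n a = 0 ->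
      x * eps = 0 /\ exists y, forall a, xa a * eta a = y * rho a].
Proof.
have [addX fext] := fapp.
have [xs [xs_eta fE]] := add_factor f addX.
pose beta (w : rows) : X := \sum_a ent w a *: xs a.
have betaL : linear beta.
  move=> c w w'; rewrite /beta scaler_sumr -big_split; apply: eq_bigr => a _ /=.
  by rewrite entD entZ scalerDl scalerA.
pose betaM := GRing.isLinear.Build A rows X *:%R beta betaL.
pose bl : {linear rows -> X} := HB.pack beta betaM.
have [al alE] := fext _ (emb_fun : {linear P -> rows}) in_add_rows.
have genP p : p = val p *: lelt kap 1.
  by rewrite lelt_scale mulr1 lelt_val.
have beta_emb p : bl (emb_fun p) = f p.
  rewrite /= /beta [in RHS](genP p) linearZ /= fE scaler_sumr.
  by apply: eq_bigr => a _; rewrite ent_emb scalerA.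
have ba : bijective (bl \o al).
  by apply: (fmin (h := bl \o al)) => p; rewrite -[RHS]beta_emb -alE.
have ab : bijective (al \o bl).
  by apply: (emb_minimal (h := al \o bl)) => p; rewrite -[RHS]alE -beta_emb.
have binj : injective bl.
  by move=> u v E; apply: (bij_inj ab); apply: (congr1 al).
have bsurj x : exists w, bl w = x.
  by have [c _ cK] := ba; exists (al (c x)); apply: cK.
have [gsurj gker] := cok.
have [F [G FK GK]] := isoT.
have injF : injective F := can_inj FK.
have scP c (u : P') (v : M) : c *: (u, v) = (c *: u, c *: v) :> (P' * M)%type by [].
have adP (u u' : P') (v v' : M) : (u, v) + (u', v') = (u + u', v + v') :> (P' * M)%type.
  by [].
pose t := G (lelt eps 1, 0); pose n a := G (0, g (xs a)).
have FE x (xa : O -> A) : F (x *: t + \sum_a xa a *: n a) =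
    (lelt eps x, g (\sum_a xa a *: xs a)).
  rewrite linearD linearZ linear_sum /= GK.
  have -> : \sum_a F (xa a *: n a) = (0, g (\sum_a xa a *: xs a)).
    elim/big_rec2: _ => [|a u v _ ->]; first by rewrite linear0.
    by rewrite linearZ /= GK linearD linearZ scP scaler0 adP add0r.
  by rewrite scP adP addr0 scaler0 add0r lelt_scale mulr1.
have FE0 (xa : O -> A) : F (\sum_a xa a *: n a) = (0, g (\sum_a xa a *: xs a)).
  have := FE 0 xa; rewrite scale0r add0r => ->; congr (_, _).
  by apply: val_inj; rewrite /= mul0r.
exists t, n; split.
- apply: injF; rewrite linearZ /= GK scP scaler0 lelt_scale mulr1.
  by congr (_, _); apply: val_inj; rewrite /= mul1r epsK.
- move=> a; apply: injF; rewrite linearZ /= GK scP scaler0.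
  by rewrite -linearZ /= xs_eta.
- apply: injF; rewrite linear0 FE0 -fE; congr (_, _).
  by apply/gker; exists (lelt kap 1).
- move=> m; case Fm: (F m) => [p u]; have [x gx] := gsurj u.
  have [w wx] := bsurj x; exists (val p), (ent w); apply: injF.
  by rewrite Fm FE lelt_val // -gx -wx.
move=> x xa /(congr1 F); rewrite FE linear0 => -[x0 xa0].
split; first exact: x0.
have /gker[p pE] := xa0.
exists (val p) => a; rewrite -ent_emb -ent_mk; congr (ent _ a); apply: binj.
rewrite beta_emb -pE /= /beta; apply: eq_bigr => b _.
by rewrite ent_mk -scalerA xs_eta.
Qed.
End FromTilting.
End Presentation.

(** * Finite dimensional quotients are nilpotent *)

Section Nilpotence.
Variables (K : fieldType) (V : finType) (Q : quiver V) (I : ideal (cpa K Q)).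
Hypothesis Icl : rad_closed I.
Hypothesis fd : finite_dimensional (quot_alg (A := cpa_alg K Q) I).

Lemma quot_piZ (c : K) f :
  quot_pi I (c *: f) = kalg_scal (quot_alg (A := cpa_alg K Q) I) c * quot_pi I f.
Proof. by rewrite scale_cpa_scal rmorphM. Qed.

(** The images of the powers of the radical form a decreasing sequence of
    subspaces, so two consecutive ones coincide; from then on the sequence is
    constant, and its intersection is 0 because [I] is closed. *)
Lemma fd_nilpotent : exists N, forall f, inrad N f -> I f.
Proof.
apply: contrapT => /forallNP nilN.
have chain n : exists f, inrad n f /\ forall g, inrad n.+1 g -> ~ I (f - g).
  apply: contrapT => /forallNP noN; apply: (nilN n) => f Hf.
  have step i : forall h, inrad (n + i) h ->
      exists g, inrad (n + i).+1 g /\ I (h - g).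
    elim: i => [|i IH] h.
      rewrite addn0 => Hh; apply: contrapT => no; apply: (noN h); split=> // g Hg Ihg.
      by apply: no; exists g.
    rewrite addnS => Hh.
    have /choice[g gP] a := IH _ (inrad_lquot a Hh).
    exists (\sum_a arrow_elt K a * g a); split.
      apply: inrad_sum => a _; rewrite -add1n; apply: inradM; last exact: (gP a).1.
      exact: (@inrad_path K V Q (src a) [:: a]).
    rewrite {1}(arrow_decomp (inrad_le _ Hh)) // -sumrB; apply: ideal_sum => a _.
    by rewrite -mulrBr; apply/idealMl/(gP a).2.
  have tail m : exists g, inrad (n + m) g /\ I (f - g).
    elim: m => [|m [g [Hg Ig]]].
      by exists f; rewrite addn0 subrr; split=> //; apply: ideal0.
    have [g' [Hg' Ig']] := step m g Hg; exists g'; rewrite addnS; split=> //.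
    by rewrite -(subrKA g); apply: idealD.
  apply: Icl => m; have [g [Hg Ig]] := tail m; exists (f - g) => //.
  by rewrite subKr; apply: inrad_le Hg; apply: leq_addl.
have /choice[x xP] := chain.
have [d [b bP]] := fd.
have /choice[c cE] (j : 'I_d.+1) := bP (quot_pi I (x j)).
pose M := \matrix_(j < d.+1, i < d) c j i.
have kn0 : kermx M != 0.
  rewrite -mxrank_eq0 mxrank_ker subn_eq0 -ltnNge ltnS.
  exact: rank_leq_col.
have [i0 v0] : exists i0, row i0 (kermx M) != 0.
  apply/existsP; rewrite -negb_forall; apply: contra kn0 => /forallP z.
  by apply/eqP/row_matrixP => i; rewrite (eqP (z i)) row0.
pose v := row i0 (kermx M).
have vM : v *m M = 0 by apply/sub_kermxP/row_sub.
have Iv : I (\sum_j v 0 j *: x j).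
  rewrite -[\sum_j _]subr0; apply/quot_piP; rewrite raddf_sum rmorph0.
  under eq_bigr => j _ do rewrite /= quot_piZ cE big_distrr /=.
  rewrite exchange_big big1 // => i _.
  have /(congr1 (fun A : 'rV[K]_d => A 0 i)) := vM; rewrite mxE [RHS]mxE => Mi.
  transitivity (kalg_scal (quot_alg (A := cpa_alg K Q) I) 0 * b i).
    rewrite -Mi raddf_sum big_distrl; apply: eq_bigr => j _.
    rewrite [M j i]mxE mulrA; congr (_ * _).
    exact: (esym (rmorphM (kalg_scal (quot_alg (A := cpa_alg K Q) I)) _ _)).

  by rewrite rmorph0 mul0r.
have [j0 j0v] : exists j, v 0 j != 0.
  apply/existsP; rewrite -negb_forall; apply: contra v0 => /forallP z.
  by apply/eqP/rowP => i; rewrite (eqP (z i)) mxE.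
case: (@arg_minnP _ j0 (fun j : 'I_d.+1 => v 0 j != 0) (fun j => j : nat) j0v) => j vj jmin.
have [_ xj] := xP j.
pose g := - \sum_(i | i != j) (v 0 j)^-1 * v 0 i *: x i.
apply: (xj g).
  apply: inradN; apply: inrad_sum => i nij; have [->|vi] := eqVneq (v 0 i) 0.
    by rewrite mulr0 scale0r; apply: inrad0.
  apply/inradZ/(inrad_le _ (xP i).1).
  by rewrite ltn_neqAle eq_sym nij jmin.
have := idealZ (v 0 j)^-1 Iv; rewrite scaler_sumr (bigD1 j) //= scalerA mulVf //.
by rewrite scale1r /g opprK; under eq_bigr => i _ do rewrite scalerA.
Qed.

End Nilpotence.

(** * Relations starting at a source *)

(** The arrows [o a] are those that start at the source [k], the relations [r b]
    run from [k] to [s b], and the relations in [S] start elsewhere. *)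
Section Source.
Variables (K : fieldType) (V : finType) (Q : quiver V) (k : V).
Variables (O B : finType) (o : O -> Q) (r : B -> cpa K Q) (s : B -> V).
Variables (S : cpa K Q -> Prop) (I : ideal (cpa K Q)).

Local Notation e := (vertex_elt K (Q := Q)).
Local Notation arr a := (arrow_elt K (o a)).

Hypothesis source : forall x : Q, tgt x != k.
Hypothesis o_src : forall a, src (o a) = k.
Hypothesis o_inj : injective o.
Hypothesis o_surj : forall x, src x = k -> exists a, x = o a.
Hypothesis s_neq : forall b, s b != k.
Hypothesis r_src : forall b, e k * r b = r b.
Hypothesis r_tgt : forall b, r b * e (s b) = r b.
Hypothesis r_rad : forall b, inrad 2 (r b).
Hypothesis S_src : forall f, S f -> e k * f = 0.
Hypothesis S_rad : forall f, S f -> inrad 1 f.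

Definition relations (f : cpa K Q) : Prop := S f \/ exists b, f = r b.
Definition relations_but (b : B) (f : cpa K Q) : Prop :=
  S f \/ exists2 b', b' != b & f = r b'.

Hypothesis IE : forall f, I f <-> closed_ideal relations f.
Hypothesis fd : finite_dimensional (quot_alg (A := cpa_alg K Q) I).
Hypothesis gl2 : gl_dim_le (quot_alg (A := cpa_alg K Q) I) 2.
Hypothesis minimal_r : forall b, ~ closed_ideal (relations_but b) (r b).

(** The second derivatives: [r b] is the sum of the products of the arrows [o a]
    with [D b a]. *)
Definition D (b : B) (a : O) : cpa K Q := lquot (o a) (r b).

Lemma I_closed : rad_closed I.
Proof.
move=> f Hf; apply/IE/closed_ideal_closed => n.
by have [g /IE Ig fg] := Hf n; exists g.
Qed.

Lemma I_ind (P : cpa K Q -> Prop) : P 0 -> (forall f g, P f -> P g -> P (f + g)) ->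
  (forall a f, P f -> P (a * f)) -> (forall a f, P f -> P (f * a)) ->
  (forall f, S f -> P f) -> (forall b, P (r b)) -> rad_closed P ->
  forall f, I f -> P f.
Proof.
move=> P0 PD Pl Pr PS PB Pcl f /IE; apply: closed_ideal_ind => // g [/PS//|[b ->]].
exact: PB.
Qed.

Lemma I_rad f : I f -> inrad 1 f.
Proof.
move: f; apply: I_ind.
- exact: inrad0.
- exact: inradD.
- by move=> a f; apply: inradMl.
- by move=> a f; apply: inradMr.
- exact: S_rad.
- by move=> b; apply: inrad_le (r_rad b).
move=> f Hf; have [g Hg fg] := Hf 1%N.
by rewrite -(subrK g f); apply: inradD.
Qed.

Lemma S_lquot f a : S f -> lquot (o a) f = 0.
Proof.
move=> Sf; apply: cpaP => v l _; rewrite coef0 coef_lquot; case: ifP => // _.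
have := congr1 (fun g => coef g k (o a :: l)) (S_src Sf).
by rewrite /= coef_vertexM eqxx mul1r coef0 o_src.
Qed.

Lemma r_coef_nil b v : coef (r b) v [::] = 0.
Proof. exact: (r_rad b). Qed.

Lemma arr_decomp f : e k * f = f -> inrad 1 f ->
  f = \sum_a arr a * lquot (o a) f.
Proof.
move=> fk fr; rewrite {1}(arrow_decomp fr).
rewrite (bigID (fun x => src x == k)) /= [X in _ + X]big1 ?addr0 => [|x nx].
  rewrite -big_filter.
  rewrite (perm_big [seq o a | a <- index_enum O]) /=; last first.
    apply: uniq_perm; first by rewrite filter_uniq ?index_enum_uniq.
      by rewrite map_inj_uniq ?index_enum_uniq.
    move=> x; rewrite mem_filter mem_index_enum andbT; apply/eqP/mapP.
      by case/o_surj => a ->; exists a; rewrite ?mem_index_enum.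
    by case=> a _ ->.
  by rewrite big_map.
apply: cpaP => v [|y l] vl; rewrite coef0 ?coef_arrowM_nil // coef_arrowM_cons.
case: eqP => [vx|]; last by rewrite mul0r.
rewrite coef_lquot; case: ifP => // _; last by rewrite mulr0.
have := congr1 (fun g => coef g (src x) (x :: l)) fk.
by rewrite /= coef_vertexM (negbTE nx) mul0r => <-; rewrite mulr0.
Qed.

Lemma r_decomp b : r b = \sum_a arr a * D b a.
Proof. by apply: arr_decomp => //; apply: inrad_le (r_rad b). Qed.

Lemma out_arr a : e k * arr a = arr a.
Proof. by rewrite -{1}(o_src a) src_arrow. Qed.

Lemma D_src b a : e (tgt (o a)) * D b a = D b a.
Proof. by rewrite /D -lquot_vertexl. Qed.

Lemma D_tgt b a : D b a * e (s b) = D b a.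
Proof. by rewrite /D -{2}(r_tgt b) lquotM r_coef_nil scale0r addr0. Qed.

Lemma D_rad b a : inrad 1 (D b a).
Proof. exact: inrad_lquot (r_rad b). Qed.

Lemma lquot_arr a b f :
  lquot (o a) (arr b * f) = (a == b)%:R *: (e (tgt (o a)) * f).
Proof.
rewrite lquotM lquot_arrow (inj_eq o_inj).
rewrite (_ : coef (arr b) _ _ = 0) ?scale0r ?addr0 -?cpa_scalerAl //.
by rewrite coef_path xpair_eqE andbF.
Qed.

Lemma lquot_sum_arr a (y : O -> cpa K Q) :
  lquot (o a) (\sum_b arr b * y b) = e (tgt (o a)) * y a.
Proof.
rewrite linear_sum (bigD1 a) //= big1 => [|b nba].
  by rewrite lquot_arr eqxx scale1r addr0.
by rewrite lquot_arr eq_sym (negbTE nba) scale0r.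
Qed.

(** Paths ending at the source [k] are trivial. *)
Lemma end_source f : f * e k = coef f k [::] *: e k.
Proof.
apply: cpaP => v l vl; rewrite coefZ coef_Mvertex coef_path vl /=.
case/lastP: l vl => [|l x] vl.
  by rewrite /walk_end /= xpair_eqE eqxx andbT; case: eqP => [->|]; rewrite ?mulr0.
rewrite /walk_end map_rcons last_rcons (negbTE (source x)) mulr0 xpair_eqE.
by case: l {vl} => [|y l]; rewrite ?andbF mulr0.
Qed.

Lemma nilpotent_I : exists N, forall f, inrad N f -> I f.
Proof. exact: fd_nilpotent I_closed fd. Qed.

(** Exactness in the middle of the presentation of the simple right module at [k]
    by the arrows [o a] and the relations [r b].  The induction over the ideal
    works because multiplication on the left by [u] acts on the components as
    a scalar modulo [I], and multiplication on the right commutes with taking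
    components. *)
Lemma I_lquot f : I f ->
  exists z : B -> cpa K Q, forall a, I (lquot (o a) f - \sum_b D b a * z b).
Proof.
pose P f := I f /\
  exists z : B -> cpa K Q, forall a, I (lquot (o a) f - \sum_b D b a * z b).
move=> If; suff : P f by case.
have [N IN] := nilpotent_I.
have Irel x : relations x -> I x by move=> Rx; apply/IE/mem_closed_ideal.
move: f If; apply: I_ind.
- split; first exact: ideal0.
  exists (fun=> 0) => a; rewrite linear0 big1 => [|b _]; last by rewrite mulr0.
  by rewrite subr0; apply: ideal0.
- move=> f g [If [z zE]] [Ig [z' z'E]]; split; first exact: idealD.
  exists (fun b => z b + z' b) => a; rewrite linearD.
  under eq_bigr => b _ do rewrite mulrDr.
  by rewrite big_split /= opprD addrACA; apply: idealD.
- move=> u f [If [z zE]]; split; first exact: idealMl.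
  exists (fun b => coef u k [::] *: z b) => a; rewrite lquotM o_src.
  under eq_bigr => b _ do rewrite -cpa_scalerAr.
  rewrite -scaler_sumr -addrA -scalerBr; apply: idealD; last exact: idealZ.
  exact: idealMl.
- move=> u f [If [z zE]]; split; first exact: idealMr.
  exists (fun b => z b * u) => a; rewrite lquotM.
  rewrite (I_rad If) // scale0r addr0.
  under eq_bigr => b _ do rewrite mulrA.
  by rewrite -mulr_suml -mulrBl; apply: idealMr.
- move=> f Sf; split; first by apply: Irel; left.
  exists (fun=> 0) => a; rewrite S_lquot // big1 => [|b _]; last by rewrite mulr0.
  by rewrite subr0; apply: ideal0.
- move=> b; split; first by apply: Irel; right; exists b.
  exists (fun b' => (b' == b)%:R) => a.
  rewrite (bigD1 b) //= eqxx mulr1 big1 => [|b' nb]; last by rewrite (negbTE nb) mulr0.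
  by rewrite addr0 subrr; apply: ideal0.
move=> f Hf; split; first by apply: I_closed => n; have [g [Ig _] fg] := Hf n; exists g.
have [g [Ig [z zE]] fg] := Hf N.+1; exists z => a.
rewrite -(subrKA (lquot (o a) g)); apply: idealD => //.
by apply: IN; rewrite -linearB; apply: inrad_lquot.
Qed.

Lemma sum_arr_I (y : O -> cpa K Q) : I (\sum_a arr a * y a) ->
  exists z : B -> cpa K Q, forall a, I (e (tgt (o a)) * y a - \sum_b D b a * z b).
Proof.
by move=> /I_lquot[z zE]; exists z => a; rewrite -(lquot_sum_arr a y).
Qed.

(** Minimality of the relations: otherwise [r b], multiplied by a unit, would
    lie in the closed ideal of the other relations, for a path from [k] of
    positive length never returns to the start of [r b]. *)
Lemma D_minimal (z : B -> cpa K Q) : (forall a, I (\sum_b D b a * z b)) ->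
  forall b, inrad 1 (e (s b) * z b).
Proof.
move=> zI b0; apply/inrad1P => v; rewrite coef_vertexM.
have [->|] := eqVneq v (s b0); last by rewrite mul0r.
rewrite mul1r; apply/eqP/negPn/negP => mu0; set mu := coef _ _ _ in mu0.
pose I' := closed_ideal (relations_but b0).
have I'cl : rad_closed I' by apply: closed_ideal_closed.
have arrI f : I f -> forall u a, I' (arr a * u * f).
  move: f; apply: I_ind.
  - by move=> u a; rewrite mulr0; apply: ideal0.
  - by move=> f g If Ig u a; rewrite mulrDr; apply: idealD.
  - by move=> c f If u a; rewrite mulrA -(mulrA (arr a)); apply: If.
  - by move=> c f If u a; rewrite mulrA; apply/idealMr/If.
  - by move=> f Sf u a; apply/idealMl/mem_closed_ideal; left.
  - move=> b u a; have [->|nb] := eqVneq b b0; last first.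
      by apply/idealMl/mem_closed_ideal; right; exists b.
    rewrite -r_src -mulrA [u * _]mulrA end_source -cpa_scalerAl -cpa_scalerAr.
    apply: idealZ; rewrite r_src -(arrow_tgt K (o a)) -mulrA -r_src.
    rewrite [e (tgt _) * _]mulrA vertex_eltM (negbTE (source _)) scale0r mul0r mulr0.
    exact: ideal0.
  move=> f Hf u a; apply: I'cl => n; have [g Hg fg] := Hf n.
  by exists (arr a * u * g) => //; rewrite -mulrBr; apply: inradMl.
have rz : I' (r b0 * z b0).
  have -> : r b0 * z b0 = (\sum_b r b * z b) - \sum_(b | b != b0) r b * z b.
    by rewrite (bigD1 b0) //= addrK.
  apply: idealB.
    under eq_bigr => b _ do rewrite r_decomp mulr_suml.
    rewrite exchange_big /=; apply: (@ideal_sum _ I') => a _.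
    under eq_bigr => b _ do rewrite -mulrA.
    by rewrite -mulr_sumr -[arr a]mulr1; apply: arrI.
  by apply: ideal_sum => b nb; apply/idealMr/mem_closed_ideal; right; exists b.
pose es := e (s b0); pose x := es - mu^-1 *: (es * z b0 * es).
have xr : inrad 1 x.
  apply/inrad1P => w; rewrite coefB coefZ coef_Mvertex coef_vertexM coef_path.
  rewrite xpair_eqE eqxx andbT /walk_end /=.
  have [->|] := eqVneq w (s b0); last by rewrite !mul0r mulr0 subr0.
  by rewrite mul1r mulr1 mulVf // subrr.
have [w [xw _]] := one_sub_inverse xr.
apply: (minimal_r (b := b0)); rewrite -[r b0]mulr1 -xw mulrA.
apply: idealMr; rewrite mulrBr mulr1 mulrBr r_tgt opprB addrCA subrr addr0.
by rewrite -cpa_scalerAr !mulrA r_tgt; apply/idealZ/idealMr.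
Qed.

(** ** Passing to the quotient algebra *)

Local Notation A := (quot_ring I).
Local Notation pi := (@quot_pi _ I).

Lemma pi_lift (X : Type) (y : X -> A) : exists y' : X -> cpa K Q, forall x, pi (y' x) = y x.
Proof. by exists (fun x => quot_repr (y x)) => x; apply: quot_reprK. Qed.

Definition Jn (n : nat) (u : A) : Prop := exists2 f, inrad n f & u = pi f.

Lemma Jn_all u : Jn 0 u.
Proof. by exists (quot_repr u) => //; rewrite quot_reprK. Qed.
Lemma Jn0 n : Jn n 0.
Proof. by exists 0; [apply: inrad0|rewrite rmorph0]. Qed.
Lemma JnD n u v : Jn n u -> Jn n v -> Jn n (u + v).
Proof.
by move=> [f Hf ->] [g Hg ->]; exists (f + g); [apply: inradD|rewrite rmorphD].
Qed.
Lemma JnMl n a u : Jn n u -> Jn n (a * u).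
Proof.
move=> [f Hf ->]; exists (quot_repr a * f); first exact: inradMl.
by rewrite rmorphM /= quot_reprK.
Qed.
Lemma JnMr n a u : Jn n u -> Jn n (u * a).
Proof.
move=> [f Hf ->]; exists (f * quot_repr a); first exact: inradMr.
by rewrite rmorphM /= quot_reprK.
Qed.
Lemma JnM1 n u v : Jn n u -> Jn 1 v -> Jn n.+1 (u * v).
Proof.
move=> [f Hf ->] [g Hg ->]; exists (f * g); last by rewrite rmorphM.
by rewrite -addn1; apply: inradM.
Qed.
Lemma Jn_nil : exists N, forall u, Jn N u -> u = 0.
Proof.
have [N IN] := nilpotent_I; exists N => u [f Hf ->].
by apply/quot_pi0P/IN.
Qed.

Definition radA : ideal A :=
  Ideal (Jn0 1) (@JnD 1) (fun a u => @JnMl 1 a u) (fun a u => @JnMr 1 a u).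

(** Exactness at the left end: by the minimality of the relations, the kernel of
    [D] lies in the radical, and then [delta_ker_filtered], where the global
    dimension enters, pushes it into every power of the nilpotent radical. *)
Lemma D_independent (z : B -> cpa K Q) : (forall a, I (\sum_b D b a * z b)) ->
  forall b, I (e (s b) * z b).
Proof.
move=> zI b; apply/quot_pi0P; rewrite rmorphM.
have [N JN] := Jn_nil; apply: JN.
apply: (@delta_ker_filtered A radA O B (fun a => pi (arr a))
  (fun a => pi (e (tgt (o a)))) (fun b a => pi (D b a)) (fun b => pi (e (s b)))
  _ _ _ _ _ _ gl2 Jn _ _ _ _ N (fun b => pi (z b))) => //.
- by move=> b'; under eq_bigr => a _ do rewrite -rmorphM; rewrite -rmorph_sum -r_decomp;
    apply/quot_pi0P/IE/mem_closed_ideal; right; exists b'.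
- by move=> b' a; rewrite -rmorphM D_src.
- by move=> b' a; rewrite -rmorphM D_tgt.
- by move=> b'; rewrite -rmorphM vertex_eltM eqxx scale1r.
- move=> y; have [y' yE] := pi_lift y.
  under eq_bigr => a _ do rewrite -yE -rmorphM.
  rewrite -rmorph_sum => /quot_pi0P/sum_arr_I[z' z'E]; exists (fun b => pi (z' b)) => a.
  under [in RHS]eq_bigr => b' _ do rewrite -rmorphM.
  by rewrite -yE -rmorphM -rmorph_sum; apply/quot_piP.
- move=> y yK b'; have [y' yE] := pi_lift y.
  rewrite -yE -rmorphM; exists (e (s b') * y' b') => //; apply: D_minimal => a.
  apply/quot_pi0P; rewrite rmorph_sum -[RHS](yK a); apply: eq_bigr => b'' _.
  by rewrite rmorphM /= yE.
- exact: Jn_all.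
- exact: Jn0.
- exact: JnD.
- by move=> n u v Ju; apply: JnM1.
- move=> a; under eq_bigr => b' _ do rewrite -rmorphM.
  by rewrite -rmorph_sum; apply/quot_pi0P.
Qed.

(** ** The mutated quiver *)

(** [Y] is the quiver with the arrows [x] of [Q] not starting at [k], an arrow
    from the end of [o a] to [k] for each [a], and an arrow from [k] to [s b]
    for each [b].  The map [kind] tells these apart, so that the lemmas apply to
    any labelling of the arrows. *)
Variables (Y : quiver V) (kind : Y -> Q + (O + B)).
Hypothesis kind_inj : injective kind.
Hypothesis kind_com : forall y x, kind y = inl x ->
  [/\ src y = src x, tgt y = tgt x & src x != k].
Hypothesis kind_star : forall y a, kind y = inr (inl a) ->
  src y = tgt (o a) /\ tgt y = k.
Hypothesis kind_bst : forall y b, kind y = inr (inr b) -> src y = k /\ tgt y = s b.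

Definition com_part (y : Y) : option Q := if kind y is inl x then Some x else None.

Lemma com_ends y x : com_part y = Some x -> src y = src x /\ tgt y = tgt x.
Proof. by rewrite /com_part; case E: (kind y) => [z|] // [<-]; case: (kind_com E). Qed.

Definition common := QuiverPmap com_ends.

Variables (star : O -> Y) (bst : B -> Y).
Hypothesis kindK_com : forall x, src x != k -> exists y, kind y = inl x.
Hypothesis starK : forall a, kind (star a) = inr (inl a).
Hypothesis bstK : forall b, kind (bst b) = inr (inr b).

Lemma coef_common_arrow x v l : coef (subst common (arrow_elt K x)) v l =
  [&& walk v l, v == src x & (map kind l == [:: inl x])]%:R.
Proof.
rewrite coef_subst; case: ifP => [tl|ntl].
  rewrite coef_path walk_pmap // xpair_eqE; congr (nat_of_bool [&& _, _ & _])%:R.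
  case: l tl => [|y [|y' l]] //=; rewrite /com_part; case: (kind y) => //= z.
  by case: (kind y').
case: l ntl => [|y [|y' l]] //=; rewrite ?andbF //; last by rewrite eqseq_cons !andbF.
rewrite /com_part; case: (kind y) => //= z; rewrite !andbT.
by rewrite eqseq_cons !andbF.
Qed.

Lemma subst_common_arrow x y : kind y = inl x ->
  subst common (arrow_elt K x) = arrow_elt K y.
Proof.
move=> Ey; have [Es _ _] := kind_com Ey; apply: cpaP => v l vl.
rewrite coef_common_arrow coef_path xpair_eqE vl Es -Ey.
by rewrite -[[:: kind y]]/(map kind [:: y]) (inj_eq (inj_map kind_inj)).
Qed.

Lemma common_out a : subst common (arr a) = 0.
Proof.
apply: cpaP => v l vl; rewrite coef_common_arrow coef0.
case: (map kind l =P _) => [El|]; last by rewrite !andbF.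
case: l El {vl} => //= y l [Ey _]; have [_ _] := kind_com Ey.
by rewrite o_src eqxx.
Qed.

(** A representation of [Y] that extends one of [Q]: [al a] and [be b] are the
    images of the arrows to and from [k]. *)
Section Represent.
Variables (R : kalgebra K) (psi : {rmorphism cpa K Q -> R}).
Variables (al : O -> R) (be : B -> R).
Hypothesis psiI : forall f, I f -> psi f = 0.
Hypothesis psi_al : forall a, psi (e (tgt (o a))) * al a = al a.
Hypothesis al_psi : forall a, al a * psi (e k) = al a.
Hypothesis psi_be : forall b, psi (e k) * be b = be b.
Hypothesis be_psi : forall b, be b * psi (e (s b)) = be b.
Hypothesis al_be : forall a b, al a * be b = - psi (D b a).

Definition rep (y : Y) : R :=
  match kind y with
  | inl x => psi (arrow_elt K x)
  | inr (inl a) => al a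
  | inr (inr b) => be b
  end.

Lemma psi_orth v w : v != w -> psi (e v) * psi (e w) = 0.
Proof. by move=> nvw; rewrite -rmorphM vertex_eltM (negbTE nvw) scale0r rmorph0. Qed.

Lemma al_com a x : src x != k -> al a * psi (arrow_elt K x) = 0.
Proof.
move=> nx; rewrite -al_psi -src_arrow rmorphM -mulrA [psi _ * (_ * _)]mulrA.
by rewrite psi_orth ?mul0r ?mulr0 // eq_sym.
Qed.

Lemma al_al a b : al a * al b = 0.
Proof.
rewrite -al_psi -(psi_al b) -mulrA [psi _ * (_ * _)]mulrA.
by rewrite psi_orth ?mul0r ?mulr0 // eq_sym; apply: source.
Qed.

Lemma be_be b b' : be b * be b' = 0.
Proof.
rewrite -be_psi -(psi_be b') -mulrA [psi _ * (_ * _)]mulrA.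
by rewrite psi_orth ?mul0r ?mulr0.
Qed.

Lemma psi_k_be f b : psi f * be b = psi (coef f k [::] *: e k) * be b.
Proof. by rewrite -end_source rmorphM -mulrA psi_be. Qed.

(** Elements of weight at least [i], for the weight in which paths of length
    [n] weigh [2 n] and the arrows [al] weigh 1: right multiplication by an
    arrow of [Y] raises the weight. *)
Definition weight (i : nat) (u : R) : Prop :=
  exists (y : cpa K Q) (ya : O -> cpa K Q),
    [/\ inrad (uphalf i) y, forall a, inrad i./2 (ya a) &
        u = psi y + \sum_a psi (ya a) * al a].

Lemma weight_al i y a : inrad i./2 y -> weight i (psi y * al a).
Proof.
move=> Hy; exists 0, (fun a' => if a' == a then y else 0); split.
- exact: inrad0.
- by move=> a'; case: ifP => // _; apply: inrad0.
rewrite rmorph0 add0r (bigD1 a) //= eqxx big1 ?addr0 // => a' /negbTE ->.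
by rewrite rmorph0 mul0r.
Qed.

Lemma weight_psi i y : inrad (uphalf i) y -> weight i (psi y).
Proof.
move=> Hy; exists y, (fun=> 0); split=> // [a|]; first exact: inrad0.
by rewrite big1 ?addr0 // => a _; rewrite rmorph0 mul0r.
Qed.

Lemma weight_rep i u y : (0 < i)%N -> weight i u -> weight i.+1 (u * rep y).
Proof.
move=> i0 [f [fa [Hf Hfa ->]]]; rewrite mulrDl mulr_suml /rep.
case E: (kind y) => [x|[a|b]].
- have [_ _ nx] := kind_com E.
  rewrite big1 ?addr0 => [|a _]; last by rewrite -mulrA al_com ?mulr0.
  rewrite -rmorphM; apply: weight_psi.
  apply: (@inrad_le _ _ _ _ (uphalf i + 1)).
    by rewrite addn1 /= ltnS uphalf_half leq_addl.
  by apply: inradM => //; apply: (@inrad_path K V Q (src x) [:: x]).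
- rewrite big1 ?addr0 => [|a' _]; last by rewrite -mulrA al_al mulr0.
  exact: weight_al.
have i1 : (0 < uphalf i)%N by case: i i0 {Hf Hfa}.
rewrite psi_k_be (Hf k [::] i1) scale0r rmorph0 mul0r add0r.
under eq_bigr => a _ do rewrite -mulrA al_be mulrN -rmorphM.
rewrite sumrN -rmorph_sum -rmorphN; apply: weight_psi.
apply: inradN; apply: inrad_sum => a _ /=; rewrite -addn1.
exact: inradM (D_rad _ _).
Qed.

Lemma weight_word i u l : (0 < i)%N -> weight i u ->
  weight (i + size l) (u * \prod_(y <- l) rep y).
Proof.
elim: l i u => [|y l IH] i u i0 wu; first by rewrite big_nil mulr1 addn0.
by rewrite big_cons mulrA /= addnS -addSn; apply: IH => //; apply: weight_rep.
Qed.

Lemma weight_arrow y : (exists b, kind y = inr (inr b)) \/ weight 1 (rep y).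
Proof.
rewrite /rep; case E: (kind y) => [x|[a|b]]; [right|right|by left; exists b].
  by apply: weight_psi; apply: (@inrad_path K V Q (src x) [:: x]).
by rewrite -psi_al; apply: weight_al.
Qed.

Variable N : nat.
Hypothesis IN : forall f, inrad N f -> I f.

Lemma weight_vanish i u : (N.*2 <= i)%N -> weight i u -> u = 0.
Proof.
move=> Ni [f [fa [Hf Hfa ->]]]; have Ni2 : (N <= i./2)%N by rewrite -(doubleK N) half_leq.
rewrite psiI ?add0r; last first.
  by apply/IN/(inrad_le _ Hf)/(leq_trans Ni2); rewrite uphalf_half leq_addl.
by apply: big1 => a _; rewrite psiI ?mul0r //; apply/IN/(inrad_le Ni2).
Qed.

Lemma long_words l : (N.*2.+2 <= size l)%N -> \prod_(y <- l) rep y = 0.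
Proof.
case: l => [|y [|y' l]] //= szl; rewrite !ltnS in szl.
rewrite big_cons; have [[b Eb]|wy] := weight_arrow y; last first.
  apply: weight_vanish (weight_word (y' :: l) _ wy) => //=.
  by rewrite addnS; apply: leq_trans szl _; rewrite addnC addn1 leqW.
rewrite big_cons; have [[b' Eb']|wy'] := weight_arrow y'.
  by rewrite /rep Eb Eb' mulrA be_be mul0r.
rewrite [X in _ * X](_ : _ = 0) ?mulr0 //.
apply: weight_vanish (weight_word l _ wy') => //=.
by rewrite add1n leqW.
Qed.

Hypothesis psiZ : forall c, psi (cpa_scal c) = kalg_scal R c.
Hypothesis psi_out : forall a, psi (arr a) = 0.

(** Long words vanish by the weights, so that [cpa_lift] applies. *)
Lemma rep_lift : exists Phi : {rmorphism cpa K Y -> R},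
  [/\ forall c, Phi (cpa_scal c) = kalg_scal R c,
      forall f, inrad N.*2.+2 f -> Phi f = 0,
      forall f, Phi (subst common f) = psi f,
      forall a, Phi (arrow_elt K (star a)) = al a
    & forall b, Phi (arrow_elt K (bst b)) = be b].
Proof.
have psiE v w : psi (e v) * psi (e w) = if v == w then psi (e v) else 0.
  by rewrite -rmorphM vertex_eltM; case: eqP; rewrite ?scale1r // scale0r rmorph0.
have psi1 : \sum_v psi (e v) = 1 by rewrite -rmorph_sum vertex_sum rmorph1.
have srcE y : psi (e (src y)) * rep y = rep y.
  rewrite /rep; case E: (kind y) => [x|[a|b]].
  - by have [-> _ _] := kind_com E; rewrite -rmorphM src_arrow.
  - by have [-> _] := kind_star E.
  - by have [-> _] := kind_bst E.
have tgtE y : rep y * psi (e (tgt y)) = rep y.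
  rewrite /rep; case E: (kind y) => [x|[a|b]].
  - by have [_ -> _] := kind_com E; rewrite -rmorphM arrow_tgt.
  - by have [_ ->] := kind_star E.
  - by have [_ ->] := kind_bst E.
have longE v l : walk v l -> (N.*2.+2 <= size l)%N ->
    lift_word (fun v => psi (e v)) rep v l = 0.
  by move=> _ szl; rewrite /lift_word long_words ?mulr0.
have [Phi [PhiZ PhiM Phiv Phia]] := cpa_lift psiE psi1 srcE tgtE longE.
have NM : (N <= N.*2.+2)%N by rewrite -addnn -!addnS leq_addr.
exists Phi; split=> //.
- apply: (@cpa_hom_ext _ _ _ R (Phi \o subst common) psi N.*2.+2) => //=.
  + by move=> c; rewrite /= -PhiZ /cpa_scal linearZ /= rmorph1.
  + by move=> f Hf; apply/PhiM/inrad_subst.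
  + by move=> f Hf; apply/psiI/IN/(inrad_le NM).
  + by move=> v; rewrite /= subst_vertex Phiv.
  move=> x /=; have [/o_surj[a ->]|nx] := eqVneq (src x) k.
    by rewrite common_out rmorph0 psi_out.
  have [y Ey] := kindK_com nx.
  by rewrite (subst_common_arrow Ey) Phia /rep Ey.
- by move=> a; rewrite Phia /rep starK.
- by move=> b; rewrite Phia /rep bstK.
Qed.

End Represent.

(** ** The truncated Jacobian algebra of the mutated quiver *)

Variable IY : ideal (cpa K Y).

Definition relationsY (f : cpa K Y) : Prop :=
  (exists2 g, S g & f = subst common g) \/
  exists b a, f = subst common (D b a) + arrow_elt K (star a) * arrow_elt K (bst b).

Hypothesis IYE : forall f, IY f <-> closed_ideal relationsY f.

Local Notation com := (subst (K := K) common).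
Local Notation st a := (arrow_elt K (star a)).
Local Notation bs b := (arrow_elt K (bst b)).
Local Notation piY := (@quot_pi _ IY).

Lemma IY_closed : rad_closed IY.
Proof.
move=> f Hf; apply/IYE/closed_ideal_closed => n.
by have [g /IYE Ig fg] := Hf n; exists g.
Qed.

Lemma IY_rel f : relationsY f -> IY f.
Proof. by move=> Rf; apply/IYE/mem_closed_ideal. Qed.

Lemma IY_min (P : cpa K Y -> Prop) : P 0 -> (forall f g, P f -> P g -> P (f + g)) ->
  (forall a f, P f -> P (a * f)) -> (forall a f, P f -> P (f * a)) ->
  (forall f, relationsY f -> P f) -> rad_closed P -> forall f, IY f -> P f.
Proof. by move=> P0 PD Pl Pr PR Pcl f /IYE; apply: closed_ideal_ind. Qed.

Lemma common_source f : com (e k * f) = coef f k [::] *: vertex_elt K k.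
Proof.
pose g := e k * f - coef f k [::] *: e k.
have gk : e k * g = g.
  by rewrite mulrBr mulrA -cpa_scalerAr !vertex_eltM eqxx !scale1r.
have gr : inrad 1 g.
  apply/inrad1P => v; rewrite coefB coefZ coef_vertexM coef_path /= xpair_eqE eqxx andbT.
  by case: eqP => [->|_]; rewrite ?mul1r ?mulr1 ?subrr // !mul0r mulr0 subrr.
have g0 : com g = 0.
  rewrite (arr_decomp gk gr) linear_sum big1 // => a _.
  by rewrite rmorphM /= common_out mul0r.
move: g0; rewrite /g linearB linearZ /= subst_vertex => /eqP.
by rewrite subr_eq0 => /eqP.
Qed.

Lemma com_r b : com (r b) = 0.
Proof. by rewrite -r_src common_source r_coef_nil scale0r. Qed.

Lemma com_I f : I f -> IY (com f).
Proof.
move/IE; apply: (closed_ideal_min (J := preim_ideal com IY)) => [|g [Sg|[b ->]]].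
- by apply: rad_closed_preim IY_closed; apply: inrad_subst.
- by apply: IY_rel; left; exists g.
- by rewrite /= com_r; apply: ideal0.
Qed.

Lemma src_star a : src (star a) = tgt (o a).
Proof. by case: (kind_star (starK a)). Qed.
Lemma tgt_star a : tgt (star a) = k.
Proof. by case: (kind_star (starK a)). Qed.
Lemma src_bst b : src (bst b) = k.
Proof. by case: (kind_bst (bstK b)). Qed.
Lemma tgt_bst b : tgt (bst b) = s b.
Proof. by case: (kind_bst (bstK b)). Qed.

Lemma arrow_arrow0 (Q0 : quiver V) (x y : Q0) :
  tgt x != src y -> arrow_elt K x * arrow_elt K y = 0.
Proof. by move=> nxy; rewrite path_eltM /= ?eqxx // ifN. Qed.

Lemma com_bs f b : com f * bs b = coef f k [::] *: bs b.
Proof.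
have bE : bs b = vertex_elt K k * bs b by rewrite -{1}(src_bst b) src_arrow.
rewrite {1}bE -{1}(subst_vertex K common k) mulrA -rmorphM /= end_source linearZ /=.
by rewrite subst_vertex -cpa_scalerAl -bE.
Qed.

Lemma st_bs a b : IY (st a * bs b + com (D b a)).
Proof. by apply: IY_rel; right; exists b, a; rewrite addrC. Qed.

(** In a word on the arrows of [Y], an arrow to [k] that is not the last letter is
    followed by an arrow from [k], and their product is a [D b a] up to sign.
    Removing these products leaves words with at most one arrow from [k], at
    the beginning, and at most one arrow to [k], at the end. *)
Definition nf (x : cpa K Q) (xa : O -> cpa K Q) (z : B -> cpa K Q)
    (w : B -> O -> cpa K Q) : cpa K Y :=
  com x + \sum_a com (xa a) * st a + \sum_b bs b * com (z b) +
  \sum_b \sum_a bs b * com (w b a) * st a.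

Definition normal (f : cpa K Y) : Prop :=
  exists x xa z w, IY (f - nf x xa z w).

Lemma nf_linear c x xa z w x' xa' z' w' :
  c *: nf x xa z w + nf x' xa' z' w' =
  nf (c *: x + x') (fun a => c *: xa a + xa' a) (fun b => c *: z b + z' b)
     (fun b a => c *: w b a + w' b a).
Proof.
rewrite /nf !scalerDr !scaler_sumr addrACA; congr (_ + _).
  rewrite addrACA; congr (_ + _).
    rewrite addrACA linearP -big_split; congr (_ + _).
    by apply: eq_bigr => a _; rewrite linearP mulrDl cpa_scalerAl.
  by rewrite -big_split; apply: eq_bigr => b _; rewrite linearP mulrDr cpa_scalerAr.
rewrite -big_split; apply: eq_bigr => b _ /=; rewrite scaler_sumr -big_split.
apply: eq_bigr => a _ /=.
by rewrite linearP mulrDr mulrDl -cpa_scalerAr -cpa_scalerAl.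
Qed.

Lemma normal_com x : normal (com x).
Proof.
exists x, (fun=> 0), (fun=> 0), (fun _ _ => 0); rewrite /nf.
rewrite !big1 ?addr0 ?subrr => [||b _|a _]; try exact: ideal0.
- by move=> b _; rewrite big1 // => a _; rewrite linear0 mulr0 mul0r.
- by rewrite linear0 mulr0.
- by rewrite linear0 mul0r.
Qed.

Lemma normal_nf x xa z w : normal (nf x xa z w).
Proof. by exists x, xa, z, w; rewrite subrr; apply: ideal0. Qed.

Lemma normal_linear c f g : normal f -> normal g -> normal (c *: f + g).
Proof.
move=> [x [xa [z [w Hf]]]] [x' [xa' [z' [w' Hg]]]].
exists (c *: x + x'), (fun a => c *: xa a + xa' a), (fun b => c *: z b + z' b),
  (fun b a => c *: w b a + w' b a).
by rewrite -nf_linear opprD addrACA -scalerBr; apply/idealD/Hg/idealZ.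
Qed.

Lemma normal_congr f g : IY (f - g) -> normal g -> normal f.
Proof.
move=> fg [x [xa [z [w Hg]]]]; exists x, xa, z, w.
by rewrite -(subrKA g); apply: idealD.
Qed.

Lemma nf_com x xa z w y x' : kind y = inl x' ->
  nf x xa z w * arrow_elt K y =
  nf (x * arrow_elt K x') (fun=> 0) (fun b => z b * arrow_elt K x') (fun _ _ => 0).
Proof.
move=> Ey; have [Es _ nx] := kind_com Ey.
have st0 a : st a * arrow_elt K y = 0.
  by apply: arrow_arrow0; rewrite tgt_star Es eq_sym.
rewrite /nf !mulrDl -(subst_common_arrow Ey) rmorphM !mulr_suml /=.
rewrite (subst_common_arrow Ey); congr (_ + _ + _ + _).
- by apply: eq_bigr => a _; rewrite -mulrA st0 linear0 mulr0 mul0r.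
- by apply: eq_bigr => b _; rewrite rmorphM /= (subst_common_arrow Ey) mulrA.
apply: eq_bigr => b _; rewrite mulr_suml; apply: eq_bigr => a _.
by rewrite -mulrA st0 linear0 !mulr0 mul0r.
Qed.

Lemma nf_star x xa z w a0 :
  nf x xa z w * st a0 =
  nf 0 (fun a => if a == a0 then x else 0) (fun=> 0)
     (fun b a => if a == a0 then z b else 0).
Proof.
have st0 a : st a * st a0 = 0.
  by apply: arrow_arrow0; rewrite tgt_star src_star eq_sym.
rewrite /nf !mulrDl linear0 add0r !mulr_suml.
rewrite [X in _ + X + _ + _]big1 => [|a _]; last by rewrite -mulrA st0 mulr0.
rewrite [X in _ + X = _]big1 => [|b _]; last first.
  by rewrite mulr_suml big1 // => a _; rewrite -mulrA st0 mulr0.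
rewrite !addr0; congr (_ + _).
  rewrite [X in _ + X]big1 ?addr0 => [|b _]; last by rewrite mulr0.
  rewrite (bigD1 a0) //= eqxx big1 ?addr0 // => a /negbTE ->.
  by rewrite linear0 mul0r.
apply: eq_bigr => b _; rewrite (bigD1 a0) //= eqxx big1 ?addr0 // => a /negbTE ->.
by rewrite linear0 mulr0 mul0r.
Qed.

Lemma nf_bst x xa z w b0 :
  IY (nf x xa z w * bs b0 -
      nf (- \sum_a xa a * D b0 a) (fun=> 0)
         (fun b => (b == b0)%:R * (coef x k [::] *: (1 : cpa K Q)) - \sum_a w b a * D b0 a)
         (fun _ _ => 0)).
Proof.
have bs0 b : bs b * bs b0 = 0.
  by apply: arrow_arrow0; rewrite tgt_bst src_bst.
have -> : nf x xa z w * bs b0 = coef x k [::] *: bs b0 +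
    \sum_a com (xa a) * (st a * bs b0) +
    \sum_b \sum_a bs b * com (w b a) * (st a * bs b0).
  rewrite /nf !mulrDl !mulr_suml com_bs.
  rewrite [X in _ + X + _]big1 ?addr0 => [|b _]; last first.
    by rewrite -mulrA com_bs -cpa_scalerAr bs0 scaler0.
  congr (_ + _ + _); first by apply: eq_bigr => a _; rewrite mulrA.
  by apply: eq_bigr => b _; rewrite mulr_suml; apply: eq_bigr => a _; rewrite mulrA.
have -> : nf (- \sum_a xa a * D b0 a) (fun=> 0)
         (fun b => (b == b0)%:R * (coef x k [::] *: (1 : cpa K Q)) - \sum_a w b a * D b0 a)
         (fun _ _ => 0) = coef x k [::] *: bs b0 +
    \sum_a com (xa a) * - com (D b0 a) +
    \sum_b \sum_a bs b * com (w b a) * - com (D b0 a).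
  rewrite /nf [X in _ + X + _ + _]big1 => [|a _]; last by rewrite linear0 mul0r.
  rewrite [X in _ + X = _]big1 => [|b _]; last first.
    by rewrite big1 // => a _; rewrite linear0 mulr0 mul0r.
  have -> : com (- \sum_a xa a * D b0 a) = \sum_a com (xa a) * - com (D b0 a).
    rewrite linearN linear_sum -sumrN.
    by apply: eq_bigr => a _; rewrite rmorphM mulrN.
  have -> : \sum_b bs b * com ((b == b0)%:R * (coef x k [::] *: (1 : cpa K Q)) -
        \sum_a w b a * D b0 a) = coef x k [::] *: bs b0 +
      \sum_b \sum_a bs b * com (w b a) * - com (D b0 a).
    under eq_bigr => b _ do rewrite linearB mulrBr.
    rewrite sumrB -sumrN; congr (_ + _).
      rewrite (bigD1 b0) //= eqxx mul1r linearZ /= rmorph1 -cpa_scalerAr mulr1.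
      by rewrite big1 ?addr0 // => b /negbTE ->; rewrite mul0r linear0 mulr0.
    apply: eq_bigr => b _; rewrite linear_sum big_distrr /= -sumrN.
    by apply: eq_bigr => a _; rewrite rmorphM mulrN mulrA.
  by rewrite !addr0 addrCA addrA.
rewrite opprD addrACA; apply: idealD.
  rewrite opprD addrACA subrr add0r -sumrB; apply: ideal_sum => a _.
  by rewrite -mulrBr opprK; apply/idealMl/st_bs.
rewrite -sumrB; apply: ideal_sum => b _; rewrite -sumrB; apply: ideal_sum => a _.
by rewrite -mulrBr opprK; apply/idealMl/st_bs.
Qed.

Lemma normalM f y : normal f -> normal (f * arrow_elt K y).
Proof.
move=> [x [xa [z [w Hf]]]].
apply: (@normal_congr _ (nf x xa z w * arrow_elt K y)).
  by rewrite -mulrBl; apply: idealMr.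
case E: (kind y) => [x'|[a|b]].
- rewrite (nf_com _ _ _ _ E); exact: normal_nf.
- have -> : y = star a by apply: kind_inj; rewrite E starK.
  by rewrite nf_star; exact: normal_nf.
have -> : y = bst b by apply: kind_inj; rewrite E bstK.
by do 4 eexists; apply: nf_bst.
Qed.

Lemma normal_path v l : walk v l -> normal (path_elt K v l).
Proof.
elim/last_ind: l => [|l y IH] vl.
  by have := normal_com (e v); rewrite subst_vertex.
have := vl; rewrite -cats1 walk_cat => /andP[vl' /= /andP[/eqP sy _]].
have -> : path_elt K v (l ++ [:: y]) = path_elt K v l * arrow_elt K y.
  by rewrite path_eltM // sy eqxx.
exact/normalM/IH.
Qed.

Lemma path_word v l : walk v l ->
  path_elt K v l = vertex_elt K v * \prod_(y <- l) arrow_elt K (y : Y).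
Proof.
elim/last_ind: l => [|l y IH] vl; first by rewrite big_nil mulr1.
have := vl; rewrite -cats1 walk_cat => /andP[vl' /= /andP[/eqP sy _]].
rewrite big_cat big_seq1 mulrA -IH // path_eltM // sy eqxx.
by [].
Qed.

(** The quotient itself is a representation as in [long_words]. *)
Lemma rad_IY : exists M, forall f, inrad M f -> IY f.
Proof.
have [N IN] := nilpotent_I; exists N.*2.+2 => f Hf.
apply: IY_closed => m; exists (\sum_(p <- paths_lt Y m) f p *: basis K p);
  last exact: trunc_congr.
apply: ideal_sum => p _; have [ltp|lep] := ltnP (plen p) N.*2.+2.
  by rewrite -coefE Hf // scale0r; apply: ideal0.
apply/idealZ/quot_pi0P; rewrite path_word; last exact: (valP p).
rewrite rmorphM rmorph_prod.
pose psi : {rmorphism cpa K Q -> quot_alg (A := cpa_alg K Y) IY} := piY \o com.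
have long := @long_words (quot_alg (A := cpa_alg K Y) IY) psi
  (fun a => piY (st a)) (fun b => piY (bs b)).
rewrite (_ : \prod_(y <- _) _ = 0) ?mulr0 //.
rewrite -[RHS](long _ _ _ _ _ _ N IN (pword p) lep) => {long}.
- apply: eq_bigr => y _; rewrite /rep; case E: (kind y) => [x|[a|b]].
  + by rewrite /psi /= (subst_common_arrow E).
  + by congr (piY (arrow_elt K _)); apply: kind_inj; rewrite starK.
  + by congr (piY (arrow_elt K _)); apply: kind_inj; rewrite bstK.
- by move=> g Ig; apply/quot_pi0P/com_I.
- by move=> a; rewrite /psi /= -rmorphM subst_vertex -(src_star a) src_arrow.
- by move=> a; rewrite /psi /= -rmorphM subst_vertex -(tgt_star a) arrow_tgt.
- by move=> b; rewrite /psi /= -rmorphM subst_vertex -(src_bst b) src_arrow.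
- by move=> b; rewrite /psi /= -rmorphM subst_vertex -(tgt_bst b) arrow_tgt.
- move=> a b; rewrite /psi /= -rmorphM -rmorphN; apply/quot_piP.
  by rewrite opprK; apply: st_bs.
Qed.

Lemma normal_all f : normal f.
Proof.
have [M IM] := rad_IY; apply: (@cpa_ind _ _ _ normal M).
- by have := normal_com 0; rewrite linear0.
- by move=> g h Ng; rewrite -[g]scale1r; apply: normal_linear.
- move=> p _; rewrite -[_ *: _]addr0; apply: normal_linear; last first.
    by have := normal_com 0; rewrite linear0.
  exact/normal_path/(valP p).
by move=> g h gh; apply/normal_congr/IM.
Qed.

(** ** The endomorphism algebra of the tilting module *)

Section Endomorphisms.
Variables (T : lmodType (quot_alg (A := cpa_alg K Q) I)) (t : T) (n : O -> T).
Variable a0 : O.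

Local Notation act f m := (pi f *: (m : T)).
Local Notation ep := (1 - e k).

Hypothesis t_eps : act ep t = t.
Hypothesis n_eta : forall a, act (e (tgt (o a))) (n a) = n a.
Hypothesis rho_n : \sum_a act (arr a) (n a) = 0.
Hypothesis tn_gen : forall m, exists (x : cpa K Q) (xa : O -> cpa K Q),
  m = act x t + \sum_a act (xa a) (n a).
Hypothesis tn_rel : forall (x : cpa K Q) (xa : O -> cpa K Q),
  act x t + \sum_a act (xa a) (n a) = 0 ->
  I (x * ep) /\ exists y, forall a, I (xa a * e (tgt (o a)) - y * arr a).

Lemma actD f g m : act (f + g) m = act f m + act g m.
Proof. by rewrite rmorphD scalerDl. Qed.
Lemma actB f g m : act (f - g) m = act f m - act g m.
Proof. by rewrite rmorphB scalerBl. Qed.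
Lemma actM f g m : act (f * g) m = act f (act g m).
Proof. by rewrite rmorphM scalerA. Qed.
Lemma act_sum (X : finType) (F : X -> cpa K Q) m :
  act (\sum_i F i) m = \sum_i act (F i) m.
Proof. by rewrite rmorph_sum scaler_suml. Qed.
Lemma actI f m : I f -> act f m = 0.
Proof. by move/quot_pi0P => ->; rewrite scale0r. Qed.
Lemma act_surj (u : quot_ring I) m : u *: (m : T) = act (quot_repr u) m.
Proof. by rewrite quot_reprK. Qed.
Lemma act_congr f g m : I (f - g) -> act f m = act g m.
Proof. by move=> Ifg; congr (_ *: _); apply/quot_piP. Qed.

Lemma e_ep v : v != k -> e v * ep = e v.
Proof. by move=> nv; rewrite mulrBr mulr1 vertex_eltM (negbTE nv) scale0r subr0. Qed.
Lemma ep_e v : v != k -> ep * e v = e v.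
Proof.
by move=> nv; rewrite mulrBl mul1r vertex_eltM eq_sym (negbTE nv) scale0r subr0.
Qed.
Lemma ep_k : ep * e k = 0.
Proof. by rewrite mulrBl mul1r vertex_eltM eqxx scale1r subrr. Qed.
Lemma ep_ep : ep * ep = ep.
Proof. by rewrite mulrBr mulr1 ep_k subr0. Qed.
Lemma ep_f_k f : ep * f * e k = 0.
Proof. by rewrite -mulrA end_source -cpa_scalerAr ep_k scaler0. Qed.

Lemma ep_n a : act ep (n a) = n a.
Proof. by rewrite -n_eta -actM ep_e // source. Qed.

Lemma endo_ext (f g : endo T) : f t = g t -> (forall a, f (n a) = g (n a)) -> f = g.
Proof.
move=> ft fn; apply: endo_eq => m; have [x [xa ->]] := tn_gen m.
rewrite !linearD !linear_sum !linearZ /= ft; congr (_ + _).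
by apply: eq_bigr => a _; rewrite !linearZ /= fn.
Qed.

(** A formula on the generators is well defined as soon as it respects the
    relations in [tn_rel]. *)
Lemma endo_exists (t' : T) (n' : O -> T) : act ep t' = t' ->
  (forall a, act (e (tgt (o a))) (n' a) = n' a) -> \sum_a act (arr a) (n' a) = 0 ->
  exists f : endo T, f t = t' /\ forall a, f (n a) = n' a.
Proof.
move=> t'e n'e rn'.
pose val' (x : cpa K Q) (xa : O -> cpa K Q) := act x t' + \sum_a act (xa a) (n' a).
have wd x xa : act x t + \sum_a act (xa a) (n a) = 0 -> val' x xa = 0.
  move=> /tn_rel[xI [y yI]]; rewrite /val' -t'e -actM actI // add0r.
  under eq_bigr => a _ do rewrite -n'e -actM (act_congr _ (yI a)) actM.
  by rewrite -scaler_sumr rn' scaler0.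
have wd2 x xa x' xa' : act x t + \sum_a act (xa a) (n a) =
    act x' t + \sum_a act (xa' a) (n a) -> val' x xa = val' x' xa'.
  move=> E; apply/eqP; rewrite -subr_eq0 /val' opprD addrACA -actB -sumrB.
  under eq_bigr => a _ do rewrite -actB.
  apply/eqP/(wd (x - x') (fun a => xa a - xa' a)).
  under eq_bigr => a _ do rewrite actB.
  by rewrite actB sumrB addrACA -opprD E subrr.
have /choice[c cE] m : exists p : cpa K Q * (O -> cpa K Q),
    m = act p.1 t + \sum_a act (p.2 a) (n a).
  by have [x [xa E]] := tn_gen m; exists (x, xa).
pose F m := val' (c m).1 (c m).2.
have FE x xa : F (act x t + \sum_a act (xa a) (n a)) = val' x xa.
  by apply: wd2; rewrite -cE.
have FL : linear F.
  move=> u m m'; rewrite {1}(cE m) {1}(cE m').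
  pose x := quot_repr u.
  have uE (m0 : T) : u *: m0 = act x m0 by apply: act_surj.
  rewrite uE scalerDr -actM scaler_sumr addrACA -actD -big_split /=.
  under eq_bigr => a _ do rewrite -actM -actD.
  rewrite (FE _ (fun a => x * (c m).2 a + (c m').2 a)) /F /val' uE scalerDr -!actM.
  rewrite scaler_sumr [RHS]addrACA -actD -big_split; congr (_ + _).
  by apply: eq_bigr => a _; rewrite actD actM.
pose FA := GRing.isLinear.Build _ T T *:%R F FL.
pose FM : {linear T -> T} := HB.pack F FA.
have one (m : T) : act 1 m = m by rewrite rmorph1 scale1r.
exists (endo_of FM); split=> [|a] /=.
  have := FE 1 (fun=> 0); rewrite /val' !big1 ?addr0 ?one //.
  - by move=> a _; rewrite rmorph0 scale0r.
  - by move=> a _; rewrite rmorph0 scale0r.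
have sumE (G : O -> T) : \sum_b act (b == a)%:R (G b) = G a.
  rewrite (bigD1 a) //= eqxx one big1 ?addr0 // => b /negbTE ->.
  by rewrite rmorph0 scale0r.
by have := FE 0 (fun b => (b == a)%:R); rewrite /val' !sumE rmorph0 !scale0r !add0r.
Qed.

Local Notation E := (endo_alg T).

Lemma endo_sum (X : Type) (l : seq X) (F : X -> endo T) m :
  (\sum_(i <- l) F i) m = \sum_(i <- l) F i m.
Proof. by elim/big_rec2: _ => // i u v _ <-. Qed.

Lemma act_scal_comm c f m : act (cpa_scal c) (act f m) = act f (act (cpa_scal c) m).
Proof. by rewrite -!actM cpa_central. Qed.

Lemma endo_act (f : endo T) x m : f (act x m) = act x (f m).
Proof. by rewrite linearZ. Qed.

Lemma coef_scal (c : K) v : coef (cpa_scal c : cpa K Q) v [::] = c.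
Proof. by rewrite /cpa_scal coefZ coef1 mulr1. Qed.

Lemma endo_scalE c m : (kalg_scal E c : endo T) m = act (cpa_scal c) m.
Proof. by []. Qed.

Lemma act0 m : act 0 m = 0. Proof. by rewrite rmorph0 scale0r. Qed.
Lemma act1 m : act 1 m = m. Proof. by rewrite rmorph1 scale1r. Qed.

(** The generator [t] spans a copy of the left ideal of [ep], whose endomorphisms
    are right multiplications; on the [n a] only the scalar of the trivial path
    at [k] is left. *)
Lemma psi_exists : exists psi : {rmorphism cpa K Q -> E},
  (forall f, (psi f : endo T) t = act (ep * f) t) /\
  (forall f a, (psi f : endo T) (n a) = act (cpa_scal (coef f k [::])) (n a)).
Proof.
have /choice[p pE] f : exists g : endo T, g t = act (ep * f) t /\
    forall a, g (n a) = act (cpa_scal (coef f k [::])) (n a).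
  apply: endo_exists => [|a|].
  - by rewrite -actM mulrA ep_ep.
  - by rewrite -act_scal_comm n_eta.
  under eq_bigr => a _ do rewrite -act_scal_comm.
  by rewrite -scaler_sumr rho_n scaler0.
have pz : zmod_morphism (p : cpa K Q -> E).
  move=> f g; apply: endo_ext => [|a] /=.
    by rewrite !(pE _).1 mulrBr actB.
  by rewrite !(pE _).2 coefB raddfB actB.
have pm : monoid_morphism (p : cpa K Q -> E).
  split=> [|f g]; apply: endo_ext => [|a] /=.
  - by rewrite (pE _).1 mulr1.
  - by rewrite (pE _).2 coef1 rmorph1 act1.
  - rewrite !(pE _).1 endo_act (pE _).1 -actM; congr (pi _ *: _).
    by rewrite [RHS]mulrA mulrBr [in RHS]mulr1 ep_f_k subr0 mulrA.
  rewrite !(pE _).2 endo_act (pE _).2 -actM coefM_nil; congr (pi _ *: _).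
  by rewrite rmorphM.
pose pA := GRing.isZmodMorphism.Build _ E p pz.
pose pB := GRing.isMonoidMorphism.Build _ E p pm.
pose pr : {rmorphism cpa K Q -> E} := HB.pack (p : cpa K Q -> E) pA pB.
by exists pr; split=> [f|f a]; [apply: (pE f).1|apply: (pE f).2].
Qed.

Lemma D_ep b a : D b a * ep = D b a.
Proof. by rewrite -{1}D_tgt -mulrA e_ep // D_tgt. Qed.

Lemma ep_D b a : ep * D b a = D b a.
Proof. by rewrite -D_src mulrA ep_e // source. Qed.

Lemma ep_arr a : ep * arr a = 0.
Proof. by rewrite -out_arr mulrA ep_k mul0r. Qed.

Lemma coef_k_arr a : coef (arr a) k [::] = 0.
Proof. by rewrite coef_path xpair_eqE !andbF. Qed.

(** The arrow to [k] labelled [a] acts by [t |-> n a], and the arrow from [k]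
    labelled [b] acts by [n a |-> - D b a t], which is compatible with the
    relation of the [n a] because [r b] is zero in the algebra.  First the one,
    then the other sends [t] to [- D b a t], as the relations of [Y] demand. *)
Lemma Phi_exists : exists Phi : {rmorphism cpa K Y -> E},
  [/\ forall c, Phi (cpa_scal c) = kalg_scal E c,
      forall f, IY f -> Phi f = 0,
      forall x xa z w, (Phi (nf x xa z w) : endo T) t =
        act (ep * x) t + \sum_a act (ep * xa a) (n a)
    & forall x xa z w a', (Phi (nf x xa z w) : endo T) (n a') =
        act (cpa_scal (coef x k [::])) (n a') -
        \sum_b act (D b a' * z b) t - \sum_b \sum_a act (D b a' * w b a) (n a)].
Proof.
have [psi [psit psin]] := psi_exists.
have /choice[al alE] a : exists g : endo T, g t = n a /\ forall a', g (n a') = 0.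
  apply: endo_exists => [|a'|]; first exact: ep_n.
    exact: scaler0.
  by apply: big1 => a' _; apply: scaler0.
have /choice[be beE] b : exists g : endo T, g t = 0 /\
    forall a', g (n a') = - act (D b a') t.
  apply: endo_exists => [|a'|]; first exact: scaler0.
    by rewrite scalerN -actM D_src.
  under eq_bigr => a' _ do rewrite scalerN -actM.
  rewrite sumrN -act_sum -r_decomp actI ?oppr0 //.
  by apply/IE/mem_closed_ideal; right; exists b.
have [N IN] := nilpotent_I.
have [] := @rep_lift E psi (fun a => al a) (fun b => be b) _ _ _ _ _ _ N IN.
- move=> f If; apply: endo_ext => [|a] /=.
    by rewrite psit actI //; apply: idealMl.
  by rewrite psin (I_rad If) // rmorph0 act0.
- move=> a; apply: endo_ext => [|a'] /=.
    by rewrite psit endo_act (alE _).1 ep_e ?source // n_eta.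
  by rewrite psin endo_act !(alE _).2 scaler0.
- move=> a; apply: endo_ext => [|a'] /=.
    by rewrite (alE _).1 psin coef_path eqxx rmorph1 act1.
  by rewrite (alE _).2 linear0.
- move=> b; apply: endo_ext => [|a] /=.
    by rewrite psit endo_act (beE _).1 scaler0.
  by rewrite psin endo_act coef_path eqxx rmorph1 act1.
- move=> b; apply: endo_ext => [|a] /=.
    by rewrite (beE _).1 linear0.
  by rewrite (beE _).2 linearN /= endo_act psit -actM ep_e // D_tgt.
- move=> a b; apply: endo_ext => [|a'] /=.
    by rewrite (alE _).1 (beE _).2 psit ep_D.
  by rewrite (alE _).2 linear0 psin D_rad // rmorph0 act0 oppr0.
- move=> c; apply: endo_ext => [|a]; rewrite endo_scalE.
    by rewrite psit -cpa_central actM t_eps.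
  by rewrite psin coef_scal.
- move=> a; apply: endo_ext => [|a'] /=.
    by rewrite psit ep_arr act0.
  by rewrite psin coef_k_arr rmorph0 act0.
move=> Phi [PhiZ PhiM Phic Phis Phib].
have PhiE x xa z w : Phi (nf x xa z w) = psi x + \sum_a psi (xa a) * (al a : E) +
    \sum_b (be b : E) * psi (z b) + \sum_b \sum_a (be b : E) * psi (w b a) * (al a : E).
  rewrite /nf !rmorphD !rmorph_sum Phic; congr (_ + _ + _ + _).
  - by apply: eq_bigr => a _; rewrite rmorphM Phic Phis.
  - by apply: eq_bigr => b _; rewrite rmorphM Phic Phib.
  apply: eq_bigr => b _; rewrite rmorph_sum; apply: eq_bigr => a _.
  by rewrite !rmorphM Phic Phis Phib.
exists Phi; split=> //.
  apply: IY_min.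
  + exact: rmorph0.
  + by move=> f g Ef Eg; rewrite rmorphD Ef Eg addr0.
  + by move=> u f Ef; rewrite rmorphM Ef mulr0.
  + by move=> u f Ef; rewrite rmorphM Ef mul0r.
  + move=> _ [[g Sg ->]|[b [a ->]]].
      rewrite Phic; apply: endo_ext => [|a] /=.
        by rewrite psit actI //; apply/idealMl/IE/mem_closed_ideal; left.
      by rewrite psin S_rad // rmorph0 act0.
    rewrite rmorphD rmorphM Phic Phis Phib; apply: endo_ext => [|a'] /=.
      by rewrite psit ep_D (alE _).1 (beE _).2 subrr.
    by rewrite psin D_rad // rmorph0 act0 (alE _).2 linear0 addr0.
  + move=> f Hf; have [g Eg fg] := Hf N.*2.+2.
    by rewrite -(subrK g f) rmorphD Eg addr0 PhiM.
- move=> x xa z w; rewrite PhiE /= !endo_sum psit.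
  rewrite [X in _ + X + _]big1 => [|b _]; last by rewrite /= (beE _).1 linear0.
  rewrite [X in _ + X = _]big1 => [|b _]; last first.
    by rewrite endo_sum big1 // => a _; rewrite /= (beE _).1 !linear0.
  rewrite !addr0; congr (_ + _); apply: eq_bigr => a _.
  by rewrite /= psit endo_act (alE _).1.
move=> x xa z w a'; rewrite PhiE /= !endo_sum psin.
rewrite [X in _ + X + _ + _]big1 => [|a _]; last by rewrite /= psin endo_act (alE _).2 scaler0.
rewrite addr0 -!sumrN; congr (_ + _ + _).
  apply: eq_bigr => b _; rewrite /= (beE _).2 linearN /= endo_act psit -actM.
  by rewrite mulrA D_ep.
apply: eq_bigr => b _; rewrite endo_sum -sumrN; apply: eq_bigr => a _ /=.
by rewrite (beE _).2 linearN /= endo_act psit linearN /= !endo_act (alE _).1 -actM mulrA D_ep.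
Qed.

Lemma com_ep f : com (f * ep) = com f - coef f k [::] *: vertex_elt K k.
Proof.
by rewrite mulrBr mulr1 linearB end_source linearZ /= subst_vertex.
Qed.

Lemma com_ep_ep x : coef x k [::] = 0 -> com x = com (ep * x * ep).
Proof.
move=> xk; rewrite com_ep coefM_nil xk mulr0 scale0r subr0 mulrBl mul1r.
by rewrite linearB /= common_source xk scale0r subr0.
Qed.

Lemma com_st f a : com f * st a = com (ep * f * e (tgt (o a))) * st a.
Proof.
have kst : vertex_elt K k * st a = 0.
  rewrite -(src_arrow K (star a)) mulrA vertex_eltM src_star eq_sym.
  by rewrite (negbTE (source _)) scale0r mul0r.
rewrite rmorphM /= subst_vertex -mulrA -(src_star a) src_arrow.
rewrite mulrBl mul1r linearB /= common_source mulrBl -cpa_scalerAl kst.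
by rewrite scaler0 subr0.
Qed.

Lemma bs_com f b : bs b * com f = bs b * com (e (s b) * f * ep).
Proof.
have bE : bs b * vertex_elt K (s b) = bs b by rewrite -(tgt_bst b) arrow_tgt.
have bsk : bs b * vertex_elt K k = 0.
  by rewrite -bE -mulrA vertex_eltM (negbTE (s_neq b)) scale0r mulr0.
rewrite com_ep mulrBr -cpa_scalerAr bsk scaler0 subr0.
by rewrite rmorphM /= subst_vertex mulrA bE.
Qed.

(** The hypotheses are the values at [t] and at the [n a'] of the endomorphism
    given by the normal form.  The relations of [T] turn them into relations in
    the algebra: for [x] and [xa] these are the claim, and for [z] and [w] they
    say that columns lie in the kernel of [D], so that [D_independent] applies. *)
Lemma nf_kernel x xa z w :
  act (ep * x) t + \sum_a act (ep * xa a) (n a) = 0 ->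
  (forall a', act (cpa_scal (coef x k [::])) (n a') -
     \sum_b act (D b a' * z b) t -
     \sum_b \sum_a act (D b a' * w b a) (n a) = 0) ->
  IY (nf x xa z w).
Proof.
move=> /tn_rel[xI [y yI]] nE.
have nrel a' : (I (- (\sum_b D b a' * z b) * ep)) /\ exists y', forall a,
    I (((a == a')%:R *: cpa_scal (coef x k [::]) - \sum_b D b a' * w b a : cpa K Q) *
       e (tgt (o a)) - y' * arr a).
  apply: (@tn_rel (- \sum_b D b a' * z b)
    (fun a => (a == a')%:R *: cpa_scal (coef x k [::]) - \sum_b D b a' * w b a : cpa K Q)).
  rewrite -[RHS](nE a') rmorphN scaleNr act_sum.
  under [X in _ + X = _]eq_bigr => a _ do rewrite actB act_sum.
  rewrite sumrB [\sum_a \sum_b _]exchange_big /= addrCA addrA; congr (_ - _ - _).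
  rewrite (bigD1 a') //= eqxx scale1r big1 ?addr0 // => a /negbTE ->.
  by rewrite scale0r act0.
have kill f a' a : e (tgt (o a')) * f * arr a = 0.
  rewrite -out_arr mulrA -[_ * f * e k]mulrA end_source -cpa_scalerAr vertex_eltM.
  by rewrite (negbTE (source _)) scale0r scaler0 mul0r.
have diag a' a : I ((a == a')%:R * coef x k [::] *: e (tgt (o a)) -
    \sum_b D b a' * (w b a * e (tgt (o a)))).
  have [y' /(_ a) Iy'] := (nrel a').2.
  have := idealMl (e (tgt (o a'))) Iy'; rewrite mulrBr [_ * (y' * _)]mulrA kill subr0.
  congr (I _); rewrite mulrBl mulrBr; congr (_ - _).
    case: (a =P a') => [->|_]; last by rewrite !scale0r mul0r mulr0 mul0r scale0r.
    by rewrite scale1r mul1r -scale_cpa_scal -cpa_scalerAr vertex_eltM eqxx scale1r.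
  rewrite mulr_suml mulr_sumr; apply: eq_bigr => b _.
  by rewrite !mulrA D_src.
(* The idempotent of [k] acts on [n a0] as the identity, so its coefficient can
   be read off there. *)
have xk : coef x k [::] = 0.
  have := I_rad (diag a0 a0) (tgt (o a0)) (isT : (size [::] < 1)%N).
  rewrite eqxx mul1r coefB coefZ coef_path eqxx mulr1 coef_sum big1 ?subr0 // => b _.
  by rewrite coefM_nil D_rad // mul0r.
have zI b : I (e (s b) * (z b * ep)).
  apply: (D_independent (z := fun b => z b * ep)) => a.
  under eq_bigr => b' _ do rewrite mulrA.
  by rewrite -mulr_suml -[_ * _]opprK -mulNr; apply/idealN/(nrel a).1.
have wI b a : I (e (s b) * (w b a * e (tgt (o a)))).
  apply: (D_independent (z := fun b => w b a * e (tgt (o a)))) => a'.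
  have := diag a' a; rewrite xk mulr0 scale0r sub0r => /idealN.
  by rewrite opprK.
rewrite /nf; apply: idealD; [apply: idealD; [apply: idealD|]|].
- by rewrite com_ep_ep //; apply/com_I.
- apply: ideal_sum => a _; rewrite com_st; apply/idealMr/com_I.
  have := idealMl ep (yI a); rewrite mulrBr !mulrA ep_ep => H.
  move: H; rewrite -[_ * arr a](_ : 0 = _) ?subr0 //.
  by rewrite -out_arr mulrA ep_f_k mul0r.
- apply: ideal_sum => b _; rewrite bs_com; apply/idealMl/com_I.
  by rewrite -mulrA.
apply: ideal_sum => b _; apply: ideal_sum => a _.
rewrite -mulrA com_st mulrA bs_com; apply/idealMr/idealMl/com_I.
rewrite !mulrA -[_ * e (tgt (o a)) * ep]mulrA !e_ep ?source // -mulrA; exact: wI.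
Qed.

(** The images of the [n a] satisfy the relation of the [n a], so that their
    coordinates, multiplied by the arrows [o a], give elements of [I] starting
    at [k], up to [mu] times that relation; [sum_arr_I] writes them in terms
    of [D]. *)
Lemma Phi_surj (f : endo T) : exists x xa z w,
  f t = act (ep * x) t + \sum_a act (ep * xa a) (n a) /\
  forall a', f (n a') = act (cpa_scal (coef x k [::])) (n a') -
     \sum_b act (D b a' * z b) t -
     \sum_b \sum_a act (D b a' * w b a) (n a).
Proof.
have [x [xa ftE]] := tn_gen (f t).
have /choice[y0 yE] a : exists p : cpa K Q * (O -> cpa K Q),
    f (n a) = act p.1 t + \sum_c act (p.2 c) (n c).
  by have [u [v E]] := tn_gen (f (n a)); exists (u, v).
pose y a := (y0 a).1; pose yy a := (y0 a).2.
have [yI [y' yyI]] : I ((\sum_a arr a * y a) * ep) /\ exists y', forall c,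
    I ((\sum_a arr a * yy a c) * e (tgt (o c)) - y' * arr c).
  apply: (@tn_rel (\sum_a arr a * y a) (fun c => \sum_a arr a * yy a c)).
  have := linear_sum f (index_enum O) xpredT (fun a => act (arr a) (n a)).
  rewrite rho_n linear0 => /esym E0; rewrite -[RHS]E0.
  under [in RHS]eq_bigr => a _ do
    rewrite /= endo_act yE scalerDr scaler_sumr -actM.
  rewrite big_split /= act_sum; congr (_ + _).
  rewrite exchange_big /=; apply: eq_bigr => c _; rewrite act_sum.
  by apply: eq_bigr => a _; rewrite actM.
pose mu := coef y' k [::].
have [z zI] : exists z, forall a, I (e (tgt (o a)) * (y a * ep) - \sum_b D b a * z b).
  apply: sum_arr_I; rewrite (_ : \sum_a _ = (\sum_a arr a * y a) * ep) //.
  by rewrite mulr_suml; apply: eq_bigr => a _; rewrite mulrA.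
pose u c a : cpa K Q := yy a c * e (tgt (o c)) - (a == c)%:R *: (mu *: e (tgt (o c))).
have /choice[w wI] c : exists w, forall a, I (e (tgt (o a)) * u c a - \sum_b D b a * w b).
  apply: sum_arr_I.
  rewrite (_ : \sum_a _ = e k * ((\sum_a arr a * yy a c) * e (tgt (o c)) - y' * arr c)).
    exact: idealMl.
  rewrite mulrBr; under eq_bigr => a _ do rewrite mulrBr -cpa_scalerAr -cpa_scalerAr.
  rewrite sumrB; congr (_ - _).
    rewrite mulr_suml mulr_sumr; apply: eq_bigr => a _.
    by rewrite !mulrA out_arr.
  rewrite (bigD1 c) //= eqxx scale1r big1 ?addr0 => [|a /negbTE ->]; last by rewrite scale0r.
  rewrite arrow_tgt -[in RHS]out_arr !mulrA -[e k * y' * e k]mulrA end_source.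
  by rewrite -cpa_scalerAr vertex_eltM eqxx scale1r -cpa_scalerAl out_arr.
exists (ep * x * ep + mu *: e k), xa, (fun b => - z b), (fun b c => - w c b).
have epk : coef (ep : cpa K Q) k [::] = 0.
  by rewrite coefB coef1 coef_path eqxx subrr.
split.
  rewrite -[t in LHS]t_eps endo_act ftE scalerDr -actM scaler_sumr; congr (_ + _).
    by rewrite mulrDr -cpa_scalerAr ep_k scaler0 addr0 !mulrA ep_ep [RHS]actM t_eps.
  by apply: eq_bigr => a _; rewrite actM.
move=> a'.
have -> : coef (ep * x * ep + mu *: e k) k [::] = mu.
  by rewrite coefD !coefM_nil epk !mul0r add0r coefZ coef_path eqxx mulr1.
rewrite -[n a' in LHS]n_eta endo_act yE scalerDr -actM scaler_sumr.
rewrite -{1}t_eps -actM -mulrA (act_congr _ (zI a')) act_sum.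
rewrite -sumrN -addrA addrCA; congr (_ + _).
  by apply: eq_bigr => b _; rewrite mulrN rmorphN scaleNr opprK.
rewrite exchange_big /= -sumrN.
under eq_bigr => c _ do rewrite -actM.
have step c : act (e (tgt (o a')) * (y0 a').2 c) (n c) =
    act ((a' == c)%:R *: cpa_scal mu) (n c) - \sum_b act (D b a' * - w c b) (n c).
  have -> : \sum_b act (D b a' * - w c b) (n c) =
      - act (e (tgt (o a')) * u c a') (n c).
    rewrite (act_congr _ (wI c a')) act_sum -sumrN; apply: eq_bigr => b _.
    by rewrite mulrN rmorphN scaleNr.
  rewrite opprK /u -/(yy a' c) mulrBr actB mulrA [act (_ * _ * e _) _]actM n_eta.
  rewrite [X in _ = X + _](_ : _ = act (e (tgt (o a')) *
    ((a' == c)%:R *: (mu *: e (tgt (o c))))) (n c)); first by rewrite addrC subrK.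
  case: (a' =P c) => [->|_]; last by rewrite !scale0r mulr0.
  by rewrite !scale1r -cpa_scalerAr vertex_eltM eqxx scale1r scale_cpa_scal actM n_eta.
rewrite (eq_bigr _ (fun c _ => step c)) big_split; congr (_ + _).
rewrite (bigD1 a') //= eqxx scale1r big1 ?addr0 // => c.
by rewrite eq_sym => /negbTE ->; rewrite scale0r act0.
Qed.

Lemma endo_iso : alg_isomorphic E (quot_alg (A := cpa_alg K Y) IY).
Proof.
have [Phi [PhiZ PhiI Phit Phin]] := Phi_exists.
apply: alg_isomorphic_sym; apply: (@quot_iso K (cpa_alg K Y) E IY Phi) => // [f|f].
  have [x [xa [z [w [ft fn]]]]] := Phi_surj f.
  exists (nf x xa z w); apply: endo_ext => [|a].
    by rewrite Phit ft.
  by rewrite Phin fn.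
split=> [f0|]; last exact: PhiI.
have [x [xa [z [w fI]]]] := normal_all f.
have nf0 : Phi (nf x xa z w) = 0.
  have := PhiI _ fI; rewrite rmorphB f0 sub0r => /eqP.
  by rewrite oppr_eq0 => /eqP.
apply: (ideal_congr fI); apply: nf_kernel => [|a'].
  by rewrite -(Phit _ _ z w) nf0.
by rewrite -(Phin _ xa) nf0.
Qed.

End Endomorphisms.

Lemma endo_tilting (T : lmodType (quot_alg (A := cpa_alg K Q) I)) (a0 : O) :
  is_left_tilting_mutation (A := quot_alg (A := cpa_alg K Q) I)
    (fun i : V => pi (e i)) k T ->
  alg_isomorphic (endo_alg T) (quot_alg (A := cpa_alg K Y) IY).
Proof.
move=> [X [M [f [g [fapp fmin cok isoT]]]]].
set eps := \sum_(i | i != k) pi (e i) in fapp isoT.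
have epsE : eps = pi (1 - e k).
  rewrite /eps -rmorph_sum; congr (pi _).
  by rewrite -(vertex_sum K Q) [in RHS](bigD1 k) //= addrAC subrr add0r.
have [N JN] := Jn_nil.
have [] := @tilting_presentation _ (pi (e k)) eps O (fun a => pi (arr a))
  (fun a => pi (e (tgt (o a)))) Jn N _ _ _ _ _ _ _ Jn_all Jn0 (@JnD) (@JnMl) (@JnM1)
  JN _ T X M f g fapp fmin cok isoT.
- by rewrite -rmorphM vertex_eltM eqxx scale1r.
- by rewrite epsE -rmorphM ep_ep.
- by move=> a; rewrite -rmorphM vertex_eltM eqxx scale1r.
- by move=> a; rewrite epsE -rmorphM e_ep // source.
- by move=> a; rewrite -rmorphM out_arr.
- by move=> a; rewrite -rmorphM arrow_tgt.
- move=> y; pose h := e k * quot_repr y * (1 - e k).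
  have hk : e k * h = h by rewrite /h !mulrA vertex_eltM eqxx scale1r.
  have hr : inrad 1 h.
    apply/inrad1P => v; rewrite coefM_nil coef_vertexM coefB coef1 coef_path.
    rewrite xpair_eqE eqxx andbT; case: (v =P k) => _; last by rewrite !mul0r.
    by rewrite subrr mulr0.
  exists (fun a => pi (lquot (o a) h)).
  under eq_bigr => a _ do rewrite -rmorphM.
  by rewrite -rmorph_sum -arr_decomp // epsE !rmorphM /= quot_reprK.
- move=> y; have [y' yE] := pi_lift y.
  under eq_bigr => a _ do rewrite -yE -rmorphM.
  rewrite -rmorph_sum => /quot_pi0P/sum_arr_I[z zI] a.
  exists (\sum_b D b a * z b).
    by apply: inrad_sum => b _; apply/inradMr/D_rad.
  by rewrite -yE -rmorphM; apply/quot_piP.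
move=> t [n [te ne rn gen rel]].
apply: (endo_iso (t := t) (n := n) a0) => //.
- by rewrite -epsE.
- move=> m; have [x [xa ->]] := gen m.
  exists (quot_repr x), (fun a => quot_repr (xa a)); rewrite quot_reprK.
  by congr (_ + _); apply: eq_bigr => a _; rewrite quot_reprK.
move=> x xa /rel[x0 [y yE]]; split.
  by apply/quot_pi0P; rewrite rmorphM -x0 epsE.
exists (quot_repr y) => a; apply/quot_piP.
by rewrite !rmorphM /= quot_reprK yE.
Qed.

End Source.

(** * The potential of the mutated quiver *)

Section Triangle.
Variables (K : comPzRingType) (V : finType) (Q : quiver V).

Lemma cyclic_sum (I : Type) (r : seq I) (F : I -> cpa K Q) :
  (forall i p, F i p != 0 -> is_cycle p) ->
  forall p, (\sum_(i <- r) F i) p != 0 -> is_cycle p.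
Proof.
move=> Fc p; apply: contraR => nc; rewrite -coefE coef_sum big1 // => i _.
by rewrite coefE; apply/eqP; apply: contraR nc; apply: Fc.
Qed.

Lemma cyc_der_triangle (x y z c : Q) :
  tgt x = src y -> tgt y = src z -> tgt z = src x ->
  cyc_der c (arrow_elt K x * arrow_elt K y * arrow_elt K z) =
  (x == c)%:R *: (arrow_elt K y * arrow_elt K z) +
  (y == c)%:R *: (arrow_elt K z * arrow_elt K x) +
  (z == c)%:R *: (arrow_elt K x * arrow_elt K y).
Proof.
have side (x1 y1 z1 : Q) : tgt x1 = src y1 -> tgt y1 = src z1 -> tgt z1 = src x1 ->
    (x1 == c)%:R *: (vertex_elt K (tgt c) * (arrow_elt K y1 * arrow_elt K z1) *
      vertex_elt K (src c)) = (x1 == c)%:R *: (arrow_elt K y1 * arrow_elt K z1).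
  move=> xy yz zx; have [<-|_] := eqVneq x1 c; last by rewrite !scale0r.
  by rewrite !scale1r xy -zx mulrA src_arrow -mulrA arrow_tgt.
move=> xy yz zx; rewrite cyc_der_bil => [|p].
  by rewrite !cyc_bil_leibniz !mulr1 !mul1r !cyc_bil_arrow !side // mul1r side.
have -> : arrow_elt K x * arrow_elt K y * arrow_elt K z = path_elt K (src x) [:: x; y; z].
  rewrite /arrow_elt path_eltM /= ?eqxx // {1}/walk_end /= xy eqxx.
  by rewrite path_eltM /= ?eqxx ?xy ?eqxx // /walk_end /= yz eqxx.
rewrite /path_elt; case: (val p =P _) => [pE _|_ /eqP] //.
by rewrite /is_cycle /pend /pstart /pword pE /walk_end /= zx.
Qed.

Section Triangles.
Variables (I J : finType) (x : I -> J -> Q) (y : J -> Q) (z : I -> Q).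
Hypothesis xy : forall i j, tgt (x i j) = src (y j).
Hypothesis yz : forall i j, tgt (y j) = src (z i).
Hypothesis zx : forall i j, tgt (z i) = src (x i j).
Local Notation triangles := (\sum_i \sum_j
  arrow_elt K (x i j) * arrow_elt K (y j) * arrow_elt K (z i)).

Lemma cyc_der_triangles0 c : (forall i j, x i j != c) ->
  (forall j, y j != c) -> (forall i, z i != c) -> cyc_der c triangles = 0.
Proof.
move=> xc yc zc; rewrite linear_sum big1 // => i _; rewrite linear_sum big1 // => j _.
rewrite /= cyc_der_triangle // (negbTE (xc i j)) (negbTE (yc j)) (negbTE (zc i)).
by rewrite !scale0r !addr0.
Qed.

Lemma cyc_der_triangles i j : (forall i' j', x i' j' = x i j -> i' = i /\ j' = j) ->
  (forall j', y j' != x i j) -> (forall i', z i' != x i j) ->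
  cyc_der (x i j) triangles = arrow_elt K (y j) * arrow_elt K (z i).
Proof.
move=> xI yc zc; have E i' j' : cyc_der (x i j)
    (arrow_elt K (x i' j') * arrow_elt K (y j') * arrow_elt K (z i')) =
    ((i' == i) && (j' == j))%:R *: (arrow_elt K (y j') * arrow_elt K (z i')).
  rewrite cyc_der_triangle // (negbTE (yc j')) (negbTE (zc i')) !scale0r !addr0.
  congr (_%:R *: _); congr nat_of_bool.
  by apply/eqP/andP => [/xI[-> ->]|[/eqP-> /eqP->]].
rewrite linear_sum (bigD1 i) //= linear_sum (bigD1 j) //= E !eqxx scale1r.
rewrite big1 ?addr0 => [|j' /negbTE nj]; last by rewrite /= E nj andbF scale0r.
rewrite big1 ?addr0 // => i' /negbTE ni; rewrite linear_sum big1 // => j' _ /=.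
by rewrite E ni scale0r.
Qed.

End Triangles.

End Triangle.

Section Mutation.
Variables (K : fieldType) (V : finType) (Q : quiver V) (k : V).
Local Notation M := (mut_quiver Q k).
Local Notation com a := (inl (inl a) : M).
Local Notation comp b a := (inl (inr (b, a)) : M).
Local Notation star a := (inr (inl a) : M).
Local Notation bst b := (inr (inr b) : M).
Local Notation cubic := (@mut_cubic K V Q k).
Implicit Types (W : cpa K Q) (l : seq M).

(** The path of [Q] that a word of arrows [a] and [[ba]] abbreviates *)
Definition unbr l : seq Q := flatten (pmap (@unbracket V Q k) l).

Lemma unbr_cat l1 l2 : unbr (l1 ++ l2) = unbr l1 ++ unbr l2.
Proof. by rewrite /unbr pmap_cat flatten_cat. Qed.

Lemma walk_end_unbr v l : all (@unbracket V Q k) l ->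
  walk_end v (unbr l) = walk_end v l.
Proof.
rewrite /walk_end; elim: l v => //= -[[a|[b a]]|[a|b]] l IH v //= al;
by rewrite -IH.
Qed.

Lemma walk_unbr v l : all (@unbracket V Q k) l -> walk v (unbr l) = walk v l.
Proof.
elim: l v => //= -[[a|[b a]]|[a|b]] l IH v //= al; rewrite /unbr /= -/(unbr l) IH //.
by rewrite (eqP (valP a)) (eqP (valP b)) eqxx.
Qed.

Lemma coef_bracket W v l : coef (bracket (k := k) W) v l =
  if all (@unbracket V Q k) l then coef W v (unbr l) else 0.
Proof.
have [vl|nvl] := boolP (walk v l); first by rewrite coef_walk.
rewrite coef_nwalk //; case: ifP => // al.
by rewrite coef_nwalk // walk_unbr.
Qed.

Lemma bracket_cyclic W : (forall p, W p != 0 -> is_cycle p) ->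
  forall p, bracket (k := k) W p != 0 -> is_cycle p.
Proof.
move=> Wc p; rewrite -coefE coef_bracket; case: ifP => [pl|_]; last by rewrite eqxx.
apply: contraR => nc; apply/eqP/cyclic_coef => //.
by rewrite walk_end_unbr // eq_sym.
Qed.

Lemma bracket_homogeneous W (d : Q -> int) :
  homogeneous d 1 W -> homogeneous (mut_deg d : M -> int) 1 (bracket (k := k) W).
Proof.
move/homogeneousE => W1; apply/homogeneousE => v l; rewrite coef_bracket.
case: ifP => [al|_]; last by rewrite eqxx.
move/W1 => <-; rewrite /wdeg; elim: l al => [|x l IH] /=; first by rewrite !big_nil.
case/andP=> x1 /IH {}IH; rewrite big_cons IH.
case: x x1 => [[a|[b a]]|[a|b]] //= _; rewrite /unbr /= !big_cons //.
by rewrite addrA [d (val b) + _]addrC.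
Qed.

Definition cubic_term (b : in_arrow Q k) (a : out_arrow Q k) : cpa K M :=
  arrow_elt K (comp b a) * arrow_elt K (star a) * arrow_elt K (bst b).

Lemma cubic_termE b a :
  cubic_term b a = path_elt K (src (val b)) [:: comp b a; star a; bst b].
Proof.
rewrite /cubic_term !path_eltM /= ?eqxx //= /walk_end /= ?eqxx //.
by rewrite path_eltM /walk_end /= ?eqxx.
Qed.

Lemma cubic_cyclic b a p : cubic_term b a p != 0 -> is_cycle p.
Proof.
rewrite cubic_termE /path_elt; case: (val p =P _) => [pE _|_ /eqP/(_ erefl)] //.
by rewrite /is_cycle /pend /pstart /pword (pE : val p = _) /walk_end /=.
Qed.

Lemma mut_cubicE : cubic = \sum_b \sum_a cubic_term b a.
Proof. by []. Qed.

Lemma mut_cubic_cyclic p : cubic p != 0 -> is_cycle p.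
Proof.
rewrite mut_cubicE; apply: cyclic_sum => b {}p; apply: cyclic_sum => a {}p.
exact: cubic_cyclic.
Qed.

Lemma cubic_homogeneous (d : Q -> int) : homogeneous (mut_deg d : M -> int) 1 cubic.
Proof.
apply/homogeneousE => v l; apply: contraNeq => nl; rewrite mut_cubicE.
rewrite coef_sum big1 // => b _; rewrite coef_sum big1 // => a _.
rewrite cubic_termE coef_path xpair_eqE; case: (l =P _) => [lE|]; last by rewrite !andbF.
case/eqP: nl; rewrite lE /wdeg !big_cons big_nil /= addr0.
by rewrite addrACA subrr add0r addrA subrr add0r.
Qed.

Lemma cyc_der_mut_com a : cyc_der (com a) cubic = 0.
Proof.
rewrite mut_cubicE.
by apply: (@cyc_der_triangles0 _ _ M _ _ (fun b a => comp b a) (fun a => star a)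
  (fun b => bst b)).
Qed.

Lemma cyc_der_mut_comp b a : cyc_der (comp b a) cubic =
  arrow_elt K (star a) * arrow_elt K (bst b).
Proof.
rewrite mut_cubicE.
apply: (@cyc_der_triangles _ _ M _ _ (fun b a => comp b a) (fun a => star a) (fun b => bst b)) => //.
by move=> b1 a1 [-> ->].
Qed.

End Mutation.

(** * Mutation at a strict source *)

Lemma closed_ideal_sub (K : comPzRingType) (V : finType) (Q : quiver V)
    (S T : cpa K Q -> Prop) : (forall f, S f -> T f) ->
  forall f, closed_ideal S f -> closed_ideal T f.
Proof.
move=> ST; apply: closed_ideal_min => [|f /ST]; first exact: closed_ideal_closed.
exact: mem_closed_ideal.
Qed.

Lemma restr_arrow (K : comPzRingType) (V : finType) (Q : quiver V) (C : {set Q})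
    (y : cut_quiver C) : restr C (arrow_elt K (val y)) = arrow_elt K y.
Proof.
apply: cpaP => v l vl; rewrite coef_restr !coef_path vl.
have -> : walk v (map val l) = true.
  by move: vl; elim: l v => //= x l IH v /andP[-> /IH].
by rewrite !xpair_eqE -(inj_eq (inj_map val_inj)).
Qed.

Lemma homogeneousD (K : fieldType) (V : finType) (Q : quiver V) (d : Q -> int) n
    (f g : cpa K Q) :
  homogeneous d n f -> homogeneous d n g -> homogeneous d n (f + g).
Proof.
move=> Hf Hg p; rewrite cpaDE; have [->|/Hf //] := eqVneq (f p) 0.
by rewrite add0r; apply: Hg.
Qed.

Section StrictSource.
Variables (K : fieldType) (V : finType) (Q : quiver V).
Variables (W : cpa K Q) (C : {set Q}) (k : V).
Hypothesis Wred : is_reduced W.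
Hypothesis ksource : strict_source C k.
Hypothesis Wmin : minimal_cut_relations W C.

Local Notation QC := (cut_quiver C).
Local Notation O := (out_arrow Q k).
Local Notation B := (in_arrow Q k).

Lemma out_notin (a : O) : val a \notin C.
Proof. exact: (ksource (val a)).2 (eqP (valP a)). Qed.

Lemma in_in (b : B) : val b \in C.
Proof. exact: (ksource (val b)).1 (eqP (valP b)). Qed.

Definition cut_out (a : O) : QC := Sub (val a) (out_notin a).
Definition cut_in (b : B) : cpa K QC := cut_relation (C := C) W (val b).
Definition other_relation (f : cpa K QC) : Prop :=
  exists2 c, (c \in C) && (tgt c != k) & f = cut_relation (C := C) W c.

Lemma reduced_cyclic p : W p != 0 -> is_cycle p.
Proof. by case/Wred. Qed.

Lemma inrad_reduced : inrad 3 W.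
Proof.
move=> v l ltl; have [vl|nvl] := boolP (walk v l); last exact: coef_nwalk.
rewrite coef_walk; apply/eqP; apply: contraTT ltl => /Wred[_].
by rewrite -leqNgt.
Qed.

Lemma cut_relationE c : cut_relation (C := C) W c = restr C (cyc_der c W).
Proof. exact: cut_restrictE. Qed.

Lemma cut_relation_src c :
  vertex_elt K (tgt c) * cut_relation (C := C) W c = cut_relation (C := C) W c.
Proof.
rewrite cut_relationE -{1}(subst_vertex K (cut_pmap C)) -rmorphM cyc_der_src //.
exact: reduced_cyclic.
Qed.

Lemma cut_relation_tgt c :
  cut_relation (C := C) W c * vertex_elt K (src c) = cut_relation (C := C) W c.
Proof.
rewrite cut_relationE -{1}(subst_vertex K (cut_pmap C)) -rmorphM cyc_der_tgt //.
exact: reduced_cyclic.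
Qed.

Lemma inrad_cut_relation c : inrad 2 (cut_relation (C := C) W c).
Proof. by rewrite cut_relationE; apply/inrad_subst/inrad_cyc_der/inrad_reduced. Qed.

Lemma cut_source (x : QC) : tgt x != k.
Proof. by apply: contra (valP x) => /eqP; apply: (ksource (val x)).1. Qed.

Lemma cut_out_surj (x : QC) : src x = k -> exists a, x = cut_out a.
Proof.
move=> /eqP xk; exists (Sub (val x) xk : O).
by apply: val_inj.
Qed.

Lemma in_src_neq (b : B) : src (val b) != k.
Proof.
apply/eqP => /(ksource (val b)).2.
by rewrite in_in.
Qed.

Lemma other_relation_src f : other_relation f -> vertex_elt K k * f = 0.
Proof.
case=> c /andP[_ nk] ->; rewrite -cut_relation_src mulrA vertex_eltM.
by rewrite eq_sym (negbTE nk) scale0r mul0r.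
Qed.

Lemma cut_relationsE f :
  closed_ideal (fun f => exists2 c, c \in C & f = cut_relation (C := C) W c) f <->
  closed_ideal (relations cut_in other_relation) f.
Proof.
split; apply: closed_ideal_sub => {}f.
  case=> c cC ->; have [ck|nk] := eqVneq (tgt c) k; last first.
    by left; exists c; rewrite ?cC.
  by right; exists (Sub c (introT eqP ck) : B).
case=> [[c /andP[cC _] ->]|[b ->]]; first by exists c.
by exists (val b) => //; apply: in_in.
Qed.

Lemma cut_in_minimal b : ~ closed_ideal (relations_but cut_in other_relation b) (cut_in b).
Proof.
move=> H; apply: (Wmin (in_in b)); move: H; apply: closed_ideal_sub => f.
case=> [[c /andP[cC nk] ->]|[b' nb ->]].
  exists c => //; rewrite !inE cC andbT.
  by apply: contraNneq nk => ->; apply: (valP b).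
by exists (val b') => //; rewrite !inE in_in andbT (inj_eq val_inj).
Qed.

(** Without an arrow starting at [k], the relations of the arrows ending at
    [k] would be zero, against minimality, so that [k] would be isolated. *)
Lemma out_arrow_exists : connected_quiver Q -> ~ one_vertex_quiver Q -> exists a : O, True.
Proof.
move=> conn nQ; apply: contrapT => nO.
have nout (a : Q) : src a != k by apply/negP => ak; case: nO; exists (Sub a ak : O).
have nin (b : Q) : tgt b != k.
  apply/negP => bk; pose b' : B := Sub b bk.
  apply: (Wmin (in_in b')); suff -> : cut_relation (C := C) W (val b') = 0 by apply: ideal0.
  rewrite -cut_relation_src (eqP (valP b')); apply: cpaP => v [|x l] vl.
    rewrite coef0 coef_vertexM (@inrad_cut_relation (val b') v [::]) //.
    by rewrite mulr0.
  rewrite coef0 coef_vertexM; case/andP: vl => /eqP <- _.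
  by rewrite (negbTE (nout (val x))) mul0r.
case: nQ; have Vk v : v = k.
  case/connectP: (conn k v) => -[|u s] //= /andP[/existsP[a] + _] _.
  by rewrite (negbTE (nout a)) (negbTE (nin a)) andbF.
split; last by apply: eq_card0 => a; have := nout a; rewrite (Vk (src a)) eqxx.
by rewrite -(card1 k); apply: eq_card => v; rewrite !inE (Vk v) eqxx.
Qed.

End StrictSource.

Section MutatedRelations.
Variables (K : fieldType) (V : finType) (Q : quiver V).
Variables (W W0 : cpa K Q) (C : {set Q}) (k : V).
Hypothesis ksource : strict_source C k.
Hypothesis W0pot : is_potential W0.
Hypothesis W0deg : homogeneous (cut_deg C) 1 W0.
Hypothesis WW0 : cyc_equiv W W0.
Hypothesis nostart : no_cycle_starts_at k W0.
Variable a0 : out_arrow Q k.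

Local Notation M := (mut_quiver Q k).
Local Notation com a := (inl (inl a) : M).
Local Notation comp b a := (inl (inr (b, a)) : M).
Local Notation star a := (inr (inl a) : M).
Local Notation bst b := (inr (inr b) : M).
Local Notation QC := (cut_quiver C).
Local Notation O := (out_arrow Q k).
Local Notation B := (in_arrow Q k).
Local Notation X := (pre_mutation k W0 (cut_deg C)).
Local Notation C' := (degree_one_arrows X : {set M}).
Local Notation Y := (cut_quiver C').

Lemma mut_deg_com a : (com a \in C') = (val a \in C).
Proof. by rewrite inE /= /cut_deg; case: ifP. Qed.

Lemma mut_deg_comp b a : comp b a \in C'.
Proof.
by rewrite inE /= /cut_deg (negbTE (out_notin ksource a)) (in_in ksource b).
Qed.

Lemma mut_deg_star a : star a \notin C'.
Proof. by rewrite inE /= /cut_deg (negbTE (out_notin ksource a)). Qed.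

Lemma mut_deg_bst b : bst b \notin C'.
Proof. by rewrite inE /= /cut_deg (in_in ksource b). Qed.

Lemma mut_deg01 x : gdeg X x = 0 \/ gdeg X x = 1.
Proof.
case: x => [[a|[b a]]|[a|b]] /=; rewrite /cut_deg.
- by case: ifP => _; [right|left].
- by rewrite (negbTE (out_notin ksource a)) (in_in ksource b); right.
- by rewrite (negbTE (out_notin ksource a)); left.
- by rewrite (in_in ksource b); left.
Qed.

Lemma mut_pot_cyclic p : gpot X p != 0 -> is_cycle p.
Proof.
have Wc q : W0 q != 0 -> is_cycle q by case/W0pot.
rewrite /= cpaDE; have [->|/(bracket_cyclic Wc) //] := eqVneq (bracket (k := k) W0 p) 0.
by rewrite add0r; apply: mut_cubic_cyclic.
Qed.

Lemma mut_pot_homogeneous : homogeneous (gdeg X) 1 (gpot X).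
Proof.
by apply: homogeneousD; [apply: bracket_homogeneous|apply: cubic_homogeneous].
Qed.

Definition star_arrow (a : O) : Y := Sub (star a) (mut_deg_star a).
Definition bst_arrow (b : B) : Y := Sub (bst b) (mut_deg_bst b).

(** The composite arrows and the common arrows in [C] have degree 1 and are not
    arrows of [Y], so that the default values [a0] never occur. *)
Definition arrow_kind (y : Y) : QC + (O + B) :=
  match val y with
  | inl (inl a) => if insub (val a) is Some x then inl x else inr (inl a0)
  | inl (inr _) => inr (inl a0)
  | inr z => inr z
  end.

Variant arrow_kind_spec (y : Y) : QC + (O + B) -> Type :=
| CommonArrow a x of val y = com a & val a = val x : arrow_kind_spec y (inl x)
| StarArrow a of val y = star a : arrow_kind_spec y (inr (inl a))
| BstArrow b of val y = bst b : arrow_kind_spec y (inr (inr b)).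

Lemma arrow_kindP y : arrow_kind_spec y (arrow_kind y).
Proof.
rewrite /arrow_kind; have := valP y; case E: (val y) => [[a|[b a]]|[a|b]] yC.
- case: insubP => [x _ xa|]; last by rewrite -mut_deg_com yC.
  by apply: CommonArrow E _.
- by have := mut_deg_comp b a; rewrite (negbTE yC).
- exact: StarArrow E.
- exact: BstArrow E.
Qed.

Lemma arrow_kind_inj : injective arrow_kind.
Proof.
move=> y1 y2; case: arrow_kindP => [a x E1 ax|a E1|b E1]; case: arrow_kindP => //.
- move=> a' x' E2 ax' [xx]; apply: val_inj; rewrite E1 E2; congr (com _).
  by apply: val_inj; rewrite ax ax' xx.
- by move=> a' E2 [aa]; apply: val_inj; rewrite E1 E2 aa.
- by move=> b' E2 [bb]; apply: val_inj; rewrite E1 E2 bb.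
Qed.

Lemma arrow_kind_com y x : arrow_kind y = inl x ->
  [/\ src y = src x, tgt y = tgt x & src x != k].
Proof.
case: arrow_kindP => // a x' E ax [<-]; rewrite /= E /= ax; split=> //.
by rewrite -ax; case/andP: (valP a).
Qed.

Lemma arrow_kind_star y a : arrow_kind y = inr (inl a) ->
  src y = tgt (cut_out ksource a) /\ tgt y = k.
Proof. by case: arrow_kindP => // a' E [<-]; rewrite /= E. Qed.

Lemma arrow_kind_bst y b : arrow_kind y = inr (inr b) ->
  src y = k /\ tgt y = src (val b).
Proof. by case: arrow_kindP => // a' E [<-]; rewrite /= E. Qed.

Lemma arrow_kind_surj (x : QC) : src x != k -> exists y, arrow_kind y = inl x.
Proof.
move=> xk; have xc : (src (val x) != k) && (tgt (val x) != k).
  by rewrite xk (cut_source ksource x).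
pose c : common_arrow Q k := Sub (val x) xc.
have yC : com c \notin C' by rewrite mut_deg_com (valP x).
by exists (Sub (com c) yC : Y); rewrite /arrow_kind /= valK.
Qed.

Local Notation to_mut := (subst (K := K) (common arrow_kind_com)).

Local Notation to_common := (qpmap (common arrow_kind_com)).

(** Only the values at the common arrows matter; [val a0] is a default. *)
Definition underlying (y : Y) : Q := if val y is inl (inl a) then val a else val a0.

Lemma common_underlying (l : seq Y) : all to_common l ->
  map val (pmap to_common l) = map underlying l.
Proof.
elim: l => //= y l IH; rewrite /com_part.
case: (arrow_kindP y) => // a x E ax /= /IH ->.
by rewrite /underlying E ax.
Qed.

Lemma all_common (l : seq Y) :
  all to_common l = all (@unbracket V Q k) (map val l).
Proof.
rewrite all_map; apply: eq_all => y /=; rewrite /com_part.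
by case: (arrow_kindP y) => [a x -> _|a ->|b ->].
Qed.

Lemma unbr_underlying (l : seq Y) : all to_common l ->
  unbr (map val l) = map underlying l.
Proof.
elim: l => //= y l IH; rewrite /com_part.
case: (arrow_kindP y) => // a x E ax /= /IH <-.
by rewrite /unbr /underlying /= E.
Qed.

Lemma coef_to_mut f v l : coef (to_mut f) v l =
  if all to_common l
  then coef f v (pmap to_common l) else 0.
Proof. exact: coef_subst. Qed.

Lemma cyc_der_W0 c v l : coef (cyc_der c W) v l =
  if v == tgt c then \sum_(j < (size l).+1)
    coef W0 (walk_end v (take j l)) (drop j l ++ c :: take j l) else 0.
Proof.
rewrite (cyc_equiv_der WW0) coef_cyc_der // => p.
by case/W0pot.
Qed.

Lemma cyc_der_bracket x v l : coef (cyc_der x (bracket (k := k) W0)) v (map val l) =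
  if (v == tgt x) && all to_common l && unbracket x then
    \sum_(j < (size l).+1) coef W0 (walk_end v (take j (map underlying l)))
      (drop j (map underlying l) ++ unbr [:: x] ++ take j (map underlying l))
  else 0.
Proof.
rewrite coef_cyc_der; last by apply: bracket_cyclic => p /W0pot[].
case: (v =P tgt x) => //= _; rewrite size_map.
have allE (j : nat) : all (@unbracket V Q k) (drop j (map val l) ++ x :: take j (map val l))
    = all to_common l && unbracket x.
  rewrite all_common -{3}(cat_take_drop j (map val l)) !all_cat /=.
  by rewrite andbC -andbA andbC.
case: ifP => [lx|nlx]; last by apply: big1 => j _; rewrite coef_bracket allE nlx.
apply: eq_bigr => j _; rewrite coef_bracket allE lx.
have /andP[al _] := lx; move: (al); rewrite -{1}(cat_take_drop j l) all_cat.
case/andP=> at_ ad; rewrite -cat1s !unbr_cat -!map_take -!map_drop !unbr_underlying //.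
by rewrite -walk_end_unbr -?all_common // unbr_underlying.
Qed.

Lemma relation_com a :
  cut_relation (C := C') (gpot X) (com a) = to_mut (cut_relation (C := C) W (val a)).
Proof.
rewrite !cut_relationE linearD /= cyc_der_mut_com addr0.
apply: cpaP => v l _; rewrite coef_restr cyc_der_bracket coef_to_mut coef_restr.
rewrite cyc_der_W0 /= andbT; case: ifP => [/andP[/eqP -> al]|].
  rewrite al eqxx common_underlying // size_map.
  by apply: eq_bigr => j _.
by case: (all _ l) => //=; rewrite andbT => ->.
Qed.

(** The cycles of [W0] that contain [ba] give the derivative of [W0] along [b] with
    its first arrow [a] removed.  The derivative has one term more, in which the
    cycle would start at [k]. *)
Lemma relation_comp b a : cut_relation (C := C') (gpot X) (comp b a) =
  to_mut (D (cut_out ksource) (@cut_in K V Q W C k) b a) +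
  arrow_elt K (star_arrow a) * arrow_elt K (bst_arrow b).
Proof.
rewrite cut_relationE linearD /= cyc_der_mut_comp rmorphD rmorphM /=.
rewrite -(restr_arrow K (star_arrow a)) -(restr_arrow K (bst_arrow b)); congr (_ + _).
apply: cpaP => v l _; rewrite coef_restr cyc_der_bracket coef_to_mut /D coef_lquot.
rewrite /cut_in cut_relationE coef_restr cyc_der_W0 /= andbT.
case: (all _ l) (@common_underlying l) => [/(_ isT) ->|_]; last by rewrite andbF.
rewrite andbT; case: (v =P _) => // va; rewrite (eqP (valP a)) (eqP (valP b)) eqxx.
rewrite size_map [RHS]big_ord_recl [X in _ = X + _](_ : _ = 0) ?add0r.
  by rewrite va; apply: eq_bigr => j _.
rewrite take0 drop0 /walk_end /=; set m := (_ :: _).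
have [vm|nvm] := boolP (walk k m); last exact: coef_nwalk.
by rewrite coef_walk; apply/eqP; apply: contraT => /nostart; rewrite eqxx.
Qed.

Lemma mut_relationsE f :
  closed_ideal (fun f => exists2 c, c \in C' & f = cut_relation (C := C') (gpot X) c) f <->
  closed_ideal (relationsY (cut_out ksource) (@cut_in K V Q W C k) (@other_relation K V Q W C k)
    arrow_kind_com star_arrow bst_arrow) f.
Proof.
split; apply: closed_ideal_sub => {}f.
  case=> -[[a|[b a]]|[a|b]] xC ->.
  - left; exists (cut_relation (C := C) W (val a)); last exact: relation_com.
    by exists (val a) => //; rewrite -mut_deg_com xC; case/andP: (valP a).
  - by right; exists b, a; apply: relation_comp.
  - by have := mut_deg_star a; rewrite xC.
  - by have := mut_deg_bst b; rewrite xC.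
case=> [[_ [c /andP[cC ck] ->] ->]|[b [a ->]]]; last first.
  by exists (comp b a); [apply: mut_deg_comp|rewrite relation_comp].
have cc : (src c != k) && (tgt c != k).
  by rewrite ck andbT; apply/eqP => /(ksource c).2; rewrite cC.
by exists (com (Sub c cc : common_arrow Q k)); rewrite ?mut_deg_com ?relation_com.
Qed.

End MutatedRelations.

Theorem mutation_endomorphism_algebra (K : fieldType) (V : finType) (Q : quiver V)
    (W : cpa K Q) (C : {set Q}) (k : V) :
  connected_quiver Q -> ~ one_vertex_quiver Q -> is_reduced W ->
  algebraic_cut W C -> strict_source C k ->
  forall (T : lmodType (cut_jacobian W C)) (R : graded_QP K V),
    is_left_tilting_mutation (vertex_idem W C) k T ->
    is_left_mutation k W C R ->
    alg_isomorphic (endo_alg T) (cut_jacobian (gpot R) (degree_one_arrows R)).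
Proof.
move=> conn nQ Wred [_ fd gl2 Wmin] ks T R Tmut [W0 [[W0pot W0deg] WW0 nostart Rred]].
have [a0 _] := out_arrow_exists Wred ks Wmin conn nQ.
have X01 := @mut_deg01 K V Q W0 C k ks.
apply: alg_isomorphic_trans (reduced_part_iso X01 _ _ Rred); last 2 first.
- exact: mut_pot_cyclic.
- exact: mut_pot_homogeneous.
apply: (endo_tilting (cut_source ks) _ _ (@cut_out_surj _ _ _ _ ks) (in_src_neq ks)
  _ _ _ _ _ (@cut_relationsE K V Q W C k ks) fd gl2 (cut_in_minimal ks Wmin)
  (@arrow_kind_inj K V Q W0 C k ks a0) (@arrow_kind_star K V Q W0 C k ks a0)
  (@arrow_kind_bst K V Q W0 C k ks a0) (@arrow_kind_surj K V Q W0 C k ks a0) _ _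
  (@mut_relationsE K V Q W W0 C k ks W0pot WW0 nostart a0) a0 Tmut).
- by move=> a; apply/eqP/(valP a).
- by move=> a a' [aa]; apply: val_inj.
- by move=> b; rewrite /cut_in -{1}(eqP (valP b)); apply: cut_relation_src.
- by move=> b; apply: cut_relation_tgt.
- by move=> b; apply: inrad_cut_relation.
- by move=> f; apply: other_relation_src.
- by move=> f [c _ ->]; apply/(@inrad_le _ _ _ 1 2)/inrad_cut_relation.
- by [].
- by [].
Qed.

Theorem proposition4p2 (K : closedFieldType) (V : finType) (Q : quiver V)
    (W : cpa K Q) (C : {set Q}) (k : V) :
  connected_quiver Q ->
  ~ one_vertex_quiver Q ->
  is_reduced W ->
  algebraic_cut W C ->
  strict_source C k ->
  forall (T : lmodType (cut_jacobian W C)) (R : graded_QP K V),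
    is_left_tilting_mutation (vertex_idem W C) k T ->
    is_left_mutation k W C R ->
    alg_isomorphic (endo_alg T)
      (cut_jacobian (gpot R) (degree_one_arrows R)).
Proof. exact: mutation_endomorphism_algebra. Qed.
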